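(* Let $m\in\mathbb{N}$, $1<p_0<p<p_1<\infty$, $1<\tau_0,\tau_1,\tau<\infty$, $0<\theta\le\infty$, $\alpha_j>0$, $b_j>\frac1\theta$ for $j=1,\dots,m$, $\boldsymbol{\alpha}=(\alpha_1,\dots,\alpha_m)$, $\mathbf{b}=(b_1,\dots,b_m)$, and let $j_0\in\{1,\dots,m\}$; $\mathbf{e}_{j_0}$ denotes the $j_0$-th standard basis vector of $\mathbb{R}^m$. 1. Put $v_j=-b_j+\frac1{\min\{\tau,\theta\}}$, $\beta_j=\alpha_j+\frac1{p_0}-\frac1p$ for $j=1,\dots,m$, $\mathbf{v}=(v_1,\dots,v_m)$, $\boldsymbol{\beta}=(\beta_1,\dots,\beta_m)$. If $\min\{\tau,\theta\}=\tau$, then for any $\varepsilon>0$ there exists a function $f_1\in S_{p_0,\tau_0,\theta}^{\boldsymbol{\beta},\mathbf{v}-\varepsilon\mathbf{e}_{j_0}}B(\mathbb{T}^m)$ such that $f_1\notin \mathrm{Lip}_{p,\tau,\theta}^{(\boldsymbol{\alpha},-\mathbf{b})}(\mathbb{T}^m)$. 2. Put $u_j=\alpha_j+\frac1{p_1}-\frac1p$ (assumed positive, so that the Besov space is defined), $\mu_j=-b_j+\frac1{\max\{\tau,\theta\}}$ for $j=1,\dots,m$, $\mathbf{u}=(u_1,\dots,u_m)$, $\boldsymbol{\mu}=(\mu_1,\dots,\mu_m)$. If $\max\{\tau,\theta\}=\tau$, then for any $\varepsilon>0$ there exists a function $f_2\in \mathrm{Lip}_{p,\tau,\theta}^{(\boldsymbol{\alpha},-\mathbf{b})}(\mathbb{T}^m)$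 such that $f_2\notin S_{p_1,\tau_1,\theta}^{\mathbf{u},\boldsymbol{\mu}+\varepsilon\mathbf{e}_{j_0}}B(\mathbb{T}^m)$.
   Context: $\mathbb{T}^m=[0,2\pi)^m$, $\mathbb{I}^m=[0,1)^m$, and $1/\infty=0$. For $1<p<\infty$, $1\le\tau<\infty$, the Lorentz space $L_{p,\tau}(\mathbb{T}^m)$ consists of real-valued measurable functions $f$, $2\pi$-periodic in each variable, with $\|f\|_{p,\tau}=\left(\int_0^1 (f^*(t))^\tau t^{\tau/p-1}dt\right)^{1/\tau}<\infty$, where $f^*$ is the non-increasing rearrangement of $|f(2\pi\mathbf{x})|$, $\mathbf{x}\in\mathbb{I}^m$. $\mathring{L}_{p,\tau}(\mathbb{T}^m)$ is the set of $f\in L_{p,\tau}(\mathbb{T}^m)$ with $\int_0^{2\pi}f(\mathbf{x})\,dx_j=0$ for every $j=1,\dots,m$. Mixed modulus of smoothness: for $\alpha>0$, $h\in\mathbb{R}$, the difference of order $\alpha$ in the variable $x_k$ is $\Delta_h^\alpha f(\mathbf{x})=\sum_{\nu=0}^\infty(-1)^\nu\binom{\alpha}{\nu}f(\mathbf{x}+(\alpha-\nu)h\mathbf{e}_k)$, where $\mathbf{e}_k$ is the $k$-th standard basis vector and $\binom{\alpha}{0}=1$, $\binom{\alpha}{\nu}=\frac{\alpha(\alpha-1)\cdots(\alpha-\nu+1)}{\nu!}$ for $\nu\ge1$. For $\boldsymbol{\alpha}=(\alpha_1,\dots,\alpha_m)$ with $\alpha_j>0$, $\Delta_{\mathbf{h}}^{\boldsymbol{\alpha}}f$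 is obtained by applying successively the differences of order $\alpha_k$ with step $h_k$ in $x_k$, $k=1,\dots,m$, and $\omega_{\boldsymbol{\alpha}}(f,\mathbf{t})_{p,\tau}=\sup_{|h_1|\le t_1,\dots,|h_m|\le t_m}\|\Delta_{\mathbf{h}}^{\boldsymbol{\alpha}}f\|_{p,\tau}$. Besov space: for $\mathbf{r}$ with $r_j>0$, $\mathbf{c}\in\mathbb{R}^m$, $0<\theta\le\infty$, fix orders $k_j>r_j$, $\mathbf{k}=(k_1,\dots,k_m)$ (different choices give equivalent norms). $S_{p,\tau,\theta}^{\mathbf{r},\mathbf{c}}B(\mathbb{T}^m)$ is the space of $f\in\mathring{L}_{p,\tau}(\mathbb{T}^m)$ with $$\|f\|_{S_{p,\tau,\theta}^{\mathbf{r},\mathbf{c}}B}=\|f\|_{p,\tau}+\left[\int_0^1\cdots\int_0^1\omega_{\mathbf{k}}^\theta(f,\mathbf{t})_{p,\tau}\prod_{j=1}^m\frac{(1-\log t_j)^{\theta c_j}}{t_j^{1+\theta r_j}}dt_1\cdots dt_m\right]^{1/\theta}<\infty .$$ Logarithmic Lipschitz space: $\mathrm{Lip}_{p,\tau,\theta}^{(\boldsymbol{\alpha},-\mathbf{b})}(\mathbb{T}^m)$ is the space of all $f\in\mathring{L}_{p,\tau}(\mathbb{T}^m)$ with $$\|f\|_{\mathrm{Lip}_{p,\tau,\theta}^{(\boldsymbol{\alpha},-\mathbf{b})}}=\|f\|_{p,\tau}+\left[\int_0^1\cdots\int_0^1\omega_{\boldsymbol{\alpha}}^\theta(f,\mathbf{t})_{p,\tau}\Bigl(\prod_{j=1}^m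 t_j^{-\alpha_j}(1-\log t_j)^{-b_j}\Bigr)^\theta\prod_{j=1}^m\frac{dt_j}{t_j}\right]^{1/\theta}<\infty .$$ For third index $\infty$ both integral expressions are replaced by suprema over $\mathbf{t}\in(0,1)^m$, of $\omega_{\mathbf{k}}(f,\mathbf{t})_{p,\tau}\prod_j t_j^{-r_j}(1-\log t_j)^{c_j}$ and of $\omega_{\boldsymbol{\alpha}}(f,\mathbf{t})_{p,\tau}\prod_j t_j^{-\alpha_j}(1-\log t_j)^{-b_j}$ respectively. *)

(* Defs.v *)
From HB Require Import structures.
From mathcomp Require Import all_boot all_order all_algebra.
From mathcomp Require Import all_classical all_reals all_analysis.

Set Implicit Arguments.
Unset Strict Implicit.
Unset Printing Implicit Defensive.

Import Order.TTheory GRing.Theory Num.Theory.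
Import numFieldNormedType.Exports.

Local Open Scope classical_set_scope.
Local Open Scope ring_scope.

Section cons_measure.
Context {R : realType} d (T : measurableType d) (n : nat).
Variable nu : {sigma_finite_measure set T -> \bar R}.
Variable mu : {sigma_finite_measure set (n.-tuple T) -> \bar R}.

Definition cons_pair (y : T * n.-tuple T) : n.+1.-tuple T :=
  [tuple of y.1 :: y.2].

Lemma measurable_cons_pair : measurable_fun setT cons_pair.
Proof. exact: measurable_cons. Qed.

Definition cons_measure : set (n.+1.-tuple T) -> \bar R :=
  pushforward (nu \x mu)%E cons_pair.

Let cons_measure0 : cons_measure set0 = 0%E.
Proof. by rewrite /cons_measure /pushforward preimage_set0 measure0. Qed.

Let cons_measure_ge0 A : (0 <= cons_measure A)%E.
Proof. by rewrite /cons_measure /pushforward measure_ge0. Qed.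

Let cons_measure_semi_sigma_additive : semi_sigma_additive cons_measure.
Proof.
move=> F mF tF mUF; rewrite /cons_measure /pushforward preimage_bigcup.
have mpre A : measurable A -> measurable (cons_pair @^-1` A).
  by move=> mA; rewrite -[X in measurable X]setTI; exact: measurable_cons_pair.
apply: measure_semi_sigma_additive => [i||].
- exact: mpre.
- apply/trivIsetP => /= i j _ _ ij; rewrite -preimage_setI.
  by move/trivIsetP : tF => /(_ _ _ _ _ ij) ->//; rewrite preimage_set0.
- by rewrite -preimage_bigcup; exact: mpre.
Qed.

HB.instance Definition _ := isMeasure.Build _ _ _ cons_measure
  cons_measure0 cons_measure_ge0 cons_measure_semi_sigma_additive.

Let cons_measure_sigma_finite : sigma_finite setT cons_measure.
Proof.
have /sigma_finiteP[F [FT ndF Foo]] := sigma_finiteT nu.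
have /sigma_finiteP[G [GT ndG Goo]] := sigma_finiteT mu.
pose un (y : n.+1.-tuple T) : T * n.-tuple T := (thead y, [tuple of behead y]).
have mun : measurable_fun setT un.
  apply/measurable_fun_pair; first exact: measurable_tnth.
  exact: measurable_behead.
have unK : cancel cons_pair un.
  by move=> [x t]; rewrite /un/=; congr pair; exact/val_inj.
exists (fun i => un @^-1` (F i `*` G i)).
  apply/esym; rewrite -subTset => y _.
  have [i _ Fi] : (\bigcup_i F i) (un y).1 by rewrite -FT.
  have [j _ Gj] : (\bigcup_i G i) (un y).2 by rewrite -GT.
  exists (maxn i j) => //; split.
  - by move: Fi; exact/subsetPset/ndF/leq_maxl.
  - by move: Gj; exact/subsetPset/ndG/leq_maxr.
move=> i; have [mF nuF] := Foo i; have [mG muG] := Goo i; split.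
  by rewrite -[X in measurable X]setTI; apply: mun => //; exact: measurableX.
rewrite /cons_measure /pushforward.
have -> : cons_pair @^-1` (un @^-1` (F i `*` G i)) = F i `*` G i.
  by apply/funext => y; rewrite -[in RHS](unK y).
by rewrite product_measure1E// lte_mul_pinfty// ge0_fin_numE.
Qed.

HB.instance Definition _ := @Measure_isSigmaFinite.Build _ _ _ cons_measure
  cons_measure_sigma_finite.

End cons_measure.

Section mixed_smoothness.
Context {R : realType}.

(* Lebesgue measure on R^m, on the product Borel sigma-algebra that the library
   puts on tuples. *)
Fixpoint lebesgue_tuple m : {sigma_finite_measure set (m.-tuple (measurableTypeR R)) -> \bar R} :=
  match m with
  | 0 => \d_([tuple] : 0.-tuple (measurableTypeR R))
  | m'.+1 => cons_measure lebesgue_measure (lebesgue_tuple m')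
  end.

Variable m : nat.
Implicit Types (f : m.-tuple R -> R) (x t h : m.-tuple R) (j : 'I_m).

Local Notation mu := (lebesgue_tuple m).

Definition translate j (s : R) x : m.-tuple R :=
  [tuple tnth x i + (i == j)%:R * s | i < m].

Definition replace_coord j (s : R) x : m.-tuple R :=
  [tuple if i == j then s else tnth x i | i < m].

Definition unit_cube : set (m.-tuple R) := [set x | forall j, 0 <= tnth x j < 1].

Definition open_unit_cube : set (m.-tuple R) :=
  [set t | forall j, 0 < tnth t j < 1].

Definition distribution_fun f (s : R) : \bar R :=
  mu (unit_cube `&` [set x | s < `|f [tuple 2 * pi * tnth x i | i < m]|]).

Definition rearrangement f (t : R) : \bar R :=
  ereal_inf [set s%:E | s in [set s | 0 <= s /\ (distribution_fun f s <= t%:E)%E]].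

Definition lorentz_norm (p tau : R) f : \bar R :=
  (poweR (\int[lebesgue_measure]_(t in `]0%R, 1%R[)
            (poweR (rearrangement f t) tau * (t `^ (tau / p - 1))%:E))
         tau^-1)%E.

Definition lorentz (p tau : R) : set (m.-tuple R -> R) :=
  [set f | [/\ measurable_fun setT f,
               forall j x, f (translate j (2 * pi) x) = f x
             & (lorentz_norm p tau f < +oo)%E]].

(* The elements of the space are classes modulo null sets, hence the vanishing
   of the one-dimensional means is required almost everywhere. An extended
   integral with value 0 is in particular absolutely convergent. *)
Definition lorentz0 (p tau : R) : set (m.-tuple R -> R) :=
  [set f | lorentz p tau f /\
    forall j, {ae mu, forall x,
      (\int[lebesgue_measure]_(s in `[0%R, (2 * pi)%R])
         (f (replace_coord j s x))%:E = 0)%E}].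

Definition gbinomial (a : R) (n : nat) : R :=
  (\prod_(i < n) (a - i%:R)) / n`!%:R.

(* For a > 0 and f in a Lorentz space the series converges absolutely for
   almost every x, so the arbitrary value of a divergent limit is irrelevant. *)
Definition difference (a s : R) j f : m.-tuple R -> R := fun x =>
  limn (series (fun nu => (-1) ^+ nu * gbinomial a nu *
                          f (translate j ((a - nu%:R) * s) x))).

Definition mixed_difference (a : 'rV[R]_m) h f : m.-tuple R -> R :=
  foldl (fun g j => difference (a 0 j) (tnth h j) j g) f (enum 'I_m).

Definition mixed_modulus (p tau : R) (a : 'rV[R]_m) f t : \bar R :=
  ereal_sup [set lorentz_norm p tau (mixed_difference a h f) |
             h in [set h | forall j, `|tnth h j| <= tnth t j]].

(* The third index is an extended real; only 0 < theta <= +oo is meant. *)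
Definition besov_seminorm (p tau : R) (theta : \bar R) (r c k : 'rV[R]_m) f
    : \bar R :=
  match theta with
  | q%:E =>
      (poweR (\int[mu]_(t in open_unit_cube)
                (poweR (mixed_modulus p tau k f t) q *
                 (\prod_j ((1 - ln (tnth t j)) `^ (q * c 0 j) /
                           tnth t j `^ (1 + q * r 0 j)))%:E))
             q^-1)%E
  | +oo%E =>
      ereal_sup [set (mixed_modulus p tau k f t *
                      (\prod_j (tnth t j `^ (- r 0 j) *
                                (1 - ln (tnth t j)) `^ c 0 j))%:E)%E |
                 t in open_unit_cube]
  | -oo%E => 0%E
  end.

(* k is the vector of orders of the modulus, to be taken with r_j < k_j. *)
Definition besov (p tau : R) (theta : \bar R) (r c k : 'rV[R]_m)
    : set (m.-tuple R -> R) :=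
  [set f | lorentz0 p tau f /\
    (lorentz_norm p tau f + besov_seminorm p tau theta r c k f < +oo)%E].

Definition log_lip_seminorm (p tau : R) (theta : \bar R) (a b : 'rV[R]_m) f
    : \bar R :=
  match theta with
  | q%:E =>
      (poweR (\int[mu]_(t in open_unit_cube)
                (poweR (mixed_modulus p tau a f t) q *
                 ((\prod_j (tnth t j `^ (- a 0 j) *
                            (1 - ln (tnth t j)) `^ (- b 0 j))) `^ q *
                  \prod_j (tnth t j)^-1)%:E))
             q^-1)%E
  | +oo%E =>
      ereal_sup [set (mixed_modulus p tau a f t *
                      (\prod_j (tnth t j `^ (- a 0 j) *
                                (1 - ln (tnth t j)) `^ (- b 0 j)))%:E)%E |
                 t in open_unit_cube]
  | -oo%E => 0%E
  end.

(* The space Lip^(a, -b): the sign of b is built in. *)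
Definition log_lip (p tau : R) (theta : \bar R) (a b : 'rV[R]_m)
    : set (m.-tuple R -> R) :=
  [set f | lorentz0 p tau f /\
    (lorentz_norm p tau f + log_lip_seminorm p tau theta a b f < +oo)%E].

End mixed_smoothness.

Arguments besov {R} m.
Arguments log_lip {R} m.

(* Main.v *)
Require Import Defs.
From HB Require Import structures.
From mathcomp Require Import all_boot all_order all_algebra.
From mathcomp Require Import all_classical all_reals all_analysis.
From mathcomp Require Import measurable_realfun ring lra zify.

Set Implicit Arguments.
Unset Strict Implicit.
Unset Printing Implicit Defensive.

Import Order.TTheory GRing.Theory Num.Theory.
Import numFieldNormedType.Exports.

Local Open Scope classical_set_scope.
Local Open Scope ring_scope.

(** Both parts rest on one family of test functions. In the coordinate j0 take
    the lacunary series G = sum_s a_s phi_s, where the phi_s are smooth bumps of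
    the same height on pairwise disjoint intervals of length comparable to 2^-s,
    and a_s = 2^(-gamma s) (s+1)^(-lambda) with gamma = alpha_j0 - 1/p. In each of
    the other coordinates take a single bump. Subtract from every factor its mean
    and multiply the factors.

    The difference of order k and step 2^-n of phi_s has size about
    min(1, 2^(s-n))^k, and up to tails it lives on a set of measure about 2^-s, so
    that its norm in L_(q,T) is about 2^(-s/q) min(1, 2^(s-n))^k. What happens
    when these contributions are summed over s depends on k and q.

    - If gamma + 1/q < k, the sum is a convolution with a kernel that decays
      geometrically away from s = n. Only s close to n matters, whatever T is, and
      the modulus at t_j0 = 2^-n is about 2^(-(gamma+1/q) n) (n+1)^(-lambda)
      (mixed_modulus_sub_le, mixed_modulus_sub_ge). This is the case of the Besov
      spaces, where q is p0 or p1.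
    - If k = alpha_j0 and q = p, then gamma + 1/q = k, and every s <= n
      contributes with the same power 2^(-alpha_j0 n). These contributions sit on
      sets of measure 2^-s, hence add up in the l_T norm. The modulus is at least
      a constant times 2^(-alpha_j0 n) (n+1)^(1/T - lambda)
      (mixed_modulus_critical_ge), and at most a constant times the same quantity
      if lambda T < 1 (mixed_modulus_critical_le). This is the case of the
      Lipschitz space, with T = tau.

    The power of 2^-n cancels against the weight of the seminorm, and what is left
    is the integral of (1 - log t)^(theta E) dt / t over (0,1), finite when
    E < -1/theta and infinite when E > -1/theta (besov_seminorm_lt,
    besov_seminorm_pinfty). For the Lipschitz space E = 1/tau - lambda - b_j0; for
    a Besov space with logarithmic exponent c it is E = c - lambda. At
    c = 1/tau - b_j0 the two conditions on lambda are the same; a shift of c by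
    -eps or by +eps opens a gap between them, and lambda is chosen in this gap. In
    the second part lambda must also satisfy lambda tau < 1, which is possible
    because b_j0 > 1/theta.

    The upper bounds for the differences are obtained by duality: a bound of the
    integral of |difference| against every 1-periodic function with values in
    [0,1] and integral u controls the measure of the set where the difference is
    large (tint_fdiff_atom_le, fdiff_super_superset). The lower bounds exhibit an
    interval of length about 2^-s on which the difference is large
    (fdiff_super_lower). *)

(** * Coefficients of fractional differences *)

Section binomial_coefficients.
Context {R : realType}.
Implicit Types (k a : R) (n : nat).

Definition dcoef k n : R := (-1) ^+ n * gbinomial k n.

Lemma dcoef0 k : dcoef k 0 = 1.
Proof. by rewrite /dcoef /gbinomial big_ord0 expr0 fact0 !mul1r invr1. Qed.

Lemma dcoefS k n : dcoef k n.+1 = dcoef k n * ((n%:R - k) / n.+1%:R).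
Proof.
rewrite /dcoef /gbinomial big_ord_recr /= factS natrM exprS.
have f0 : n`!%:R != 0 :> R by rewrite pnatr_eq0 -lt0n fact_gt0.
have n1 : n.+1%:R != 0 :> R by rewrite pnatr_eq0.
rewrite -(natr1 n) in n1 *; field; exact/andP.
Qed.

Lemma dcoefS_lower k n : n.+1%:R * dcoef k n.+1 = - k * dcoef (k - 1) n.
Proof.
elim: n => [|n IH]; first by rewrite dcoefS !dcoef0; field.
rewrite dcoefS [in RHS]dcoefS.
have n1 : n.+1%:R != 0 :> R by rewrite pnatr_eq0.
have n2 : n.+2%:R != 0 :> R by rewrite pnatr_eq0.
transitivity ((n.+1%:R * dcoef k n.+1) * ((n.+1%:R - k) / n.+1%:R)).
  by field; apply/andP.
rewrite IH; rewrite -(natr1 n) in n1 *; field; exact: n1.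
Qed.

(** The identity behind both the summation formula [sum_dcoef] and the
    semigroup property [fdiffS] of differences. *)
Lemma dcoef_pascal k n : dcoef k n.+1 = dcoef (k - 1) n.+1 - dcoef (k - 1) n.
Proof.
have n1 : n.+1%:R != 0 :> R by rewrite pnatr_eq0.
apply: (mulfI n1); rewrite dcoefS_lower mulrBr (dcoefS (k - 1)).
rewrite -(natr1 n) in n1 *; field; exact: n1.
Qed.

(** Partial sums of the coefficients of order k are the coefficients of
    order k - 1; their decay gives cancellation in the series of a difference. *)
Lemma sum_dcoef k n : \sum_(0 <= i < n.+1) dcoef k i = dcoef (k - 1) n.
Proof.
elim: n => [|n IH]; first by rewrite big_nat1 !dcoef0.
by rewrite big_nat_recr //= IH dcoef_pascal addrC subrK.
Qed.

Definition harm n : R := \sum_(0 <= i < n) (i.+1%:R)^-1.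

Lemma harmS n : harm n.+1 = harm n + (n.+1%:R)^-1.
Proof. by rewrite /harm big_nat_recr. Qed.

Lemma ln_le_harm n : ln n.+1%:R <= harm n.
Proof.
elim: n => [|n IH]; first by rewrite /harm big_geq // ln1.
rewrite harmS.
have -> : n.+2%:R = n.+1%:R * (1 + n.+1%:R^-1) :> R.
  by rewrite mulrDr mulr1 divff ?pnatr_eq0 // natr1.
have i0 : (0 : R) < n.+1%:R^-1 by rewrite invr_gt0 ltr0n.
rewrite lnM ?posrE ?ltr0n ?addr_gt0 // lerD //.
by rewrite le_ln1Dx // (lt_trans _ i0) // ltrN10.
Qed.

Lemma harm_le_ln n : harm n <= 1 + ln n.+1%:R.
Proof.
case: n => [|n]; first by rewrite /harm big_geq // ln1 addr0 ler01.
suff h : harm n.+1 <= 1 + ln n.+1%:R.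
  by rewrite (le_trans h) // lerD2l ler_ln ?posrE ?ltr0n // ler_nat.
elim: n => [|n IH]; first by rewrite /harm big_nat1 invr1 lerDl ln_ge0.
rewrite harmS.
set u : R := n.+2%:R^-1.
have u0 : 0 < u by rewrite invr_gt0 ltr0n.
have u1 : u < 1 by rewrite invf_lt1 ?ltr0n // ltr1n.
have E : n.+1%:R = n.+2%:R * (1 - u) :> R.
  by rewrite mulrBr mulr1 divff ?pnatr_eq0 // -[n.+2%:R]natr1 addrK.
have : ln n.+1%:R <= ln n.+2%:R - u.
  rewrite E lnM ?posrE ?ltr0n ?subr_gt0 // lerD2l.
  by rewrite le_ln1Dx // ltrN2.
lra.
Qed.

Lemma bounded_of_eventually_noninc (u : nat -> R) N :
  (forall n, 0 <= u n) -> (forall n, (N <= n)%N -> u n.+1 <= u n) ->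
  exists2 C, 0 < C & forall n, u n <= C.
Proof.
move=> u0 uN; exists (1 + \sum_(0 <= i < N.+1) u i).
  by rewrite ltr_pwDl // sumr_ge0.
have le1 n : (n <= N)%N -> u n <= 1 + \sum_(0 <= i < N.+1) u i.
  move=> nN; rewrite (bigD1_seq n) ?mem_index_iota ?iota_uniq //=.
  by rewrite addrCA lerDl addr_ge0 // sumr_ge0.
move=> n; have [/le1//|/ltnW Nn] := leqP n N.
apply: le_trans (le1 N (leqnn N)).
rewrite -(subnKC Nn); elim: (n - N)%N => [|j IH]; first by rewrite addn0.
by rewrite addnS (le_trans _ IH) // uN // leq_addr.
Qed.

Lemma dcoef_norm_eventually a n : a <= n%:R ->
  `|dcoef a n.+1| = `|dcoef a n| * (1 - (a + 1) / n.+1%:R).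
Proof.
move=> an; rewrite dcoefS normrM; congr (_ * _).
have n1 : n.+1%:R != 0 :> R by rewrite pnatr_eq0.
rewrite ger0_norm; last by rewrite divr_ge0 ?subr_ge0.
rewrite -(natr1 n) in n1 *; field; exact: n1.
Qed.

Lemma exists_nat_ge a : exists N : nat, a <= N%:R.
Proof.
exists (Num.trunc `|a|).+1.
by rewrite (le_trans (ler_norm a)) // ltW // truncnS_gt.
Qed.

(** The recursion multiplies the modulus of the coefficient by
    1 - (a+1)/(n+1) <= exp(-(a+1)/(n+1)), so that its product with
    exp((a+1) H_n), H_n the harmonic sum, is eventually non-increasing. *)
Lemma dcoef_le_powR a :
  exists2 C, 0 < C & forall n, `|dcoef a n| <= C * n.+1%:R `^ (- (a + 1)).
Proof.
have [N aN] := exists_nat_ge a.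
pose u n := `|dcoef a n| * expR ((a + 1) * harm n).
have [||C C0 uC] := @bounded_of_eventually_noninc u N.
- by move=> n; rewrite mulr_ge0 ?expR_ge0.
- move=> n Nn; rewrite /u harmS dcoef_norm_eventually; last first.
    by rewrite (le_trans aN) // ler_nat.
  rewrite (mulrDr (a + 1)) expRD -mulrA ler_wpM2l // mulrCA ler_piMr ?expR_ge0 //.
  rewrite -ler_pdivlMr ?expR_gt0 // -expRN mul1r.
  by rewrite -mulrN (le_trans _ (expR_ge1Dx _)) // mulrN.
exists (C * expR `|a + 1|); first by rewrite mulr_gt0 ?expR_gt0.
move=> n; have := uC n; rewrite /u -ler_pdivlMr ?expR_gt0 // -expRN => h.
apply: (le_trans h); rewrite -mulrA ler_pM2l // /powR pnatr_eq0 /= -expRD.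
rewrite ler_expR.
have h1 := ln_le_harm n; have h2 := harm_le_ln n.
have [a1|a1] := leP 0 (a + 1).
  rewrite ger0_norm //.
  have := ler_wpM2l a1 h1; lra.
rewrite ltr0_norm //.
have := ler_wpM2l (ltW (_ : 0 < - (a + 1))) h2; rewrite oppr_gt0 => /(_ a1); lra.
Qed.

Lemma dcoef_cvg0 k : 0 < k -> dcoef (k - 1) n @[n --> \oo] --> (0 : R).
Proof.
move=> k0; have [C C0 hC] := dcoef_le_powR (k - 1).
apply/cvgrPdist_lt => e e0.
have [N hN] := exists_nat_ge ((C / e) `^ k^-1).
near=> n; rewrite sub0r normrN (le_lt_trans (hC n)) // subrK.
rewrite powRN -ltr_pdivlMr ?invr_gt0 ?powR_gt0 // invrK mulrC -ltr_pdivrMr //.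
rewrite -[X in X < _](@powRr1 _ (C / e)) ?divr_ge0 ?ltW //.
rewrite -[X in _ `^ X](mulVf (lt0r_neq0 k0)) powRrM gt0_ltr_powR ?nnegrE ?powR_ge0 //.
rewrite (le_lt_trans hN) // ltr_nat.
by near: n; exists N.
Unshelve. all: by end_near.
Qed.

(** The ratio of consecutive coefficients is (n - k)/(n + 1), which is
    nonnegative from n = K on. Hence sums of absolute values of a tail are
    absolute values of sums of this tail, which telescope by [sum_dcoef]. *)
Lemma dcoef_sign k K : k <= K%:R ->
  exists2 sg : R, sg * sg = 1 & forall n, (K <= n)%N -> `|dcoef k n| = sg * dcoef k n.
Proof.
move=> kK; exists (if 0 <= dcoef k K then 1 else -1).
  by case: ifP => _; rewrite ?mulr1 // mulrNN mulr1.
move=> n /subnKC <-; elim: (n - K)%N => [|j IH].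
  rewrite addn0; case: ifPn => h; first by rewrite mul1r ger0_norm.
  by rewrite mulN1r ltr0_norm // ltNge.
rewrite addnS dcoefS normrM IH mulrA ger0_norm // divr_ge0 // subr_ge0.
by rewrite (le_trans kK) // ler_nat leq_addr.
Qed.

Lemma dcoef_summable k : 0 <= k ->
  exists2 C, 0 < C & forall n, \sum_(0 <= i < n) `|dcoef k i| <= C.
Proof.
move=> k0; have [K kK] := exists_nat_ge k.
have [sg sg1 hsg] := dcoef_sign kK.
have sgn : `|sg| = 1.
  by apply/eqP; rewrite -(@eqrXn2 _ 2) // -normrX expr2 sg1 normr1 expr1n.
have [C C0 hC] := dcoef_le_powR (k - 1).
have hS n : `|\sum_(0 <= i < n) dcoef k i| <= C.
  case: n => [|n]; first by rewrite big_geq // normr0 ltW.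
  rewrite sum_dcoef (le_trans (hC n)) // ler_piMr ?(ltW C0) // subrK.
  by rewrite -[leRHS](powRr0 n.+1%:R) ler_powR ?ler1n // oppr_le0.
exists (2 * C + \sum_(0 <= i < K) `|dcoef k i|).
  by rewrite ltr_pwDl ?mulr_gt0 // sumr_ge0.
move=> n; have [nK|/ltnW Kn] := leqP n K.
  rewrite -[leLHS]add0r lerD ?mulr_ge0 ?(ltW C0) //.
  by rewrite (big_cat_nat _ nK) //= lerDl sumr_ge0.
rewrite (big_cat_nat _ Kn) //= addrC lerD2r.
under eq_big_nat => i /andP[Ki _] do rewrite hsg //.
rewrite -mulr_sumr.
have -> : \sum_(K <= i < n) dcoef k i =
    \sum_(0 <= i < n) dcoef k i - \sum_(0 <= i < K) dcoef k i.
  by rewrite [in RHS](big_cat_nat _ Kn) //= addrAC subrr add0r.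
rewrite (le_trans (ler_norm _)) // normrM sgn mul1r (le_trans (ler_normB _ _)) //.
by rewrite mulr2n mulrDl mul1r lerD.
Qed.

Lemma dcoef_neq0 k n : (forall i : nat, i%:R != k) -> dcoef k n != 0.
Proof.
move=> hk; elim: n => [|n IH]; first by rewrite dcoef0 oner_neq0.
have h : n%:R - k != 0 by rewrite subr_eq0.
by rewrite dcoefS mulf_neq0 // mulf_neq0 // invr_neq0 // pnatr_eq0.
Qed.

Lemma dcoef_nat_eq0 (k n : nat) : (k < n)%N -> dcoef k%:R n = 0.
Proof.
case: n => // n; rewrite ltnS => /subnKC <-; elim: (n - k)%N => [|j IH].
  by rewrite addn0 dcoefS subrr mul0r mulr0.
by rewrite addnS dcoefS IH mul0r.
Qed.

(** The same product as in [dcoef_le_powR], bounded from below through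
    1 - (k+1)/(v+k+1) = 1/(1 + (k+1)/v) >= exp(-(k+1)/v). For integral k the
    coefficients vanish from k + 1 on, which is why integers are excluded. *)
Lemma dcoef_ge_powR k K : 0 < k -> k < K%:R -> (forall i : nat, i%:R != k) ->
  exists2 c, 0 < c &
    forall n, (K <= n)%N -> c * n.+1%:R `^ (- (k + 1)) <= `|dcoef k n|.
Proof.
move=> k0 kK hk.
have aux (v a : R) : 0 < v -> 0 < a -> 1 - a / (v + a) = (1 + a / v)^-1.
  move=> vp ap; have v1 := lt0r_neq0 vp; have v2 := lt0r_neq0 (addr_gt0 vp ap).
  have -> : 1 + a / v = (v + a) / v by field.
  by rewrite invf_div; field.
pose S j : R := \sum_(0 <= i < j) ((K + i)%:R - k)^-1.
have v0 i : 0 < (K + i)%:R - k.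
  by rewrite subr_gt0 (lt_le_trans kK) // ler_nat leq_addr.
have Sle j : S j.+1 <= (K%:R - k)^-1 + harm j.
  elim: j => [|j IH].
    by rewrite /S /harm big_nat1 big_geq // addn0 addr0.
  rewrite harmS /S big_nat_recr //= -/(S j.+1) (le_trans (lerD IH (lexx _))) //.
  rewrite -addrA lerD2l lerD2l lef_pV2 ?posrE // ?ltr0n //.
  rewrite natrD; move: (ltW kK); lra.
have lo j : `|dcoef k K| * expR (- (k + 1) * S j) <= `|dcoef k (K + j)|.
  elim: j => [|j IH].
    by rewrite /S big_geq // mulr0 expR0 mulr1 addn0.
  rewrite addnS dcoef_norm_eventually; last first.
    by rewrite (le_trans (ltW kK)) // ler_nat leq_addr.
  rewrite /S big_nat_recr //= -/(S j) mulrDr expRD mulrA ler_pM //.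
  have vj := v0 j; set v := (K + j)%:R - k in vj *.
  have -> : (K + j).+1%:R = v + (k + 1) :> R by rewrite -natr1 /v; ring.
  have kp : 0 < k + 1 by rewrite addr_gt0.
  have -> : 1 - (k + 1) / (v + (k + 1)) = (1 + (k + 1) / v)^-1.
    exact: aux.
  rewrite mulNr expRN lef_pV2 ?posrE ?expR_gt0 ?expR_ge1Dx //.
  by rewrite addr_gt0 ?divr_gt0.
have cK : 0 < `|dcoef k K| by rewrite normr_gt0 dcoef_neq0.
exists (`|dcoef k K| * expR (- (k + 1) * ((K%:R - k)^-1 + 1))).
  by rewrite mulr_gt0 ?expR_gt0.
move=> n /subnKC <-; set j := (n - K)%N.
apply: le_trans (lo j); rewrite -mulrA ler_pM2l //.
rewrite /powR pnatr_eq0 /= -expRD ler_expR !mulNr -opprD lerN2 -mulrDr.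
have SjS : S j <= S j.+1.
  by rewrite /S big_nat_recr //= lerDl invr_ge0 ltW.
rewrite ler_pM2l ?addr_gt0 // (le_trans SjS) // (le_trans (Sle j)) //.
rewrite -addrA lerD2l.
rewrite (le_trans (harm_le_ln j)) // lerD2l ler_ln ?posrE ?ltr0n //.
by rewrite ler_nat ltnS leq_addl.
Qed.

End binomial_coefficients.

(** * Integration of periodic functions *)

Section le_integral_any.
Local Open Scope ereal_scope.
Context d (T : measurableType d) (R : realType).
Context (mu : {measure set T -> \bar R}).

(** The integral of a nonnegative function is a supremum over simple
    functions below it, so monotonicity holds for non-measurable functions as
    well. This is what allows integrating moduli of smoothness and
    rearrangements without proving them measurable. *)
Lemma le_integral_ge0 (D : set T) (f g : T -> \bar R) :
  (forall x, D x -> 0 <= f x) -> (forall x, D x -> f x <= g x) ->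
  \int[mu]_(x in D) f x <= \int[mu]_(x in D) g x.
Proof.
move=> f0 fg.
have g0 x : D x -> 0 <= g x by move=> Dx; rewrite (le_trans (f0 x Dx)) ?fg.
rewrite !ge0_integralE //; apply: le_ereal_sup => _ /= [h hf <-].
exists h => // x; rewrite (le_trans (hf x)) // /patch.
by case: ifPn => // /set_mem; exact: fg.
Qed.

End le_integral_any.

Section period_one.
Local Open Scope ereal_scope.
Context {R : realType}.
Local Notation mu := (@lebesgue_measure R).

Lemma lebesgue_measure_shift (y : R) (A : set R) : measurable A ->
  mu ((fun x : R => x + y)%R @^-1` A) = mu A.
Proof.
move=> mA.
have msh : measurable_fun setT (fun x : measurableTypeR R => (x + y)%R : measurableTypeR R).
  by apply: measurable_funD => //; exact: measurable_cst.
pose mm := HB.pack_for {mfun measurableTypeR R >-> measurableTypeR R}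
  (fun x : measurableTypeR R => (x + y)%R : measurableTypeR R)
  (isMeasurableFun.Build _ _ _ _ _ msh).
apply/esym.
have := @lebesgue_measure_unique R (pushforward mu mm).
apply => // _ [[a b]] _ <-.
rewrite /pushforward/=.
rewrite [X in _ = mu X](_ : _ = `](a - y)%R, (b - y)%R]%classic); last first.
  by apply/seteqP; split => x /=; rewrite !in_itv /= ltrBlDr lerBrDr.
rewrite !lebesgue_measure_itv/= !lte_fin ltrD2r.
by case: ifPn => // _; rewrite -!EFinB; congr (_%:E); ring.
Qed.

Lemma ge0_integral_shift (y : R) (D : set R) (F : R -> \bar R) :
  measurable D -> measurable_fun [set: R] F -> (forall x, 0 <= F x) ->
  \int[mu]_(x in (fun x : R => x + y)%R @^-1` D) F (x + y)%R =
  \int[mu]_(x in D) F x.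
Proof.
move=> mD mF F0.
have msh : measurable_fun setT (fun x : measurableTypeR R => (x + y)%R : measurableTypeR R).
  by apply: measurable_funD => //; exact: measurable_cst.
rewrite -[LHS](@ge0_integral_pushforward _ _ _ _ _ _ msh mu D F) //.
- by apply: eq_measure_integral => A mA AS; exact: lebesgue_measure_shift.
- exact: measurable_funS mF.
Qed.

Definition fracp (z : R) : R := (z - (Num.floor z)%:~R)%R.

Lemma fracp_itv z : (0 <= fracp z < 1)%R.
Proof.
rewrite /fracp subr_ge0 ge_floor /= ltrBlDl.
by have := floorD1_gt z; rewrite intrD addrC.
Qed.

Lemma fracpE z (l : int) : (l%:~R <= z < l%:~R + 1)%R -> fracp z = (z - l%:~R)%R.
Proof. by move=> h; rewrite /fracp (@floor_def _ z l) // intrD. Qed.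

Lemma fracp_id z : (0 <= z < 1)%R -> fracp z = z.
Proof. by move=> h; rewrite (@fracpE _ 0) ?subr0 // add0r. Qed.

Lemma fracpD z (l : int) : fracp (z + l%:~R) = fracp z.
Proof.
rewrite (@fracpE _ (Num.floor z + l)) ?intrD; last first.
  have := fracp_itv z; rewrite /fracp; lra.
rewrite /fracp; ring.
Qed.

Lemma measurable_fracp : measurable_fun setT fracp.
Proof.
apply: measurable_funB => //; apply: nondecreasing_measurable => // x y xy.
by rewrite ler_int; exact: le_floor.
Qed.

Definition per1 {T : Type} (F : R -> T) := forall z (l : int), F (z + l%:~R)%R = F z.

(** Cut the shifted period at the integer it contains and move the part
    beyond this integer back by 1: the result is a period with integral ends. *)
Lemma integral_per1_shift (y : R) (F : R -> \bar R) :
  measurable_fun [set: R] F -> (forall x, 0 <= F x) -> per1 F ->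
  \int[mu]_(x in `[0%R, 1%R[) F (x + y)%R = \int[mu]_(x in `[0%R, 1%R[) F x.
Proof.
move=> mF F0 pF.
have sh (a b c : R) : (fun x : R => x + c)%R @^-1` `[(a + c)%R, (b + c)%R[%classic =
    `[a, b[%classic.
  by apply/seteqP; split => x /=; rewrite !in_itv /= lerD2r ltrD2r.
have shI (a b c : R) : \int[mu]_(x in `[a, b[) F (x + c)%R =
    \int[mu]_(x in `[(a + c)%R, (b + c)%R[) F x.
  by rewrite -[RHS](ge0_integral_shift c) // sh.
have shZ (a b : R) (l : int) : \int[mu]_(x in `[(a + l%:~R)%R, (b + l%:~R)%R[) F x =
    \int[mu]_(x in `[a, b[) F x.
  by rewrite -shI; apply: eq_integral => x _; rewrite pF.
have cat (a b c : R) : (a <= b)%R -> (b <= c)%R -> \int[mu]_(x in `[a, c[) F x =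
    \int[mu]_(x in `[a, b[) F x + \int[mu]_(x in `[b, c[) F x.
  move=> ab bc; rewrite -ge0_integral_setU //.
  - congr (integral _ _ _); apply/seteqP; split => x /=; rewrite !in_itv /=.
      move=> /andP[ax xc]; have [xb|bx] := ltP x b; first by left; apply/andP.
      by right; apply/andP.
    move=> [/andP[ax xb]|/andP[bx xc]]; first by rewrite ax (lt_le_trans xb).
    by rewrite xc (le_trans ab).
  - exact: measurable_funS mF.
  - apply/disj_setPS => x /= []; rewrite !in_itv /= => /andP[_ h] /andP[h' _].
    by move: (lt_le_trans h h'); rewrite ltxx.
have := fracp_itv y; rewrite /fracp; set n := Num.floor y => /andP[n0 n1].
have ny : (n%:~R <= y)%R by lra.
have yn : (y <= n%:~R + 1)%R by lra.
rewrite shI add0r (cat _ (n%:~R + 1)%R) //; last by lra.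
rewrite -[in X in _ + X](shZ _ _ (-1)%R).
have -> : (n%:~R + 1 + (-1)%:~R = n%:~R :> R)%R by rewrite intrN; ring.
have -> : (1 + y + (-1)%:~R = y :> R)%R by rewrite intrN; ring.
rewrite addeC -cat // -(shZ 0%R 1%R n) add0r; congr (integral _ _ _).
by rewrite [in RHS]addrC.
Qed.

End period_one.

(** * Product Lebesgue measure *)

Section lebesgue_tuple_product.
Local Open Scope ereal_scope.
Context {R : realType}.
Local Notation mu := (@lebesgue_measure R).

(** Measures are monotone on measurable sets; this one also on all
    sets, because it is an iterated integral of measures of sections. The level
    sets of the differences are thereby handled without measurability. *)
Lemma lebesgue_tuple_le m (A B : set (m.-tuple (measurableTypeR R))) :
  A `<=` B -> lebesgue_tuple m A <= lebesgue_tuple m B.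
Proof.
elim: m A B => [|m IH] A B AB /=.
  rewrite !diracE lee_fin ler_nat; case: (boolP (_ \in A)) => // hA.
  by rewrite mem_set //; apply: AB; rewrite inE in hA.
rewrite /cons_measure /pushforward /=.
apply: le_integral_ge0 => [x _|x _]; first exact: measure_ge0.
by apply: IH => y; rewrite /xsection /= !inE; exact: AB.
Qed.

Definition box m (A : 'I_m -> set R) : set (m.-tuple (measurableTypeR R)) :=
  [set x | forall j, A j (tnth x j)].

Lemma measurable_box m (A : 'I_m -> set R) :
  (forall j, measurable (A j)) -> measurable (box A).
Proof.
move=> mA.
have -> : box A = \bigcap_(j in [set: 'I_m])
    ((fun x : m.-tuple (measurableTypeR R) => tnth x j) @^-1` A j).
  by apply/seteqP; split => x h j; [move=> _; exact: h|exact: (h j I)].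
apply: fin_bigcap_measurable; first exact: finite_finset.
move=> j _.
rewrite -[X in measurable X]setTI.
by apply: (@measurable_tnth _ (measurableTypeR R) m j) => //; exact: mA.
Qed.

Lemma lebesgue_tuple_box m (A : 'I_m -> set R) :
  (forall j, measurable (A j)) -> lebesgue_tuple m (box A) = \prod_(j < m) mu (A j).
Proof.
elim: m A => [|m IH] A mA.
  by rewrite big_ord0 /= diracE mem_set // => -[].
rewrite big_ord_recl /= /cons_measure /pushforward.
have -> : cons_pair (T:=measurableTypeR R) (n:=m) @^-1` box A =
    A ord0 `*` box (fun j => A (lift ord0 j)).
  apply/seteqP; split => -[x y] /= h.
    split; first by have := h ord0; rewrite (tnth_nth 0%R).
    by move=> j; have := h (lift ord0 j); rewrite !(tnth_nth 0%R).
  move=> j; have [h0 h1] := h.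
  have [k ->|->] := unliftP ord0 j; last by rewrite (tnth_nth 0%R).
  by have := h1 k; rewrite !(tnth_nth 0%R).
rewrite product_measure1E //; [|exact: mA|by apply: measurable_box => j].
by rewrite (IH (fun j => A (lift ord0 j))).
Qed.

Lemma ge0_prode (I : Type) (s : seq I) (F : I -> \bar R) :
  (forall i, 0 <= F i) -> 0 <= \prod_(i <- s) F i.
Proof. by move=> F0; elim/big_ind: _ => // x y x0 y0; exact: mule_ge0. Qed.

Lemma measurable_prod_tnth m (F : 'I_m -> R -> \bar R) :
  (forall j, measurable_fun [set: R] (F j)) ->
  measurable_fun [set: m.-tuple (measurableTypeR R)]
    (fun x => \prod_(j < m) F j (tnth x j)).
Proof.
move=> mF.
have h (s : seq 'I_m) : measurable_fun [set: m.-tuple (measurableTypeR R)]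
    (fun x => \prod_(j <- s) F j (tnth x j)).
  elim: s => [|j s IH].
    by under eq_fun do rewrite big_nil; exact: measurable_cst.
  under eq_fun do rewrite big_cons; apply: emeasurable_funM => //.
  by apply: (measurableT_comp (mF j)); exact: measurable_tnth.
exact: h.
Qed.

(** Tonelli, one coordinate at a time. *)
Lemma integral_lebesgue_tuple_prod m (F : 'I_m -> R -> \bar R) :
  (forall j, measurable_fun [set: R] (F j)) -> (forall j x, 0 <= F j x) ->
  \int[lebesgue_tuple m]_x (\prod_(j < m) F j (tnth x j)) =
  \prod_(j < m) \int[mu]_x F j x.
Proof.
elim: m F => [|m IH] F mF F0.
  rewrite big_ord0 /=; under eq_integral do rewrite big_ord0.
  by rewrite integral_dirac //= diracT mul1e.
rewrite [RHS]big_ord_recl.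
have mG : measurable_fun [set: m.-tuple (measurableTypeR R)]
    (fun x => \prod_(j < m) F (lift ord0 j) (tnth x j)).
  exact: (@measurable_prod_tnth m (fun j => F (lift ord0 j))).
transitivity (\int[(lebesgue_measure \x lebesgue_tuple m)%E]_z
    (F ord0 z.1 * \prod_(j < m) F (lift ord0 j) (tnth z.2 j))).
  rewrite /= /cons_measure.
  rewrite (@ge0_integral_pushforward _ _ _ _ R _ (measurable_cons_pair (T:=measurableTypeR R) (n:=m))) //.
  - rewrite preimage_setT; apply: eq_integral => -[x y] _ /=.
    rewrite big_ord_recl /= [tnth _ ord0](tnth_nth 0%R) /=; congr (_ * _).
    by apply: eq_bigr => j _; rewrite !(tnth_nth 0%R).
  - exact: measurable_prod_tnth.
  - by move=> y _; exact: ge0_prode.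
rewrite fubini_tonelli1 /=; first last.
  - by move=> z; rewrite mule_ge0 // ge0_prode.
  - apply: emeasurable_funM.
      by apply: (measurableT_comp (mF ord0)); exact: measurable_fst.
    by apply: (measurableT_comp mG); exact: measurable_snd.
rewrite /fubini_F /=.
under eq_integral => x _.
  rewrite ge0_integralZl //; last by move=> y _; exact: ge0_prode.
  rewrite (IH (fun j => F (lift ord0 j))) //.
  over.
rewrite ge0_integralZr //; first exact: mF.
by apply: ge0_prode => j; exact: integral_ge0.
Qed.

End lebesgue_tuple_product.

(** * One-dimensional fractional differences *)

Section fractional_difference.
Context {R : realType}.
Implicit Types (k h x y u A w : R) (F : R -> R).

(** A divergent limit has the value 0; bounds that hold at every point rely on
    this convention. *)
Definition fdiff k h F x : R :=
  limn (series (fun nu => dcoef k nu * F (x + (k - nu%:R) * h))).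

Definition bounded_by (M : R) F := forall x, `|F x| <= M.

Lemma le_nneseries_bound (v : nat -> R) (M : R) : (forall n, 0 <= v n) ->
  (forall n, \sum_(0 <= i < n) v i <= M) -> (\sum_(n <oo) (v n)%:E <= M%:E)%E.
Proof.
move=> v0 vM; apply: lime_le.
  by apply: is_cvg_nneseries => n _ _; rewrite lee_fin.
by near=> n; rewrite sumEFin lee_fin.
Unshelve. all: by end_near.
Qed.

Lemma norm_lim_series_le (v : nat -> R) : cvgn (series v) ->
  (`|limn (series v)|%:E <= \sum_(n <oo) `|v n|%:E)%E.
Proof.
move=> cv; set S := (\sum_(n <oo) _)%E.
have vS n : (`|series v n|%:E <= S)%E.
  apply: (@le_trans _ _ (\sum_(0 <= i < n) `|v i|%:E)%E).
    by rewrite sumEFin lee_fin; exact: ler_norm_sum.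
  by apply: nneseries_lim_ge => i _ _; rewrite lee_fin.
case: S vS => [r vr| _|/(_ 0%N)]; rewrite ?leey ?leeNy_eq //.
rewrite lee_fin -(cvg_lim _ (cvg_norm cv)) //; apply: limr_le.
  by apply/cvg_ex; exists `|limn (series v)|; exact: cvg_norm.
by near=> n; rewrite -lee_fin.
Unshelve. all: by end_near.
Qed.

Lemma cvg_series_norm_bounded (v : nat -> R) (M : R) :
  (forall n, \sum_(0 <= i < n) `|v i| <= M) -> cvgn (series v).
Proof.
move=> vM; apply: normed_cvg; apply: nondecreasing_is_cvgn.
  by apply: nondecreasing_series => n _ _; exact: normr_ge0.
by exists M => _ [n _ <-]; exact: vM.
Qed.

Lemma fdiff_is_cvg k h F x M : 0 <= k -> bounded_by M F ->
  cvgn (series (fun nu => dcoef k nu * F (x + (k - nu%:R) * h))).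
Proof.
move=> k0 FM; have [C C0 hC] := dcoef_summable k0.
apply: (@cvg_series_norm_bounded _ (C * M)) => n.
apply: (@le_trans _ _ (\sum_(0 <= i < n) `|dcoef k i| * M)).
  by apply: ler_sum => i _; rewrite normrM ler_wpM2l.
rewrite -mulr_suml ler_wpM2r //.
exact: le_trans (normr_ge0 _) (FM 0).
Qed.

Definition diff1 h F x := F (x + h) - F x.

Lemma bounded_by_diff1 h F M : bounded_by M F -> bounded_by (M + M) (diff1 h F).
Proof.
by move=> FM x; rewrite (le_trans (ler_normB _ _)) // lerD.
Qed.

(** The coefficients of order k + 1 are first differences of those of order k;
    summation by parts, with boundary term tending to 0. *)
Lemma fdiffS k h F x M : 0 <= k -> bounded_by M F ->
  fdiff (k + 1) h F x = fdiff k h (diff1 h F) x.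
Proof.
move=> k0 FM.
pose s0 := series (fun nu => dcoef k nu * F (x + (k - nu%:R) * h)).
pose s1 := series (fun nu => dcoef k nu * F (x + h + (k - nu%:R) * h)).
have c0 : cvgn s0 := @fdiff_is_cvg k h F x M k0 FM.
have c1 : cvgn s1 := @fdiff_is_cvg k h F (x + h) M k0 FM.
transitivity (limn s1 - limn s0).
  apply: cvg_lim => //.
  rewrite -(cvg_shiftS _).
  have -> : [sequence series (fun nu => dcoef (k + 1) nu * F (x + (k + 1 - nu%:R) * h)) n.+1]_n
     = (fun n => s1 n.+1 - s0 n).
    apply/funext => n /=; rewrite /s1 /s0 /series /=.
    rewrite big_nat_recl // [X in _ = X - _]big_nat_recl // !dcoef0 !mul1r.
    have -> : x + (k + 1 - 0%:R) * h = x + h + (k - 0%:R) * h by ring.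
    rewrite -[RHS]addrA; congr (_ + _); rewrite -sumrB; apply: eq_bigr => i _.
    rewrite dcoef_pascal addrK mulrBl; congr (_ * F _ - _ * F _).
      by rewrite -natr1; ring.
    by rewrite -natr1; ring.
  apply: cvgB; last exact: c0.
  by rewrite (cvg_shiftS s1); exact: c1.
apply/esym/cvg_lim => //.
have -> : series (fun nu => dcoef k nu * diff1 h F (x + (k - nu%:R) * h)) = s1 \- s0.
  apply/funext => n; rewrite /s1 /s0 /series /= -sumrB; apply: eq_bigr => i _.
  by rewrite /diff1 mulrBr; congr (_ * F _ - _); ring.
by apply: cvgB; [exact: c1|exact: c0].
Qed.

Lemma fdiff0 h F x : fdiff 0 h F x = F x.
Proof.
apply: cvg_lim => //; rewrite -(cvg_shiftS _).
apply: cvg_near_cst; near=> n; rewrite /series /= big_nat_recl // big1 ?addr0.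
  by rewrite dcoef0 subr0 mul0r addr0 mul1r.
by move=> i _; rewrite (@dcoef_nat_eq0 R 0 i.+1) // mul0r.
Unshelve. all: by end_near.
Qed.

(** The coefficients sum to 0, so F (x + k h) may be subtracted in every
    term: this turns the series into an average of first differences. *)
Lemma fdiff_centered k h F x M : 0 < k -> bounded_by M F ->
  fdiff k h F x = limn (series (fun nu => dcoef k nu *
    (F (x + k * h + - (nu%:R * h)) - F (x + k * h)))).
Proof.
move=> k0 FM.
have c0 := @fdiff_is_cvg k h F x M (ltW k0) FM.
have c1 : series (dcoef k) @ \oo --> (0 : R).
  rewrite -(cvg_shiftS _); have := dcoef_cvg0 k0; apply: cvg_trans.
  by apply: near_eq_cvg; near=> n; rewrite /series /= sum_dcoef.
apply/esym/cvg_lim => //.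
rewrite -[fdiff _ _ _ _]subr0 -(mul0r (F (x + k * h))).
have -> : series (fun nu => dcoef k nu * (F (x + k * h + - (nu%:R * h)) - F (x + k * h)))
   = series (fun nu => dcoef k nu * F (x + (k - nu%:R) * h)) \-
     (fun n => series (dcoef k) n * F (x + k * h)).
  apply/funext => n; rewrite /series /= mulr_suml -sumrB; apply: eq_bigr => i _.
  by rewrite mulrBr; congr (_ * F _ - _); ring.
apply: cvgB; first exact: c0.
by apply: cvgM => //; exact: cvg_cst.
Unshelve. all: by end_near.
Qed.

Lemma measurable_shift F y : measurable_fun [set: R] F ->
  measurable_fun [set: R] (fun x => F (x + y)).
Proof.
move=> mF; apply: (measurableT_comp mF).
by apply: measurable_funD => //; exact: measurable_cst.
Qed.

Lemma measurable_fdiff k h F M : 0 <= k -> bounded_by M F ->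
  measurable_fun [set: R] F -> measurable_fun [set: R] (fdiff k h F).
Proof.
move=> k0 FM mF.
apply: (@measurable_fun_cvg _ _ _ _ (fun n x =>
  series (fun nu => dcoef k nu * F (x + (k - nu%:R) * h)) n)).
  move=> n; rewrite /series /=; apply: measurable_sum => i.
  apply: measurable_funM; first exact: measurable_cst.
  exact: measurable_shift.
by move=> x _; exact: (@fdiff_is_cvg k h F x M).
Qed.

Lemma measurable_diff1 h F : measurable_fun [set: R] F ->
  measurable_fun [set: R] (diff1 h F).
Proof. by move=> mF; apply: measurable_funB => //; exact: measurable_shift. Qed.

Lemma per1_diff1 h F : per1 F -> per1 (diff1 h F).
Proof. by move=> pF z l; rewrite /diff1 addrAC !pF. Qed.

Lemma powR_inv (x a : R) : 0 < x -> x^-1 `^ a = x `^ (- a).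
Proof. by move=> x0; rewrite -powR_inv1 ?(ltW x0) // -powRrM mulN1r. Qed.

(** Split at i of order 1/x. Below, i dcoef k i is a multiple of
    dcoef (k-1) (i-1), whose partial sums are of order i^(1-k); above, the tail of
    the sum of dcoef k is of order x^k. This is the interpolation between
    boundedness and differentiability that gives the power k < 1. *)
Lemma sum_dcoef_min_le k : 0 < k -> k < 1 -> exists2 C, 0 < C &
  forall x, 0 <= x <= 1 -> forall n,
    \sum_(0 <= i < n) `|dcoef k i| * Num.min 2 (i%:R * x) <= C * x `^ k.
Proof.
move=> k0 k1.
have [C1 C10 hC1] := dcoef_le_powR (k - 1).
have [C2 C20 hC2] := dcoef_le_powR (k - 2).
have k1' : k <= 1%:R by rewrite ltW.
have [sg sg1 hsg] := dcoef_sign k1'.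
have sgn : `|sg| = 1.
  by apply/eqP; rewrite -(@eqrXn2 _ 2) // -normrX expr2 sg1 normr1 expr1n.
exists (C2 * 2 `^ (1 - k) + 4 * C1).
  by rewrite addr_gt0 ?mulr_gt0 ?powR_gt0.
move=> x /andP[]; rewrite le_eqVlt => /predU1P[<- _ n|x0 x1 n].
  rewrite powR0 ?lt0r_neq0 // mulr0 big1 // => i _.
  by rewrite mulr0 minElt ltrn0 mulr0.
pose N := (Num.trunc x^-1).+1.
have xi1 : 1 <= x^-1 by rewrite invf_ge1.
have xN : x^-1 <= N%:R by rewrite ltW // truncnS_gt.
have Nx : N%:R <= 2 / x.
  rewrite /N -natr1 mulr2n mulrDl mul1r lerD //.
  by rewrite truncn_le // invr_ge0 ltW.
have t0 i : 0 <= `|dcoef k i| * Num.min 2 (i%:R * x).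
  by rewrite mulr_ge0 // le_min ler0n mulr_ge0 // ltW.
have N0 : 0 < N%:R :> R by rewrite ltr0n.
apply: (@le_trans _ _ (\sum_(0 <= i < N + n) `|dcoef k i| * Num.min 2 (i%:R * x))).
  by rewrite [leRHS](big_cat_nat _ (leq_addl N n)) //= lerDl sumr_ge0.
rewrite (big_cat_nat _ (leq_addr n N)) //= mulrDl lerD //.
  have h1 : \sum_(0 <= i < N) `|dcoef k i| * Num.min 2 (i%:R * x) <=
      (x * sg) * \sum_(0 <= i < N) i%:R * dcoef k i.
    rewrite mulr_sumr; apply: ler_sum_nat => i /andP[_ iN].
    apply: (@le_trans _ _ (`|dcoef k i| * (i%:R * x))).
      by rewrite ler_wpM2l // ge_min lexx orbT.
    case: i iN => [|i] iN; first by rewrite !mul0r !mulr0.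
    by rewrite hsg // le_eqVlt; apply/orP; left; apply/eqP; ring.
  rewrite (le_trans h1) // (le_trans (ler_norm _)) // !normrM sgn mulr1.
  rewrite (gtr0_norm x0) /N big_nat_recl // mul0r add0r.
  under eq_bigr do rewrite dcoefS_lower.
  rewrite -mulr_sumr normrM normrN (gtr0_norm k0).
  have h2 : `|\sum_(0 <= i < Num.trunc x^-1) dcoef (k - 1) i| <= C2 * N%:R `^ (1 - k).
    have e1 : - (k - 2 + 1) = 1 - k by ring.
    case E : (Num.trunc x^-1) => [|n'].
      by rewrite big_geq // normr0 mulr_ge0 ?powR_ge0 // ltW.
    rewrite sum_dcoef /N E.
    have -> : k - 1 - 1 = k - 2 by ring.
    rewrite (le_trans (hC2 n')) // e1 ler_wpM2l ?(ltW C20) //.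
    by rewrite ge0_ler_powR ?nnegrE ?ler_nat // subr_ge0 ltW.
  have h3 : N%:R `^ (1 - k) <= 2 `^ (1 - k) * (x `^ k / x).
    have -> : x `^ k / x = (x^-1) `^ (1 - k).
      by rewrite powR_inv // opprB powRB ?(gt_eqF x0) ?implybT // powRr1 // ltW.
    rewrite -powRM ?invr_ge0 ?(ltW x0) //.
    by rewrite ge0_ler_powR ?nnegrE // ?subr_ge0 ?divr_ge0 ?ltW.
  rewrite mulrC -ler_pdivlMr //.
  apply: (@le_trans _ _ (1 * (C2 * N%:R `^ (1 - k)))).
    by rewrite ler_pM // ltW.
  by rewrite mul1r -!mulrA ler_pM2l.
have xk0 : 0 <= x `^ k by exact: powR_ge0.
have Nk (n' : nat) : (N <= n'.+1)%N -> `|dcoef (k - 1) n'| <= C1 * x `^ k.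
  move=> Nn; rewrite (le_trans (hC1 n')) // ler_wpM2l ?(ltW C10) // subrK.
  rewrite powRN -[leRHS]invrK lef_pV2 ?posrE ?invr_gt0 ?powR_gt0 //.
  rewrite -powRN -powR_inv // ge0_ler_powR ?nnegrE ?(ltW k0) ?invr_ge0 ?(ltW x0) //.
  by rewrite (le_trans xN) // ler_nat.
have h1 : \sum_(N <= i < N + n) `|dcoef k i| * Num.min 2 (i%:R * x) <=
    2 * (sg * \sum_(N <= i < N + n) dcoef k i).
  rewrite mulrA mulr_sumr; apply: ler_sum_nat => i /andP[Ni _].
  rewrite -mulrA -hsg; last exact: leq_trans Ni.
  by rewrite mulrC ler_wpM2r // ge_min lexx.
rewrite (le_trans h1) // (le_trans (ler_norm _)) // !normrM sgn mul1r normr_nat.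
have -> : 4 * C1 * x `^ k = 2 * (C1 * x `^ k + C1 * x `^ k) by ring.
rewrite ler_pM2l //.
case: n {h1} => [|n].
  by rewrite addn0 big_geq // normr0 addr_ge0 // mulr_ge0 // ltW.
have -> : \sum_(N <= i < N + n.+1) dcoef k i = dcoef (k - 1) (N + n) -
    dcoef (k - 1) N.-1.
  rewrite -!sum_dcoef (prednK (isT : (0 < N)%N)) addnS.
  by rewrite [X in _ = X - _](big_cat_nat _ (leq_trans (leq_addr n N) (leqnSn _))) //= addrAC subrr add0r.
rewrite (le_trans (ler_normB _ _)) // lerD // Nk //.
by rewrite (leq_trans (leq_addr n N)).
Qed.

End fractional_difference.

(** * Integrals against test functions *)

Section test_functions.
Context {R : realType}.
Implicit Types (k h x y u A w : R) (F phi psi : R -> R).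
Local Notation mu := (@lebesgue_measure R).

(** The functions against which differences are integrated: a periodic
    substitute for the indicators of sets of measure at most u, stable under
    shifts. *)
Definition test_fun u psi := [/\ measurable_fun [set: R] psi, per1 psi,
  (forall z, 0 <= psi z <= 1) &
  (\int[mu]_(z in `[0%R, 1%R[) (psi z)%:E <= u%:E)%E].

Definition tint psi phi : \bar R :=
  (\int[mu]_(z in `[0%R, 1%R[) (`|phi z| * psi z)%:E)%E.

Lemma test_fun_shift u psi y : test_fun u psi -> test_fun u (fun z => psi (z + y)).
Proof.
move=> [mp pp p01 pu]; split.
- exact: measurable_shift.
- by move=> z l; rewrite addrAC pp.
- by move=> z; exact: p01.
- rewrite (@integral_per1_shift _ y (fun z => (psi z)%:E)) //.
  + exact/measurable_EFinP.
  + by move=> z; rewrite lee_fin; have /andP[] := p01 z.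
  + by move=> z l; rewrite pp.
Qed.

Lemma measurable_tint_integrand u psi phi : test_fun u psi ->
  measurable_fun [set: R] phi ->
  measurable_fun [set: R] (fun z => (`|phi z| * psi z)%:E).
Proof.
move=> [mp _ _ _] mphi; apply/measurable_EFinP.
by apply: measurable_funM => //; exact: measurableT_comp.
Qed.

Lemma tint_ge0 u psi phi : test_fun u psi -> (0 <= tint psi phi)%E.
Proof.
move=> [_ _ p01 _]; apply: integral_ge0 => z _.
by rewrite lee_fin mulr_ge0 //; have /andP[] := p01 z.
Qed.

(** Shifts of the function move to the test function, and the class of
    test functions is stable under shifts: all the translates that occur in a
    difference obey the same bound. *)
Lemma tint_shift u psi F y : test_fun u psi -> measurable_fun [set: R] F ->
  per1 F -> tint psi (fun z => F (z + y)) = tint (fun z => psi (z - y)) F.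
Proof.
move=> tp mF pF; have tp' := test_fun_shift (- y) tp.
have [_ pp p01 _] := tp.
rewrite /tint.
rewrite -(@integral_per1_shift _ y (fun z => (`|F z| * psi (z - y))%:E)) //.
- by apply: eq_integral => z _; rewrite addrK.
- exact: measurable_tint_integrand tp' mF.
- by move=> z; rewrite lee_fin mulr_ge0 //; have /andP[] := p01 (z - y).
- by move=> z l; rewrite pF addrAC pp.
Qed.

Lemma tint_le_series u psi phi (c : nat -> R) (phis : nat -> R -> R) :
  test_fun u psi -> (forall n, 0 <= c n) ->
  (forall n, measurable_fun [set: R] (phis n)) ->
  (forall z, (`|phi z|%:E <= \sum_(n <oo) (c n * `|phis n z|)%:E)%E) ->
  (tint psi phi <= \sum_(n <oo) (c n)%:E * tint psi (phis n))%E.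
Proof.
move=> tp c0 mphi h; have [mp _ p01 _] := tp.
have t0 n z : (0 <= (c n * (`|phis n z| * psi z))%:E)%E.
  by rewrite lee_fin !mulr_ge0 //; have /andP[] := p01 z.
have mt n : measurable_fun [set: R] (fun z => (c n * (`|phis n z| * psi z))%:E).
  rewrite (_ : (fun z => _) = EFin \o ((cst (c n)) \* (fun z => `|phis n z| * psi z))) //.
  apply/measurable_EFinP; apply: measurable_funM; first exact: measurable_cst.
  by apply/measurable_EFinP; exact: measurable_tint_integrand tp _.
apply: (@le_trans _ _ (\int[mu]_(z in `[0%R, 1%R[)
    \sum_(n <oo) (c n * (`|phis n z| * psi z))%:E)%E).
  apply: le_integral_ge0 => z _.
    by rewrite lee_fin mulr_ge0 //; have /andP[] := p01 z.
  rewrite EFinM; have /andP[pz0 _] := p01 z.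
  apply: (@le_trans _ _ ((\sum_(n <oo) (c n * `|phis n z|)%:E) * (psi z)%:E)%E).
    by rewrite lee_wpmul2r.
  rewrite muleC -nneseriesZl //; last by move=> n _; rewrite lee_fin mulr_ge0.
  apply: lee_nneseries => [n _ _|n _].
    by rewrite -EFinM lee_fin !mulr_ge0.
  by rewrite -EFinM lee_fin mulrC mulrA.
rewrite integral_nneseries //; last by move=> n; exact: measurable_funTS (mt n).
apply: lee_nneseries => [n _ _|n _]; first exact: integral_ge0.
rewrite /tint -ge0_integralZl_EFin //.
- by move=> z _; rewrite lee_fin mulr_ge0 //; have /andP[] := p01 z.
- by apply: measurable_funTS; exact: measurable_tint_integrand tp _.
Qed.

Lemma tint_le_series_bound u psi phi (c B : nat -> R) (phis : nat -> R -> R) (M : R) :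
  test_fun u psi -> (forall n, 0 <= c n) -> (forall n, 0 <= B n) ->
  (forall n, measurable_fun [set: R] (phis n)) ->
  (forall z, (`|phi z|%:E <= \sum_(n <oo) (c n * `|phis n z|)%:E)%E) ->
  (forall n, tint psi (phis n) <= (B n)%:E)%E ->
  (forall n, \sum_(0 <= i < n) c i * B i <= M) ->
  (tint psi phi <= M%:E)%E.
Proof.
move=> tp c0 B0 mphi h hB hM; apply: (le_trans (tint_le_series tp c0 mphi h)).
apply: (@le_trans _ _ (\sum_(n <oo) (c n * B n)%:E)%E).
  apply: lee_nneseries => [n _ _|n _]; first by rewrite mule_ge0 ?lee_fin // (tint_ge0 _ tp).
  by rewrite EFinM lee_wpmul2l // lee_fin.
by apply: le_nneseries_bound => // n; rewrite mulr_ge0.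
Qed.

(** Iterated first differences with steps that may vary, as they arise from
    peeling integral orders off a difference. *)
Fixpoint diffs (l : seq R) F : R -> R :=
  if l is y :: l' then diffs l' (diff1 y F) else F.

(** F behaves as a function that oscillates at frequency w: each of its
    differences of order at most n gains a factor w |y| in the integrals
    against test functions. *)
Definition smooth_test n u A w F := forall psi, test_fun u psi ->
  forall l, (size l <= n)%N ->
    (tint psi (diffs l F) <= (A * \prod_(y <- l) (w * `|y|))%:E)%E.

Definition bounded_periodic M F := [/\ measurable_fun [set: R] F, per1 F & bounded_by M F].

Lemma bounded_periodic_diff1 h M F : bounded_periodic M F -> bounded_periodic (M + M) (diff1 h F).
Proof.
by move=> [? ? ?]; split;
  [exact: measurable_diff1|exact: per1_diff1|exact: bounded_by_diff1].
Qed.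

Lemma smooth_test_diff1 n u A w F h : smooth_test n.+1 u A w F ->
  smooth_test n u (A * (w * `|h|)) w (diff1 h F).
Proof.
move=> sF psi tp l ln; have := sF psi tp (h :: l); rewrite /= ltnS => /(_ ln).
by rewrite big_cons mulrA.
Qed.

(** The trivial bound, with no gain from the step: the coefficients are
    absolutely summable and translates obey the bound of F. *)
Lemma tint_fdiff_le k : 0 <= k -> exists2 C, 0 < C &
  forall u A h M F, 0 <= A -> bounded_periodic M F ->
  (forall psi, test_fun u psi -> (tint psi F <= A%:E)%E) ->
  forall psi, test_fun u psi -> (tint psi (fdiff k h F) <= (C * A)%:E)%E.
Proof.
move=> k0; have [C C0 hC] := dcoef_summable k0.
exists C => // u A h M F A0 [mF pF FM] hF psi tp.
apply: (@tint_le_series_bound u psi _ (fun nu => `|dcoef k nu|) (fun=> A)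
  (fun nu z => F (z + (k - nu%:R) * h))) => //.
- by move=> n; exact: measurable_shift.
- move=> z; apply: le_trans (norm_lim_series_le _) _.
    exact: (@fdiff_is_cvg _ k h F z M).
  by apply: lee_nneseries => [n _ _|n _]; rewrite ?lee_fin // normrM.
- move=> n; rewrite (tint_shift _ tp) //; apply: hF; exact: test_fun_shift.
- by move=> n; rewrite -mulr_suml ler_wpM2r.
Qed.

(** Write the difference as an average of first differences, bound
    each of them by the smaller of 2A and the gain A w |nu h|, and sum by
    [sum_dcoef_min_le]. *)
Lemma tint_fdiff_lt1_le k : 0 <= k -> k < 1 -> exists2 C, 0 < C &
  forall u A w h M F, 0 <= A -> 0 <= w -> w * `|h| <= 1 -> bounded_periodic M F ->
  smooth_test 1 u A w F ->
  forall psi, test_fun u psi ->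
    (tint psi (fdiff k h F) <= (C * A * (w * `|h|) `^ k)%:E)%E.
Proof.
rewrite le_eqVlt => /predU1P[<- _|k0 k1].
  exists 1 => // u A w h M F A0 w0 wh nF sF psi tp.
  rewrite powRr0 mulr1 mul1r (_ : fdiff 0 h F = F); last first.
    by apply/funext => x; rewrite fdiff0.
  by have := sF psi tp [::] (leq0n _); rewrite /= big_nil mulr1.
have [C C0 hC] := sum_dcoef_min_le k0 k1.
exists C => // u A w h M F A0 w0 wh [mF pF FM] sF psi tp.
pose B n : R := A * Num.min 2 (n%:R * (w * `|h|)).
have wh0 : 0 <= w * `|h| by rewrite mulr_ge0.
apply: (@tint_le_series_bound u psi _ (fun nu => `|dcoef k nu|) B
  (fun nu z => diff1 (- (nu%:R * h)) F (z + k * h))) => //.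
- by move=> n; rewrite /B mulr_ge0 // le_min ler0n mulr_ge0.
- by move=> n; apply: measurable_shift; exact: measurable_diff1.
- move=> z; rewrite (fdiff_centered h z k0 FM).
  apply: le_trans (norm_lim_series_le _) _.
    have [C' C'0 hC'] := dcoef_summable (ltW k0).
    apply: (@cvg_series_norm_bounded _ _ (C' * (M + M))) => n.
    apply: (@le_trans _ _ (\sum_(0 <= i < n) `|dcoef k i| * (M + M))).
      apply: ler_sum => i _; rewrite normrM ler_wpM2l //.
      exact: (@bounded_by_diff1 _ (- (i%:R * h)) F M FM (z + k * h)).
    rewrite -mulr_suml ler_wpM2r //.
    exact: le_trans (normr_ge0 _) (@bounded_by_diff1 _ 0 F M FM 0).
  by apply: lee_nneseries => [n _ _|n _]; rewrite ?lee_fin // normrM.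
- move=> n; rewrite (@tint_shift u) //; [|exact: measurable_diff1|exact: per1_diff1].
  have tp' := test_fun_shift (- (k * h)) tp.
  rewrite /B minEle; case: ifPn => _; last first.
    have := sF _ tp' [:: - (n%:R * h)] isT.
    by rewrite /= big_seq1 normrN normrM normr_nat (mulrCA w).
  have sF0 psi' : test_fun u psi' -> (tint psi' F <= A%:E)%E.
    by move=> tp0; have := sF _ tp0 [::] isT; rewrite /= big_nil mulr1.
  apply: (@tint_le_series_bound u _ _ (fun i => (i < 2)%N%:R) (fun=> A)
    (fun i z => if i == 0%N then F (z - n%:R * h) else F z)) => //.
  + by move=> [|i] /=; [exact: measurable_shift|exact: mF].
  + move=> z; apply: (@le_trans _ _ (\sum_(0 <= i < 2) ((i < 2)%N%:R *
        `|if i == 0%N then F (z - n%:R * h) else F z|)%:E)%E); last first.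
      by apply: nneseries_lim_ge => i _ _; rewrite lee_fin mulr_ge0.
    rewrite !big_nat_recr //= big_geq // !mul1r add0e -EFinD lee_fin.
    exact: ler_normB.
  + move=> [|i] /=; last exact: sF0.
    rewrite (@tint_shift u _ F (- (n%:R * h))) //.
    exact: sF0 (test_fun_shift _ tp').
  + move=> i; rewrite -mulr_suml mulrC ler_wpM2l //.
    case: i => [|[|i]]; first by rewrite big_geq.
      by rewrite big_nat1 ler1n.
    rewrite 2?big_nat_recl // big1 ?addr0 -?natrD //.
- move=> n; rewrite /B.
  under eq_bigr do rewrite mulrCA.
  rewrite -mulr_sumr mulrAC [leRHS]mulrC ler_wpM2l // hC //.
  by rewrite wh0.
Qed.

(** Integral orders are peeled off one at a time by [fdiffS], each
    costing one order of smoothness and gaining a factor w |h|. *)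
Lemma tint_fdiff_scaled_le (K : nat) k : 0 <= k -> k < 1 -> exists2 C, 0 < C &
  forall u A w h M F, 0 <= A -> 0 <= w -> w * `|h| <= 1 -> bounded_periodic M F ->
  smooth_test K.+1 u A w F ->
  forall psi, test_fun u psi ->
    (tint psi (fdiff (k + K%:R) h F) <= (C * A * (w * `|h|) `^ (k + K%:R))%:E)%E.
Proof.
move=> k0 k1; have [C C0 hC] := tint_fdiff_lt1_le k0 k1; exists C => //.
elim: K => [|K IH] u A w h M F A0 w0 wh nF sF psi tp.
  by rewrite addr0; exact: hC nF sF _ tp.
have wh0 : 0 <= w * `|h| by rewrite mulr_ge0.
have [_ _ FM] := nF.
have kK : 0 <= k + K%:R by rewrite addr_ge0.
have -> : fdiff (k + K.+1%:R) h F = fdiff (k + K%:R) h (diff1 h F).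
  by apply/funext => x; rewrite -natr1 addrA (fdiffS h x kK FM).
apply: le_trans (IH u (A * (w * `|h|)) w h (M + M) _ _ w0 wh _ _ psi tp) _.
- by rewrite mulr_ge0.
- exact: bounded_periodic_diff1.
- exact: smooth_test_diff1.
rewrite lee_fin -natr1 addrA [k + K%:R + 1]addrC [X in _ <= _ * X]powRD; last first.
  by rewrite gt_eqF // ltr_pwDl.
by rewrite powRr1 // !mulrA.
Qed.

End test_functions.

(** * Polynomial bumps *)

Section truncated_polynomials.
Context {R : realType}.
Implicit Types (P : {poly R}) (x y z : R) (l : seq R).

Definition tpoly P y : R := if 0 < y < 1 then P.[y] else 0.

Lemma horner_norm_le P y : `|y| <= 1 -> `|P.[y]| <= \sum_(i < size P) `|P`_i|.
Proof.
move=> y1; rewrite horner_coef (le_trans (ler_norm_sum _ _ _)) //.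
apply: ler_sum => i _; rewrite normrM ler_piMr // normrX.
by rewrite exprn_ile1.
Qed.

Lemma tpoly_bounded P : exists2 C, 0 < C & forall y, `|tpoly P y| <= C.
Proof.
exists (1 + \sum_(i < size P) `|P`_i|); first by rewrite ltr_pwDl ?sumr_ge0.
move=> y; rewrite /tpoly; case: ifPn => [/andP[y0 y1]|_].
  by rewrite ler_wpDl // horner_norm_le // ger0_norm ltW.
by rewrite normr0 addr_ge0 // sumr_ge0.
Qed.

Definition parab : {poly R} := 'X * (1 - 'X).

Lemma parabE y : parab.[y] = y * (1 - y).
Proof. by rewrite /parab !hornerE. Qed.

Lemma is_derive0_quadratic (f : R -> R) x C : 0 <= C -> f x = 0 ->
  (forall y, `|f y| <= C * (y - x) ^+ 2) -> is_derive x 1 f 0.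
Proof.
move=> C0 fx hf.
have h : h^-1 *: ((f \o shift x) (h *: (1 : R)) - f x) @[h --> 0^'] --> (0 : R).
  apply/cvgrPdist_lt => e e0.
  have d0 : 0 < e / (C + 1) by rewrite divr_gt0 // ltr_wpDl.
  near=> h; rewrite sub0r normrN fx subr0 /=.
  have h0 : h != 0 by near: h; exact: nbhs_dnbhs_neq.
  have hd : `|h| < e / (C + 1).
    near: h; apply: dnbhs0_lt => //.
  have := hf (h *: 1 + x); rewrite addrK [h *: 1]mulr1 => hh.
  rewrite normrZ normfV ltr_pdivrMl ?normr_gt0 //.
  rewrite (le_lt_trans hh) // -[h ^+ 2]real_normK ?num_real // expr2 mulrCA.
  rewrite ltr_pM2l ?normr_gt0 // (le_lt_trans (_ : _ <= (C + 1) * `|h|)) //.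
    by rewrite ler_wpM2r // lerDl.
  by rewrite mulrC -ltr_pdivlMr // ltr_wpDl.
apply: DeriveDef; first by apply/cvg_ex; exists 0.
exact: cvg_lim h.
Unshelve. all: by end_near.
Qed.

(** The factor y^2 (1-y)^2 makes the function vanish to second order at
    both end points, where it is glued to 0. *)
Lemma is_derive_tpoly P y : (parab ^+ 2 %| P)%R ->
  is_derive y 1 (tpoly P) (tpoly P^`() y).
Proof.
move=> /Pdiv.Field.dvdpP [Q ->]; set P' := Q * _.
have [C C0 hC] := tpoly_bounded Q.
have PE z : tpoly P' z = tpoly Q z * (z * (1 - z)) ^+ 2.
  by rewrite /tpoly; case: ifPn => _; rewrite ?mul0r // /P' hornerM horner_exp parabE.
have bnd z : `|tpoly P' z| <= C * z ^+ 2 /\ `|tpoly P' z| <= C * (z - 1) ^+ 2.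
  rewrite PE normrM [`|_ ^+ 2|]ger0_norm ?sqr_ge0 //.
  have [/andP[z0 z1]|zN] := boolP (0 < z < 1); last first.
    by rewrite /tpoly (negbTE zN) normr0 mul0r; split; rewrite mulr_ge0 ?sqr_ge0 ?(ltW C0).
  split; apply: ler_pM; rewrite ?sqr_ge0 //.
    by rewrite exprMn ler_piMr ?sqr_ge0 // exprn_ile1 //; lra.
  rewrite -[(z - 1) ^+ 2]sqrrN opprB exprMn ler_piMl ?sqr_ge0 //.
  by rewrite exprn_ile1 // ltW.
have [y01|yN] := boolP (0 < y < 1).
  rewrite {2}/tpoly y01.
  apply: near_eq_is_derive (is_derive_poly P' y).
  have : y \in `]0, 1[ by rewrite in_itv.
  move=> /near_in_itvoo; apply: filterS => z; rewrite in_itv /= => z01.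
  by rewrite /tpoly z01.
rewrite {2}/tpoly (negbTE yN).
have [->|y0] := eqVneq y 0.
  apply: (@is_derive0_quadratic _ _ C); rewrite ?(ltW C0) //.
    by rewrite /tpoly ltxx.
  by move=> z; rewrite subr0; have [] := bnd z.
have [->|y1] := eqVneq y 1.
  apply: (@is_derive0_quadratic _ _ C); rewrite ?(ltW C0) //.
    by rewrite /tpoly ltxx andbF.
  by move=> z; have [] := bnd z.
apply: near_eq_is_derive (is_derive_cst 0 y 1).
have [y_lt0|y_ge0] := ltP y 0.
  have : y \in `]-oo, 0[ by rewrite in_itv.
  move=> /near_in_itvNyo; apply: filterS => z; rewrite in_itv /= => z0.
  by rewrite /tpoly ltNge (ltW z0).
have y_gt1 : 1 < y.
  rewrite lt_neqAle eq_sym y1 /= leNgt; apply: contra yN => ->.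
  by rewrite andbT lt_neqAle eq_sym y0.
have : y \in `]1, +oo[ by rewrite in_itv /= andbT.
move=> /near_in_itvoy; apply: filterS => z; rewrite in_itv /= andbT => z0.
by rewrite /tpoly ltNge andbC ltNge (ltW z0).
Qed.

Lemma dvdp_derivn_parab r j : (j <= r)%N -> (parab ^+ (r - j) %| (parab ^+ r)^`(j))%R.
Proof.
elim: j => [|j IH] jr; first by rewrite derivn0 subn0 dvdpp.
rewrite derivnS; have /Pdiv.Field.dvdpP [Q ->] := IH (ltnW jr).
rewrite derivM.
have -> : (r - j = (r - j.+1).+1)%N by rewrite subnSK.
rewrite deriv_exp /= dvdp_add //; first by rewrite exprS !dvdp_mull.
by rewrite dvdp_mull // -mulrnAl dvdp_mull.
Qed.

(** The mean value theorem once per step; the chain g j of successive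
    derivatives is an explicit argument because the functions of interest come
    with formulas for their derivatives. *)
Lemma diffs_mvt n (g : nat -> R -> R) M l :
  (forall j x, (j < n)%N -> is_derive x 1 (g j) (g j.+1 x)) ->
  (forall x, `|g n x| <= M) -> size l = n ->
  forall x, `|diffs l (g 0%N) x| <= M * \prod_(y <- l) `|y|.
Proof.
elim: l n g M => [|y l IH] n g M gd gM /= ln x.
  by rewrite big_nil mulr1 -ln in gM *; exact: gM.
case: n ln gd gM => // n [ln] gd gM.
have mvt j z : (j <= n)%N -> exists2 c, `|diff1 y (g j) z| = `|g j.+1 c| * `|y| & True.
  move=> jn; have cg (a b : R) : {within `[a, b], continuous (g j)}.
    apply: continuous_subspaceT => t; apply: differentiable_continuous.
    by apply/derivable1_diffP; have [] := gd j t jn.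
  have [y0|y0] := leP 0 y.
    have [|||c _ e] := @MVT_segment R (g j) (g j.+1) z (z + y).
    - by rewrite lerDl.
    - by move=> t _; exact: gd.
    - exact: cg.
    by exists c => //; rewrite /diff1 e normrM addrAC subrr add0r.
  have [|||c _ e] := @MVT_segment R (g j) (g j.+1) (z + y) z.
  - by rewrite gerDl ltW.
  - by move=> t _; exact: gd.
  - exact: cg.
  exists c => //; rewrite /diff1 -normrN opprB e normrM.
  by rewrite opprD addNKr normrN.
rewrite big_cons mulrA.
apply: (IH n (fun j => diff1 y (g j))) => //.
  move=> j t jn; have d1 := gd j t (leqW jn).
  have d2 : is_derive t 1 (fun s => g j (s + y)) (g j.+1 (t + y)).
    have h1 : is_derive t 1 (fun s : R => s + y) (1 + 0).
      by apply: is_deriveD.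
    have h2 : is_derive (t + y) 1 (g j) (g j.+1 (t + y)) by apply: gd; exact: leqW.
    have := @is_derive1_comp R (g j) (fun s : R => s + y) t _ _ h2 h1.
    by rewrite addr0 mulr1.
  exact: is_deriveB.
move=> t; have [c -> _] := mvt n t (leqnn _).
by rewrite ler_wpM2r.
Qed.

End truncated_polynomials.

(** * Periodic atoms *)

Section atoms.
Context {R : realType}.
Implicit Types (P : {poly R}) (k h u w x y z : R) (l : seq R) (psi : R -> R).
Local Notation mu := (@lebesgue_measure R).

Definition scale s : R := 4 * 2 ^+ s.

Lemma scale_ge4 s : 4 <= scale s.
Proof. by rewrite /scale ler_pMr // exprn_ege1 // ler1n. Qed.

Lemma scale_gt0 s : 0 < scale s.
Proof. exact: lt_le_trans (scale_ge4 s). Qed.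

(** The bump (y (1-y))^r with y = 4 2^s z - 1, repeated with period 1. It lives
    on ]2^-s/4, 2^-s/2[, and these intervals are disjoint for different s. *)
Definition atom r s z := tpoly (parab ^+ r) (scale s * fracp z - 1).

(** The support of an atom stays away from the integers, so near any
    point the fractional part may be replaced by the affine function
    of the same branch. *)
Lemma tpoly_fracp_near P w z : 4 <= w ->
  \forall x \near z, tpoly P (w * (x - (Num.floor z)%:~R) - 1) = tpoly P (w * fracp x - 1).
Proof.
move=> w4; set l : R := (Num.floor z)%:~R.
have w0 : 0 < w by exact: lt_le_trans w4.
pose d := w^-1.
have d0 : 0 < d by rewrite invr_gt0.
have wd : w * d = 1 by rewrite mulfV // lt0r_neq0.
have d4 : d <= 4^-1 by rewrite lef_pV2 ?posrE.
have /andP[z0 z1] : 0 <= z - l < 1 := fracp_itv z.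
have : z \in `]l - d, l + 1 + d[ by rewrite in_itv /=; apply/andP; split; lra.
have t0 y : y <= 0 -> tpoly P y = 0.
  by move=> y0; rewrite /tpoly ltNge y0.
have t1 y : 1 <= y -> tpoly P y = 0.
  by move=> y0; rewrite /tpoly [y < 1]ltNge y0 andbF.
move=> /near_in_itvoo; apply: filterS => x; rewrite in_itv /= => /andP[xl xr].
have [xl'|lx] := ltP x l.
  rewrite (@fracpE _ x (Num.floor z - 1)); last first.
    by rewrite intrB -/l; apply/andP; split; lra.
  rewrite intrB -/l t0 ?t1 //.
    have : w * (1 - d) <= w * (x - (l - 1)) by rewrite ler_wpM2l ?(ltW w0) //; lra.
    rewrite mulrBr wd mulr1; lra.
  have : w * (x - l) <= w * 0 by rewrite ler_wpM2l ?(ltW w0) //; lra.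
  rewrite mulr0; lra.
have [xl'|lx'] := ltP x (l + 1).
  by rewrite (@fracpE _ x (Num.floor z)) // -/l; apply/andP; split; lra.
rewrite (@fracpE _ x (Num.floor z + 1)); last first.
  by rewrite intrD -/l; apply/andP; split; lra.
rewrite intrD -/l t1 ?t0 //.
  have : w * (x - (l + 1)) <= w * d by rewrite ler_wpM2l ?(ltW w0) //; lra.
  rewrite wd; lra.
have : w * 1 <= w * (x - l) by rewrite ler_wpM2l ?(ltW w0) //; lra.
lra.
Qed.

Lemma is_derive_atom_chain r s j z : (j.+2 <= r)%N ->
  is_derive z 1 (fun x => scale s ^+ j * tpoly ((parab ^+ r)^`(j)) (scale s * fracp x - 1))
    (scale s ^+ j.+1 * tpoly ((parab ^+ r)^`(j.+1)) (scale s * fracp z - 1)).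
Proof.
move=> jr; set w := scale s; set P := (parab ^+ r)^`(j).
have dP : (parab ^+ 2 %| P)%R.
  apply: (dvdp_trans _ (@dvdp_derivn_parab R r j (ltnW (ltnW jr)))).
  by apply: dvdp_exp2l; rewrite leq_subRL ?(ltnW (ltnW jr)) // addn2.
set c : R := (Num.floor z)%:~R.
have h1 : is_derive z 1 (fun x : R => w * (x - c) - 1) w.
  have -> : (fun x : R => w * (x - c) - 1) = (w \*: (fun x : R => x)) \+ cst (- w * c - 1).
    by apply/funext => x /=; rewrite /GRing.scale /=; ring.
  have := @is_deriveD _ _ _ (w \*: (fun x : R => x)) (cst (- w * c - 1)) z 1 _ _
    (is_deriveZ w (is_derive_id z (1 : R))) (is_derive_cst _ z 1).
  by rewrite addr0 /GRing.scale /= mulr1.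
have h2 := is_derive_tpoly (w * (z - c) - 1) dP.
have h3 := @is_derive1_comp R (tpoly P) (fun x : R => w * (x - c) - 1) z _ _ h2 h1.
have h4 : is_derive z 1 (fun x => tpoly P (w * fracp x - 1)) (tpoly P^`() (w * (z - c) - 1) * w).
  by apply: near_eq_is_derive h3; exact: (tpoly_fracp_near P z (scale_ge4 s)).
have -> : w ^+ j.+1 * tpoly ((parab ^+ r)^`(j.+1)) (w * fracp z - 1) =
    w ^+ j *: (tpoly P^`() (w * (z - c) - 1) * w).
  by rewrite derivnS -/P /GRing.scale /= exprSr /fracp -/c; ring.
exact: is_deriveZ h4.
Qed.

Definition atom_supp s z : R := (0 < scale s * fracp z - 1 < 1)%R%:R.

(** Majorizes the support of iterated differences: see [sums_supp]. *)
Fixpoint sums l (F : R -> R) : R -> R :=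
  if l is y :: l' then sums l' (fun x => F (x + y) + F x) else F.

Lemma sums_supp l (F S : R -> R) : (forall x, 0 <= S x) ->
  (forall x, F x != 0 -> 1 <= S x) -> forall x, diffs l F x != 0 -> 1 <= sums l S x.
Proof.
elim: l F S => [|y l IH] F S S0 FS //=; apply: IH.
  by move=> x; rewrite addr_ge0.
move=> x; rewrite /diff1; have [->|Fx _] := eqVneq (F x) 0; last first.
  by rewrite (le_trans (FS _ Fx)) // lerDr.
have [->|Fy _] := eqVneq (F (x + y)) 0; first by rewrite subrr eqxx.
by rewrite (le_trans (FS _ Fy)) // lerDl.
Qed.

Lemma sums_ge0 l (S : R -> R) : (forall x, 0 <= S x) -> forall x, 0 <= sums l S x.
Proof.
by elim: l S => //= y l IH S S0; apply: IH => x; rewrite addr_ge0.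
Qed.

Lemma measurable_sums l (S : R -> R) : measurable_fun [set: R] S ->
  measurable_fun [set: R] (sums l S).
Proof.
elim: l S => //= y l IH S mS; apply: IH.
by apply: measurable_funD => //; exact: measurable_shift.
Qed.

Lemma integral_sums l (S : R -> R) : (forall x, 0 <= S x) ->
  measurable_fun [set: R] S -> per1 S ->
  (\int[mu]_(z in `[0%R, 1%R[) (sums l S z)%:E =
   (2 ^+ size l)%:E * \int[mu]_(z in `[0%R, 1%R[) (S z)%:E)%E.
Proof.
elim: l S => [|y l IH] S S0 mS pS /=; first by rewrite mul1e.
rewrite IH; last first.
- by move=> z c; rewrite addrAC !pS.
- by apply: measurable_funD => //; exact: measurable_shift.
- by move=> x; rewrite addr_ge0.
under eq_integral do rewrite EFinD.
rewrite ge0_integralD //; last first.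
- by apply: measurable_funTS; exact/measurable_EFinP.
- by move=> x _; rewrite lee_fin.
- by apply: measurable_funTS; apply/measurable_EFinP; exact: measurable_shift.
- by move=> x _; rewrite lee_fin.
rewrite (@integral_per1_shift _ y (fun z => (S z)%:E)) //; last 2 first.
- exact/measurable_EFinP.
- by move=> z c; rewrite pS.
rewrite -{1}[X in (X + _)%E]mul1e -{1}[X in (_ + X)%E]mul1e -ge0_muleDl //.
by rewrite muleA -EFinD -EFinM exprS mulrC.
Qed.

Lemma per1_atom_supp s : per1 (atom_supp s).
Proof. by move=> z c; rewrite /atom_supp fracpD. Qed.

Lemma measurable_affine_fracp s : measurable_fun [set: R] (fun z => scale s * fracp z - 1).
Proof.
apply: measurable_funB; last exact: measurable_cst.
apply: measurable_funM; [exact: measurable_cst|exact: measurable_fracp].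
Qed.

Lemma atom_suppE s z : 0 <= z < 1 ->
  atom_supp s z = \1_(`](scale s)^-1, 2 / scale s[%classic) z.
Proof.
move=> z01; rewrite /atom_supp fracp_id // indicE /=; congr ((nat_of_bool _)%:R).
have w0 := scale_gt0 s.
by rewrite mem_setE in_itv /= subr_gt0 ltrBlDr -ltr_pdivrMl // mulr1 ltr_pdivlMr // mulrC.
Qed.

Lemma integral_atom_supp s :
  (\int[mu]_(z in `[0%R, 1%R[) (atom_supp s z)%:E = ((scale s)^-1)%:E)%E.
Proof.
have w0 := scale_gt0 s; have w4 := scale_ge4 s.
have wi : (scale s)^-1 <= 4^-1 by rewrite lef_pV2 ?posrE.
transitivity (\int[mu]_(z in `[0%R, 1%R[) (\1_(`](scale s)^-1, 2 / scale s[%classic) z)%:E)%E.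
  by apply: eq_integral => z; rewrite inE /= in_itv /= => z01; rewrite atom_suppE.
rewrite integral_indic //= setIidl; last first.
  move=> z /=; rewrite !in_itv /= => /andP[z0 z1].
  rewrite (le_trans _ (ltW z0)) ?invr_ge0 ?(ltW w0) //= (lt_le_trans z1) //.
  by rewrite mulr2n mulrDl mul1r; lra.
rewrite lebesgue_measure_itv /= lte_fin ifT; last first.
  by rewrite ltr_pdivlMr // mulVf ?lt0r_neq0 // ltr1n.
by rewrite -EFinB mulr2n mulrDl mul1r addrK.
Qed.

Lemma measurable_tpoly P : (parab ^+ 2 %| P)%R -> measurable_fun [set: R] (tpoly P).
Proof.
move=> dP; apply: continuous_measurable_fun => y.
apply: differentiable_continuous; apply/derivable1_diffP.
by have [] := is_derive_tpoly y dP.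
Qed.

Lemma atom_ge0 r s z : 0 <= atom r s z.
Proof.
rewrite /atom /tpoly; case: ifPn => // /andP[y0 y1].
by rewrite horner_exp parabE exprn_ge0 // mulr_ge0 ?(ltW y0) // subr_ge0 (ltW y1).
Qed.

Lemma atom_le1 r s z : atom r s z <= 1.
Proof.
rewrite /atom /tpoly; case: ifPn => [/andP[y0 y1]|_]; last exact: ler01.
move: y0 y1; set y := _ - 1 => y0 y1.
have y1' : 0 <= 1 - y by rewrite subr_ge0 ltW.
rewrite horner_exp parabE exprn_ile1 ?mulr_ge0 ?mulr_ile1 ?(ltW y0) ?(ltW y1) //.
by rewrite gerBl ltW.
Qed.

Lemma bounded_periodic_atom r s : (2 <= r)%N -> bounded_periodic 1 (atom r s).
Proof.
move=> r2; split.
- apply: (measurableT_comp (measurable_tpoly _)); first exact: dvdp_exp2l.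
  exact: measurable_affine_fracp.
- by move=> z c; rewrite /atom fracpD.
- by move=> z; rewrite ger0_norm ?atom_ge0 ?atom_le1.
Qed.

Lemma diffs_atom_le r n : (n.+1 <= r)%N -> exists2 C, 0 < C &
  forall s l, (size l <= n)%N -> forall z,
    `|diffs l (atom r s) z| <= C * \prod_(y <- l) (scale s * `|y|).
Proof.
move=> nr; pose P j := (parab ^+ r : {poly R})^`(j).
have /choice [C hC] : forall j, exists c, 0 < c /\ forall y, `|tpoly (P j) y| <= c.
  by move=> j; have [C C0 hC] := tpoly_bounded (P j); exists C.
exists (\sum_(j < n.+1) C j).
  rewrite big_ord_recl ltr_pwDl ?(hC _).1 ?sumr_ge0 // => j _; exact: ltW (hC _).1.
move=> s l ln z; have w0 := scale_gt0 s.
pose g j x := scale s ^+ j * tpoly (P j) (scale s * fracp x - 1).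
have -> : atom r s = g 0%N by apply/funext => x; rewrite /g mul1r.
have gd j x : (j < size l)%N -> is_derive x 1 (g j) (g j.+1 x).
  by move=> jl; apply: is_derive_atom_chain; rewrite (leq_trans _ nr) // ltnS (leq_trans jl).
have gM x : `|g (size l) x| <= scale s ^+ size l * C (size l).
  by rewrite normrM normrX gtr0_norm // ler_wpM2l ?exprn_ge0 ?(ltW w0) // (hC _).2.
apply: le_trans (diffs_mvt gd gM erefl z) _.
have -> : \prod_(y <- l) (scale s * `|y|) = scale s ^+ size l * \prod_(y <- l) `|y|.
  by rewrite big_split /= big_const_seq count_predT iter_mulr_1.
rewrite mulrAC [leRHS]mulrC ler_wpM2l //.
  by rewrite mulr_ge0 ?exprn_ge0 ?(ltW w0) ?prodr_ge0.
rewrite -ltnS in ln; rewrite (bigD1 (Ordinal ln)) //= lerDl sumr_ge0 // => j _.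
exact: ltW (hC _).1.
Qed.

(** Two bounds for the integral of an iterated difference against a
    test function of integral u: its supremum times u, and its supremum times the
    measure of its support, which is a multiple of 2^-s. *)
Lemma smooth_test_atom r n : (n.+1 <= r)%N -> (2 <= r)%N -> exists2 C, 0 < C &
  forall s u, 0 <= u ->
    smooth_test n u (C * Num.min u (2 ^- s)) (scale s) (atom r s).
Proof.
move=> nr r2; have [C C0 hC] := diffs_atom_le nr.
exists (C * 2 ^+ n); first by rewrite mulr_gt0 ?exprn_gt0.
move=> s u u0 psi tp l ln; set A := \prod_(y <- l) _.
have [mp pp p01 pu] := tp.
have A0 : 0 <= A by rewrite prodr_ge0 // => y _; rewrite mulr_ge0 // ltW ?scale_gt0.
have CA0 : 0 <= C * A by rewrite mulr_ge0 // ltW.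
have n1 : 1 <= 2 ^+ n :> R by rewrite exprn_ege1 // ler1n.
suff h : (tint psi (diffs l (atom r s)) <= (C * A)%:E * (2 ^+ n * Num.min u (2 ^- s))%:E)%E.
  by apply: (le_trans h); rewrite -EFinM lee_fin le_eqVlt; apply/orP; left; apply/eqP; ring.
have mS : measurable_fun [set: R] (atom_supp s).
  apply: (measurable_funS (E := setT)) => //.
  rewrite (_ : atom_supp s = \1_(`]0, 1[%classic) \o (fun z => scale s * fracp z - 1)).
    apply: measurableT_comp; last exact: measurable_affine_fracp.
    exact: measurable_indic.
  by apply/funext => z /=; rewrite indicE mem_setE in_itv.
have S0 z : 0 <= atom_supp s z by [].
rewrite minEle; case: ifPn => _.
  apply: (@le_trans _ _ ((C * A)%:E * (u)%:E)%E); last first.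
    by rewrite lee_wpmul2l ?lee_fin // ler_peMl.
  apply: (@le_trans _ _ ((C * A)%:E * \int[mu]_(z in `[0%R, 1%R[) (psi z)%:E)%E); last first.
    by rewrite lee_wpmul2l ?lee_fin.
  rewrite -ge0_integralZl_EFin //; last 2 first.
  - by move=> z _; rewrite lee_fin; have /andP[] := p01 z.
  - by apply: measurable_funTS; exact/measurable_EFinP.
  apply: le_integral_ge0 => z _; have /andP[q0 q1] := p01 z.
    by rewrite lee_fin mulr_ge0.
  by rewrite -EFinM lee_fin ler_wpM2r // hC.
apply: (@le_trans _ _ ((C * A)%:E *
    \int[mu]_(z in `[0%R, 1%R[) (sums l (atom_supp s) z)%:E)%E); last first.
  rewrite lee_wpmul2l ?lee_fin // integral_sums //; last exact: per1_atom_supp.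
  rewrite integral_atom_supp -EFinM lee_fin ler_pM ?invr_ge0 ?exprn_ge0 ?(ltW (scale_gt0 s)) //.
    by rewrite ler_weXn2l // ler1n.
  by rewrite lef_pV2 ?posrE ?exprn_gt0 ?scale_gt0 // /scale ler_peMl ?exprn_ge0 // ler1n.
have SS0 z : 0 <= sums l (atom_supp s) z by apply: sums_ge0.
rewrite -ge0_integralZl_EFin //; last 2 first.
- by move=> z _; rewrite lee_fin.
- by apply: measurable_funTS; apply/measurable_EFinP; exact: measurable_sums.
apply: le_integral_ge0 => z _; have /andP[q0 q1] := p01 z.
  by rewrite lee_fin mulr_ge0.
rewrite -EFinM lee_fin.
have [->|dz] := eqVneq (diffs l (atom r s) z) 0.
  by rewrite normr0 mul0r mulr_ge0.
apply: ler_pM => //; first exact: hC.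
apply: (le_trans q1); apply: sums_supp dz => // x.
by rewrite /atom /tpoly /atom_supp; case: ifPn => // _; rewrite eqxx.
Qed.

(** The basic upper estimate. For steps shorter than the support the
    order is split into an integer and a fractional part in [0,1); for longer
    steps there is no gain and the trivial bound applies. *)
Lemma tint_fdiff_atom_le k r : 0 <= k -> k + 3 <= r%:R -> exists2 C, 0 < C &
  forall s h u psi, 0 <= u -> test_fun u psi ->
  (tint psi (fdiff k h (atom r s)) <=
   (C * (Num.min 1 ((2 ^+ s * `|h|) `^ k) * Num.min u (2 ^- s)))%:E)%E.
Proof.
move=> k0 kr; pose K := Num.trunc k; pose ka := k - K%:R.
have ka0 : 0 <= ka by rewrite subr_ge0 truncn_le.
have ka1 : ka < 1 by rewrite ltrBlDr addrC natr1 truncnS_gt.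
have kE : k = ka + K%:R by rewrite subrK.
have Kr : (K.+2 < r)%N.
  rewrite -(ltr_nat R) (lt_le_trans _ kr) // -[K.+2]addn2 natrD.
  have : K%:R <= k by rewrite truncn_le.
  lra.
have [C1 C10 hC1] := smooth_test_atom (ltnW Kr) (leq_trans (isT : (1 < K.+3)%N) Kr).
have [C2 C20 hC2] := tint_fdiff_scaled_le K ka0 ka1.
have [C3 C30 hC3] := tint_fdiff_le k0.
have oneP : (1 : R) `^ k = 1 by rewrite powR1.
have k4 : 0 < 4 `^ k :> R by rewrite powR_gt0.
exists ((C2 + C3) * C1 * 4 `^ k); first by rewrite !mulr_gt0 ?addr_gt0.
move=> s h u psi u0 tp; have w0 := scale_gt0 s.
have na := @bounded_periodic_atom r s (leq_trans (isT : (1 < K.+3)%N) Kr).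
set m := Num.min u _.
have m0 : 0 <= m by rewrite le_min u0 invr_ge0 exprn_ge0.
have A0 : 0 <= C1 * m by rewrite mulr_ge0 // ltW.
have sm := hC1 s u u0.
have p0 : 0 <= 2 ^+ s * `|h| by rewrite mulr_ge0 ?exprn_ge0.
have [wh|wh] := leP (scale s * `|h|) 1.
  have := hC2 u (C1 * m) (scale s) h 1 _ A0 (ltW w0) wh na sm psi tp.
  rewrite -kE => /le_trans; apply; rewrite lee_fin.
  have p1 : 2 ^+ s * `|h| <= 1.
    by rewrite (le_trans _ wh) // ler_wpM2r // /scale ler_peMl ?exprn_ge0 // ler1n.
  have -> : Num.min 1 ((2 ^+ s * `|h|) `^ k) = (2 ^+ s * `|h|) `^ k.
    apply/min_idPr; rewrite -[leRHS]oneP.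
    by rewrite ge0_ler_powR ?nnegrE // ler01.
  have -> : scale s * `|h| = 4 * (2 ^+ s * `|h|) by rewrite /scale mulrA.
  rewrite (powRM _ _ p0) //; set q := 4 `^ k; set q' := (_ * _) `^ k.
  have -> : C2 * (C1 * m) * (q * q') = C2 * (C1 * q * (q' * m)) by ring.
  have -> : (C2 + C3) * C1 * q * (q' * m) = (C2 + C3) * (C1 * q * (q' * m)) by ring.
  rewrite ler_wpM2r ?lerDl ?(ltW C30) //.
  by rewrite !mulr_ge0 ?powR_ge0 // ltW.
have := hC3 u (C1 * m) h 1 (atom r s) A0 na _ psi tp.
move=> /(_ _)/le_trans; apply.
  by move=> psi' tp'; have := sm psi' tp' [::] (leq0n _); rewrite /= big_nil mulr1.
rewrite lee_fin.
have h4 : 1 <= 4 `^ k * Num.min 1 ((2 ^+ s * `|h|) `^ k).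
  rewrite minr_pMr ?powR_ge0 // mulr1 le_min -powRM //; apply/andP; split.
    by rewrite -[leLHS](powRr0 4) ler_powR // ler1n.
  rewrite -[leLHS]oneP ge0_ler_powR ?nnegrE ?mulr_ge0 ?exprn_ge0 ?ler01 //.
  by rewrite mulrA ltW.
have -> : (C2 + C3) * C1 * 4 `^ k * (Num.min 1 ((2 ^+ s * `|h|) `^ k) * m) =
  (C2 + C3) * (C1 * m) * (4 `^ k * Num.min 1 ((2 ^+ s * `|h|) `^ k)) by ring.
rewrite -[leLHS]mulr1 ler_pM ?mulr_ge0 ?(ltW C30) ?(ltW C10) //.
by rewrite ler_wpM2r // lerDr ltW.
Qed.

End atoms.

(** * Lacunary superpositions of atoms *)

Section superposition.
Context {R : realType}.
Implicit Types (k h u x z : R) (a c : nat -> R) (psi : R -> R).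
Local Notation mu := (@lebesgue_measure R).

(** Every point lies in the support of at most one atom, so that the series has
    at most one nonzero term and no condition on the coefficients is needed. *)
Definition super r a z : R := limn (series (fun s => a s * atom r s z)).

Lemma atom_neq0 r s z : atom r s z != 0 -> 1 < scale s * fracp z < 2.
Proof.
rewrite /atom /tpoly; case: ifPn => [/andP[h1 h2] _|_]; last by rewrite eqxx.
by apply/andP; split; lra.
Qed.

Lemma atom_disjoint r s s' z : atom r s z != 0 -> s' != s -> atom r s' z = 0.
Proof.
move=> /atom_neq0 /andP[h1 h2] ss; apply/eqP/negPn/negP => /atom_neq0 /andP[h3 h4].
have aux (i j : nat) : (i < j)%N -> 1 < scale i * fracp z -> scale j * fracp z < 2 -> False.
  move=> ij hi hj; suff : 2 < scale j * fracp z by rewrite ltNge (ltW hj).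
  have e : scale j = 2 ^+ (j - i) * scale i :> R.
    by rewrite /scale mulrCA -exprD subnK // ltnW.
  rewrite e -mulrA (@lt_le_trans _ _ (2 * (scale i * fracp z))) //; first by lra.
  rewrite ler_wpM2r ?(le_trans ler01 (ltW hi)) //.
  by rewrite -[leLHS]expr1 ler_weXn2l ?ler1n // subn_gt0.
have [ij|ij|e] := ltngtP s s'; last by rewrite e eqxx in ss.
  exact: aux ij h1 h4.
exact: aux ij h3 h2.
Qed.

Lemma super_series_cvg r a z : cvgn (series (fun s => a s * atom r s z)).
Proof.
have [[s0 hs0]|/forallNP h] := pselect (exists s, atom r s z != 0).
  apply/cvg_ex; exists (a s0 * atom r s0 z).
  apply: cvg_near_cst; near=> n; rewrite /series /=.
  have sn : (s0 < n)%N by near: n; exists s0.+1.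
  rewrite (bigD1_seq s0) ?mem_index_iota ?iota_uniq //= big1 ?addr0 // => s ss.
  by rewrite (atom_disjoint hs0 ss) mulr0.
apply/cvg_ex; exists 0; apply: cvg_near_cst; near=> n.
rewrite /series /= big1 // => s _; have /negP := h s; rewrite negbK => /eqP ->.
by rewrite mulr0.
Unshelve. all: by end_near.
Qed.

Lemma lim_series_EFin (v : nat -> R) : cvgn (series v) ->
  ((limn (series v))%:E = \sum_(n <oo) (v n)%:E)%E.
Proof.
move=> cv; rewrite -EFin_lim //; congr (limn _); apply/funext => n /=.
by rewrite /series /= sumEFin.
Qed.

Lemma superEF r a z : ((super r a z)%:E = \sum_(s <oo) (a s * atom r s z)%:E)%E.
Proof. by rewrite lim_series_EFin //; exact: super_series_cvg. Qed.

Lemma super_ge0 r a z : (forall s, 0 <= a s) -> 0 <= super r a z.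
Proof.
move=> a0; rewrite -lee_fin superEF; apply: nneseries_ge0 => s _ _.
by rewrite lee_fin mulr_ge0 // atom_ge0.
Qed.

Lemma superE r a s z : atom r s z != 0 -> super r a z = a s * atom r s z.
Proof.
move=> hs; apply: cvg_lim => //; apply: cvg_near_cst; near=> n; rewrite /series /=.
have sn : (s < n)%N by near: n; exists s.+1.
rewrite (bigD1_seq s) ?mem_index_iota ?iota_uniq //= big1 ?addr0 // => s' ss.
by rewrite (atom_disjoint hs ss) mulr0.
Unshelve. all: by end_near.
Qed.

Lemma super_eq0 r a z : (forall s, atom r s z = 0) -> super r a z = 0.
Proof.
move=> h; apply: cvg_lim => //; apply: cvg_near_cst; near=> n; rewrite /series /=.
by rewrite big1 // => s _; rewrite h mulr0.
Unshelve. all: by end_near.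
Qed.

Lemma per1_super r a : per1 (super r a).
Proof.
move=> z l; rewrite /super; congr (limn (series _)); apply/funext => s.
by rewrite /atom fracpD.
Qed.

Lemma measurable_super r a : (2 <= r)%N -> measurable_fun [set: R] (super r a).
Proof.
move=> r2; apply: (@measurable_fun_cvg _ _ _ _ (fun n z =>
  series (fun s => a s * atom r s z) n)).
  move=> n; rewrite /series /=; apply: measurable_sum => s.
  have [mF _ _] := @bounded_periodic_atom R r s r2.
  exact: measurable_funM (measurable_cst _) mF.
by move=> z _; exact: super_series_cvg.
Qed.

Lemma cvg_series_ge0_bounded (v : nat -> R) M : (forall n, 0 <= v n) ->
  (forall n, \sum_(0 <= i < n) v i <= M) -> cvgn (series v).
Proof.
move=> v0 vM; apply: (@cvg_series_norm_bounded _ _ M) => n.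
by under eq_bigr do rewrite ger0_norm //.
Qed.

(** Split the coefficients into positive and negative parts; for each
    part the double series has nonnegative terms and may be summed in any
    order. *)
Lemma lim_series_super_le r a c (C M : R) (x : nat -> R) :
  (forall s, 0 <= a s) ->
  (forall n, \sum_(0 <= i < n) `|c i| <= C) ->
  (forall n, \sum_(0 <= i < n) `|c i| * super r a (x i) <= M) ->
  ((limn (series (fun i => c i * super r a (x i))))%:E <=
   \sum_(s <oo) (a s * `|limn (series (fun i => c i * atom r s (x i)))|)%:E)%E.
Proof.
move=> a0 cC cM; pose cp i := Num.max (c i) 0; pose cn i := Num.max (- c i) 0.
have cp0 i : 0 <= cp i by rewrite le_max lexx orbT.
have cn0 i : 0 <= cn i by rewrite le_max lexx orbT.
have cE i : cp i = c i + cn i.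
  by rewrite /cp /cn; case: (leP (c i) 0) => h1; case: (leP (- c i) 0) => h2; lra.
have cple i : cp i <= `|c i| by rewrite /cp ge_max ler_norm /=.
have cnle i : cn i <= `|c i| by rewrite /cn ge_max -normrN ler_norm /=.
have split (g : nat -> R) B : (forall i, 0 <= g i) ->
    (forall n, \sum_(0 <= i < n) `|c i| * g i <= B) ->
    (\sum_(i <oo) (cp i * g i)%:E = (limn (series (fun i => c i * g i)))%:E +
      \sum_(i <oo) (cn i * g i)%:E)%E /\ (\sum_(i <oo) (cn i * g i)%:E <= B%:E)%E.
  move=> g0 gB.
  have hn n : \sum_(0 <= i < n) cn i * g i <= B.
    by rewrite (le_trans _ (gB n)) // ler_sum // => i _; rewrite ler_wpM2r.
  have c1 : cvgn (series (fun i => cn i * g i)).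
    by apply: (@cvg_series_ge0_bounded _ B) => // i; rewrite mulr_ge0.
  have c2 : cvgn (series (fun i => c i * g i)).
    apply: (@cvg_series_norm_bounded _ _ B) => n.
    by under eq_bigr do rewrite normrM (ger0_norm (g0 _)).
  split; last by apply: le_nneseries_bound => // i; rewrite mulr_ge0.
  rewrite -!lim_series_EFin //; last first.
    apply: (@cvg_series_ge0_bounded _ B) => [i|n]; first by rewrite mulr_ge0.
    by rewrite (le_trans _ (gB n)) // ler_sum // => i _; rewrite ler_wpM2r.
  rewrite -EFinD -limD //; congr ((limn _)%:E); apply/funext => n /=.
  rewrite -[RHS]/(series _ n + series _ n) /series /= -big_split.
  by apply: eq_bigr => i _; rewrite cE mulrDl.
have sw (d : nat -> R) : (forall i, 0 <= d i) ->
    (\sum_(i <oo) (d i * super r a (x i))%:E =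
     \sum_(s <oo) (a s)%:E * \sum_(i <oo) (d i * atom r s (x i))%:E)%E.
  move=> d0.
  transitivity (\sum_(i <oo) \sum_(s <oo) (d i * (a s * atom r s (x i)))%:E)%E.
    apply: eq_eseriesr => i _; rewrite EFinM superEF -nneseriesZl.
      by apply: eq_eseriesr => s _; rewrite EFinM.
    by move=> s _; rewrite lee_fin mulr_ge0 // atom_ge0.
  rewrite nneseries_interchange; last first.
    by move=> i s; rewrite lee_fin !mulr_ge0 // atom_ge0.
  apply: eq_eseriesr => s _; rewrite -nneseriesZl.
    by apply: eq_eseriesr => i _; rewrite -EFinM mulrCA.
  by move=> i _; rewrite lee_fin mulr_ge0 // atom_ge0.
have [e1 e2] := split (fun i => super r a (x i)) M (fun i => super_ge0 _ _ a0) cM.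
have hs s := split (fun i => atom r s (x i)) C (fun i => atom_ge0 _ _ _) _.
have at_le s n : \sum_(0 <= i < n) `|c i| * atom r s (x i) <= C.
  by rewrite (le_trans _ (cC n)) // ler_sum // => i _; rewrite ler_piMr // atom_le1.
set E := (\sum_(i <oo) (cn i * super r a (x i))%:E)%E in e1 e2 *.
set Z := (\sum_(s <oo) _)%E.
have E0 : (0 <= E)%E.
  by apply: nneseries_ge0 => i _ _; rewrite lee_fin mulr_ge0 // super_ge0.
have Efin : E \is a fin_num by rewrite ge0_fin_numE // (le_lt_trans e2) // ltry.
suff : ((limn (series (fun i => c i * super r a (x i))))%:E + E <= Z + E)%E.
  by rewrite leeD2rE.
rewrite -e1 /E !sw // /Z -nneseriesD; last 2 first.
- by move=> s _; rewrite lee_fin mulr_ge0.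
- move=> s _; rewrite mule_ge0 ?lee_fin //; apply: nneseries_ge0 => i _ _.
  by rewrite lee_fin mulr_ge0 // atom_ge0.
apply: lee_nneseries => [s _ _|s _].
  rewrite mule_ge0 ?lee_fin //; apply: nneseries_ge0 => i _ _.
  by rewrite lee_fin mulr_ge0 // atom_ge0.
have [-> _] := hs at_le s.
rewrite muleDr //.
by rewrite leeD2r // -EFinM lee_fin ler_wpM2l // ler_norm.
Qed.

Lemma lim_divergent (v : nat -> R) : ~ cvgn v -> limn v = 0.
Proof. by move=> /dvgP ->. Qed.

(** Holds at every point, although the superposition is unbounded in
    general: where the series of its difference diverges the difference is 0 by
    convention, and where it converges it converges absolutely, because the
    coefficients have an eventually constant sign. *)
Lemma fdiff_super_le r a k h z : 0 < k -> (forall s, 0 <= a s) ->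
  (`|fdiff k h (super r a) z|%:E <= \sum_(s <oo) (a s * `|fdiff k h (atom r s) z|)%:E)%E.
Proof.
move=> k0 a0; rewrite /fdiff; set x := fun nu : nat => z + (k - nu%:R) * h.
have Z0 : (0 <= \sum_(s <oo) (a s * `|limn (series (fun nu => dcoef k nu * atom r s (x nu)))|)%:E)%E.
  by apply: nneseries_ge0 => s _ _; rewrite lee_fin mulr_ge0.
have [cv|ncv] := pselect (cvgn (series (fun nu => dcoef k nu * super r a (x nu))));
  last by rewrite (lim_divergent ncv) normr0.
have [K kK] := exists_nat_ge k.
have [sg sg1 hsg] := dcoef_sign kK.
have sgn : `|sg| = 1.
  by apply/eqP; rewrite -(@eqrXn2 _ 2) // -normrX expr2 sg1 normr1 expr1n.
have [C C0 hC] := dcoef_summable (ltW k0).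
have [B hB] : exists B, forall n, `|series (fun nu => dcoef k nu * super r a (x nu)) n| <= B.
  have [B [_ hB]] := cvg_seq_bounded cv.
  exists (B + 1) => n; apply: hB => //; by rewrite ltrDl.
have [M hM] : exists M, forall n, \sum_(0 <= i < n) `|dcoef k i| * super r a (x i) <= M.
  exists (\sum_(0 <= i < K) `|dcoef k i| * super r a (x i) + (B + B)) => n.
  have t0 i : 0 <= `|dcoef k i| * super r a (x i) by rewrite mulr_ge0 // super_ge0.
  apply: (@le_trans _ _ (\sum_(0 <= i < K + n) `|dcoef k i| * super r a (x i))).
    by rewrite [leRHS](big_cat_nat _ (leq_addl K n)) //= lerDl sumr_ge0.
  rewrite (big_cat_nat _ (leq_addr n K)) //= lerD2l.
  under eq_big_nat => i /andP[Ki _] do rewrite hsg // -mulrA.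
  rewrite -mulr_sumr (le_trans (ler_norm _)) // normrM sgn mul1r.
  have -> : \sum_(K <= i < K + n) dcoef k i * super r a (x i) =
    series (fun nu => dcoef k nu * super r a (x nu)) (K + n)%N -
    series (fun nu => dcoef k nu * super r a (x nu)) K.
    by rewrite /series /= [in RHS](big_cat_nat _ (leq_addr n K)) //= addrAC subrr add0r.
  by rewrite (le_trans (ler_normB _ _)) // lerD.
have h1 := lim_series_super_le a0 hC hM.
have seriesN (g : nat -> R) : series (fun i => - dcoef k i * g i) =
    - series (fun i => dcoef k i * g i).
  apply/funext => n; rewrite -[RHS]/(- series _ n) /series /= -sumrN.
  by apply: eq_bigr => i _; rewrite mulNr.
have h2 : ((- limn (series (fun nu => dcoef k nu * super r a (x nu))))%:E <=
    \sum_(s <oo) (a s * `|limn (series (fun nu => dcoef k nu * atom r s (x nu)))|)%:E)%E.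
  have := @lim_series_super_le r a (fun i => - dcoef k i) C M x a0.
  rewrite seriesN limN //.
  under [X in (_ <= X)%E]eq_eseriesr => s _.
    rewrite seriesN limN; last first.
      apply: (@cvg_series_norm_bounded _ _ C) => n; rewrite (le_trans _ (hC n)) //.
      apply: ler_sum => i _; rewrite normrM ler_piMr // ger0_norm ?atom_ge0 //.
      exact: atom_le1.
    rewrite normrN; over.
  apply=> n; first by under eq_bigr do rewrite normrN; exact: hC.
  by under eq_bigr do rewrite normrN; exact: hM.
have [hl|hl] := leP 0 (limn (series (fun nu => dcoef k nu * super r a (x nu)))).
  by rewrite ger0_norm.
by rewrite ltr0_norm.
Qed.

(** Otherwise the set where f exceeds sg has measure e > u,
    and u/e times its periodized indicator is a test function of integral u whose
    integral against f is at least sg u. *)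
Lemma measurable_superset_of_large (f : R -> \bar R) u (A sg : R) :
  measurable_fun [set: R] f -> (forall z, 0 <= f z)%E -> 0 < u -> 0 <= sg ->
  (forall psi, test_fun u psi ->
    (\int[mu]_(z in `[0%R, 1%R[) (f z * (psi z)%:E) <= A%:E)%E) ->
  A < sg * u ->
  exists E : set R, [/\ measurable E, (mu E <= u%:E)%E &
    forall z, 0 <= z < 1 -> (sg%:E < f z)%E -> E z].
Proof.
move=> mf f0 u0 sg0 fA Asu.
pose E : set R := `[0%R, 1%R[ `&` [set z | (sg%:E < f z)%E].
have mE : measurable E.
  exact: (emeasurable_fun_o_infty (measurable_itv `[0%R, 1%R[) (measurable_funTS mf)).
exists E; split; [exact: mE| |by move=> z z01 fz; split => //=; rewrite in_itv].
have muI : mu `[0%R, 1%R[%classic = 1%:E.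
  by rewrite lebesgue_measure_itv /= lte01 -EFinB subr0.
have muE1 : (mu E <= 1%:E)%E.
  by rewrite -muI; apply: le_measure; rewrite ?inE //; apply: subIsetl.
have Efin : mu E \is a fin_num.
  by rewrite ge0_fin_numE // (le_lt_trans muE1) // ltry.
rewrite leNgt; apply/negP => uE.
pose e := fine (mu E); have eE : mu E = e%:E by rewrite fineK.
have ue : u < e by rewrite -lte_fin -eE.
have e0 : 0 < e by exact: lt_trans ue.
pose psi z : R := u / e * \1_E (fracp z).
have psiE z : 0 <= z < 1 -> psi z = u / e * \1_E z by move=> z01; rewrite /psi fracp_id.
have ue0 : 0 <= u / e by rewrite divr_ge0 ?ltW.
have mpsi : measurable_fun [set: R] psi.
  apply: (measurable_funM (measurable_cst _)).
  apply: measurableT_comp; last exact: measurable_fracp.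
  exact: measurable_indic.
have ipsi : (\int[mu]_(z in `[0%R, 1%R[) (psi z)%:E = u%:E)%E.
  transitivity (\int[mu]_(z in `[0%R, 1%R[) ((u / e)%:E * (\1_E z)%:E))%E.
    by apply: eq_integral => z; rewrite inE /= in_itv /= => z01; rewrite psiE.
  rewrite ge0_integralZl_EFin //; last first.
    by apply: measurable_funTS; apply/measurable_EFinP; exact: measurable_indic.
  rewrite integral_indic // setIidl; last exact: subIsetl.
  by rewrite -[X in (_ * X)%E]/(mu E) eE -EFinM divfK // lt0r_neq0.
have tp : test_fun u psi.
  split => //; last by rewrite ipsi.
    by move=> z l; rewrite /psi fracpD.
  by move=> z; rewrite /psi mulr_ge0 //= mulr_ile1 // ?ler_pdivrMr // ?mul1r ?(ltW ue) //.
have := fA psi tp; rewrite leNgt => /negP; apply.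
apply: (@lt_le_trans _ _ (sg * u)%:E); first by rewrite lte_fin.
rewrite EFinM -ipsi -ge0_integralZl_EFin //; last first.
- by apply: measurable_funTS; exact/measurable_EFinP.
- by move=> z _; rewrite lee_fin; case: tp => _ _ /(_ z)/andP[].
apply: le_integral_ge0 => z; rewrite /= in_itv /= => z01.
  by rewrite -EFinM lee_fin mulr_ge0 // psiE // mulr_ge0.
rewrite psiE // indicE; case: (boolP (z \in E)) => [|_]; last by rewrite mulr0 !mule0.
rewrite inE => -[_ /= fz]; rewrite mulr1 lee_wpmul2r ?lee_fin //.
exact: ltW.
Qed.

(** The estimate of the decreasing rearrangement of a difference, in
    the form of a set outside of which the difference is small. It sums
    [tint_fdiff_atom_le] over the atoms. *)
Lemma fdiff_super_superset k r : 0 < k -> k + 3 <= r%:R -> exists2 C, 0 < C &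
  forall a h u sg, (forall s, 0 <= a s) -> 0 < u -> 0 <= sg ->
  (\sum_(s <oo) (a s * (C * (Num.min 1 ((2 ^+ s * `|h|) `^ k) * Num.min u (2 ^- s))))%:E
    < (sg * u)%:E)%E ->
  exists E : set R, [/\ measurable E, (mu E <= u%:E)%E &
    forall z, 0 <= z < 1 -> sg < `|fdiff k h (super r a) z| -> E z].
Proof.
move=> k0 kr; have [C C0 hC] := tint_fdiff_atom_le (ltW k0) kr; exists C => //.
move=> a h u sg a0 u0 sg0 hs.
have r2 : (2 <= r)%N.
  by rewrite -(ler_nat R) (le_trans _ kr) //; move: (ltW k0); lra.
have mfd s : measurable_fun [set: R] (fdiff k h (atom r s)).
  have [mF pF FM] := @bounded_periodic_atom R r s r2.
  exact: (@measurable_fdiff _ k h _ 1 (ltW k0) FM mF).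
pose f z := (\sum_(s <oo) (a s * `|fdiff k h (atom r s) z|)%:E)%E.
have mas s : measurable_fun [set: R] (fun z => (a s * `|fdiff k h (atom r s) z|)%:E).
  apply/measurable_EFinP; apply: (measurable_funM (measurable_cst _)).
  exact: measurableT_comp.
have mf : measurable_fun [set: R] f.
  by apply: ge0_emeasurable_sum => // s z _ _; rewrite lee_fin mulr_ge0.
have f0 z : (0 <= f z)%E.
  by apply: nneseries_ge0 => s _ _; rewrite lee_fin mulr_ge0.
set S := (\sum_(s <oo) _)%E in hs.
have t0 s : 0 <= a s * (C * (Num.min 1 ((2 ^+ s * `|h|) `^ k) * Num.min u (2 ^- s))).
  by rewrite !mulr_ge0 ?(ltW C0) // le_min ?ler01 ?powR_ge0 ?(ltW u0) ?invr_ge0 ?exprn_ge0.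
have S0 : (0 <= S)%E by apply: nneseries_ge0 => s _ _; rewrite lee_fin.
have Sf : S \is a fin_num by rewrite ge0_fin_numE // (lt_trans hs) // ltry.
have [||E [mE uE hE]] := @measurable_superset_of_large f u (fine S) sg mf f0 u0 sg0.
- move=> psi tp; rewrite fineK //.
  have [mp _ p01 _] := tp.
  apply: (@le_trans _ _ (\int[mu]_(z in `[0%R, 1%R[)
      (\sum_(s <oo) (a s * (`|fdiff k h (atom r s) z| * psi z))%:E))%E).
    apply: le_integral_ge0 => z _; have /andP[q0 _] := p01 z.
      by rewrite mule_ge0 ?lee_fin.
    rewrite muleC -nneseriesZl; last by move=> s _; rewrite lee_fin mulr_ge0.
    apply: lee_nneseries => [s _ _|s _]; first by rewrite -EFinM lee_fin !mulr_ge0.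
    by rewrite -EFinM lee_fin mulrC mulrA.
  have mt s : measurable_fun [set: R]
      (fun z => (a s * (`|fdiff k h (atom r s) z| * psi z))%:E).
    apply/measurable_EFinP; apply: (measurable_funM (measurable_cst _)).
    by apply/measurable_EFinP; exact: measurable_tint_integrand tp _.
  rewrite integral_nneseries //; last 2 first.
  - by move=> s; exact: measurable_funTS (mt s).
  - by move=> s z _; rewrite lee_fin !mulr_ge0 //; have /andP[] := p01 z.
  apply: lee_nneseries => [s _ _|s _].
    by apply: integral_ge0 => z _; rewrite lee_fin !mulr_ge0 //; have /andP[] := p01 z.
  rewrite [in leRHS]EFinM; apply: le_trans (lee_wpmul2l _ (hC s h u psi (ltW u0) tp)).
    rewrite /tint -ge0_integralZl_EFin //.
    + by move=> z _; rewrite lee_fin mulr_ge0 //; have /andP[] := p01 z.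
    + by apply: measurable_funTS; exact: measurable_tint_integrand tp _.
  by rewrite lee_fin.
- by rewrite -lte_fin fineK.
exists E; split => // z z01 sz; apply: hE => //.
by rewrite (lt_le_trans _ (fdiff_super_le r h z k0 a0)) // lte_fin.
Qed.

End superposition.

(** * Lower bounds for differences of superpositions *)

Section lower_bounds.
Context {R : realType}.
Implicit Types (k h x y z : R) (a : nat -> R).

Lemma super_eq0_half r a z : 2^-1 <= fracp z -> super r a z = 0.
Proof.
move=> hz; apply: super_eq0 => s; apply/eqP/negPn/negP => /atom_neq0 /andP[_].
rewrite ltNge => /negP; apply.
apply: (@le_trans _ _ (4 * 2^-1)); first by lra.
by rewrite ler_pM // ?scale_ge4 // invr_ge0.
Qed.

Lemma atom_inside r s z : 1 < scale s * z < 2 -> 0 <= z < 1 ->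
  atom r s z = ((scale s * z - 1) * (2 - scale s * z)) ^+ r.
Proof.
move=> /andP[h1 h2] z01; rewrite /atom fracp_id // /tpoly ifT; last by apply/andP; split; lra.
by rewrite horner_exp parabE; congr ((_ * _) ^+ _); ring.
Qed.

Lemma super_inside r a s z : 1 < scale s * z < 2 ->
  super r a z = a s * atom r s z /\
  atom r s z = ((scale s * z - 1) * (2 - scale s * z)) ^+ r.
Proof.
move=> hz; have w0 := @scale_gt0 R s; have w4 := @scale_ge4 R s.
have z01 : 0 <= z < 1.
  have [h1 h2] := andP hz; apply/andP; split.
    by rewrite -(ler_pM2l w0) mulr0 ltW // (lt_trans ltr01).
  by rewrite -(ltr_pM2l w0) mulr1 (lt_trans h2) // (lt_le_trans _ w4) // ltr_nat.
have e := atom_inside r hz z01; split=> //; apply: superE; rewrite e.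
by have /andP[h1 h2] := hz; rewrite expf_neq0 // mulf_neq0 ?lt0r_neq0 // subr_gt0.
Qed.

(** The points of the lattice 2^-n Z fall into finitely many classes
    modulo the period. *)
Lemma super_lattice_bounded r a (n : nat) y : (forall s, 0 <= a s) ->
  exists M, forall nu : nat, super r a (y + nu%:R * 2 ^- n) <= M.
Proof.
move=> a0; exists (\sum_(i < 2 ^ n) super r a (y + i%:R * 2 ^- n)) => nu.
have n0 : (0 < 2 ^ n)%N by rewrite expn_gt0.
have -> : super r a (y + nu%:R * 2 ^- n) = super r a (y + (nu %% 2 ^ n)%:R * 2 ^- n).
  rewrite -[in RHS](per1_super _ _ _ (Posz (nu %/ 2 ^ n))) {1}(divn_eq nu (2 ^ n)).
  congr (super _ _ _); rewrite natrD natrM natrX -[(Posz _)%:~R]/((nu %/ 2 ^ n)%:R) mulrDl.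
  by rewrite mulfK ?expf_neq0 ?pnatr_eq0 //; ring.
rewrite (bigD1 (Ordinal (ltn_pmod nu n0))) //= lerDl sumr_ge0 // => i _.
exact: super_ge0.
Qed.

(** For the step 2^-n the series of the difference converges
    everywhere, the values of the superposition on the lattice being bounded. *)
Lemma fdiff_lattice_cvg k r a (n : nat) z : 0 <= k -> (forall s, 0 <= a s) ->
  cvgn (series (fun nu => dcoef k nu * super r a (z + (k - nu%:R) * - 2 ^- n))).
Proof.
move=> k0 a0; have [C C0 hC] := dcoef_summable k0.
have [M hM] := super_lattice_bounded r n (z - k * 2 ^- n) a0.
have M0 : 0 <= M by rewrite (le_trans _ (hM 0%N)) // super_ge0.
apply: (@cvg_series_norm_bounded _ _ (C * M)) => m.
apply: (@le_trans _ _ (\sum_(0 <= i < m) `|dcoef k i| * M)); last first.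
  by rewrite -mulr_suml ler_wpM2r.
apply: ler_sum => i _; rewrite normrM ler_wpM2l // ger0_norm ?super_ge0 //.
have -> : z + (k - i%:R) * - 2 ^- n = z - k * 2 ^- n + i%:R * 2 ^- n by ring.
exact: hM.
Qed.

(** Take z slightly to the left of the period, where the
    superposition vanishes. The first K terms of the difference see
    the value 0; all the later ones have coefficients of one sign and cannot
    cancel. About 2^(n-s) of them, with index of order 2^(n-s), hit the middle of
    the atom s, and each has a coefficient of order 2^(-(n-s)(k+1)). *)
Lemma fdiff_super_lower_nonint k r : 0 < k -> (forall i : nat, i%:R != k) ->
  exists c l (n0 : nat), [/\ 0 < c, 0 < l &
  forall a s n, (forall s, 0 <= a s) -> (s + n0 <= n)%N ->
  exists x, [/\ 0 <= x, x + l * 2 ^- s <= 1 & forall z, x <= z < x + l * 2 ^- s ->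
    c * (2 ^+ s / 2 ^+ n) `^ k * a s <= `|fdiff k (- 2 ^- n) (super r a) z|]].
Proof.
move=> k0 kni; pose K := (Num.trunc k).+1.
have kK : k < K%:R by rewrite truncnS_gt.
have [c0 c00 hc0] := dcoef_ge_powR k0 kK kni.
have [sg sg1 hsg] := dcoef_sign (ltW kK).
have sgn : `|sg| = 1.
  by apply/eqP; rewrite -(@eqrXn2 _ 2) // -normrX expr2 sg1 normr1 expr1n.
(* Q = 2^(n-s-4) steps cover a quarter of w, the left end point of the atom;
   the Q indices between 9 Q and 10 Q send z to [5/4 w, 7/4 w], where the atom is
   at least (1/4 * 3/4)^r. *)
exists (c0 * 10 `^ (- (k + 1)) * (3 / 16) ^+ r * 16 `^ k), (16^-1), (K + 4)%N.
split; first by rewrite !mulr_gt0 ?powR_gt0 ?exprn_gt0 ?divr_gt0.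
  by rewrite invr_gt0.
move=> a s n a0 sn.
pose m := (n - s - 4)%N; pose Q : nat := (2 ^ m)%N.
pose eta : R := 2 ^- n; pose w : R := (scale s)^-1.
have nE : n = (m + (s + 4))%N by rewrite /m; lia.
have eta0 : 0 < eta by rewrite invr_gt0 exprn_gt0.
have w0 : 0 < w by rewrite invr_gt0 scale_gt0.
have sw : scale s * w = 1 by rewrite mulfV // lt0r_neq0 // scale_gt0.
have w4 : w <= 4^-1 by rewrite lef_pV2 ?posrE ?scale_gt0 // scale_ge4.
have KQ : (K <= Q)%N.
  by rewrite (leq_trans (ltnW (ltn_expl K (isT : (1 < 2)%N)))) // leq_exp2l // /m; lia.
have KQ' : K%:R <= Q%:R :> R by rewrite ler_nat.
have Q0 : 0 < Q%:R :> R by rewrite ltr0n expn_gt0.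
have wQ : w = 4 * Q%:R * eta.
  have p2 i : (2 : R) ^+ i != 0 by rewrite expf_neq0 // pnatr_eq0.
  rewrite /w /eta /Q /scale natrX nE !exprD; field.
  by rewrite !p2.
have w16 : 16^-1 * 2 ^- s = w / 4.
  have p2 i : (2 : R) ^+ i != 0 by rewrite expf_neq0 // pnatr_eq0.
  by rewrite /w /scale; field; rewrite p2.
exists (1 - w + k * eta); rewrite w16.
have ke : k * eta <= w / 4.
  have -> : w / 4 = Q%:R * eta by rewrite wQ; field.
  by rewrite ler_wpM2r ?(ltW eta0) // (le_trans (ltW kK)).
have ke0 : 0 <= k * eta by rewrite mulr_ge0 ?ltW.
split; [lra|lra|move=> z /andP[z1 z2]].
pose y := z - 1 - k * eta.
have y1 : - w <= y by rewrite /y; lra.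
have y2 : y <= - (3 * w / 4) by rewrite /y; lra.
have xE nu : super r a (z + (k - nu%:R) * - eta) = super r a (y + nu%:R * eta).
  rewrite -[RHS](per1_super r a _ (Posz 1)); congr (super _ _ _).
  by rewrite /y -[(Posz 1)%:~R]/(1 : R); ring.
have z0 nu : (nu < K)%N -> super r a (y + nu%:R * eta) = 0.
  move=> nuK; apply: super_eq0_half.
  have n1 : nu%:R * eta <= w / 4.
    have -> : w / 4 = Q%:R * eta by rewrite wQ; field.
    by rewrite ler_wpM2r ?(ltW eta0) // (le_trans _ KQ') // ler_nat ltnW.
  have n2 : 0 <= nu%:R * eta by rewrite mulr_ge0 // ltW.
  rewrite (@fracpE _ _ (Negz 0)) -[(Negz 0)%:~R]/(- (1 : R)); lra.
pose v nu := dcoef k nu * super r a (z + (k - nu%:R) * - eta).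
have cv : cvgn (series v) := @fdiff_lattice_cvg k r a n z (ltW k0) a0.
have vE nu : sg * v nu = `|dcoef k nu| * super r a (y + nu%:R * eta).
  rewrite /v xE; have [nuK|Kn] := ltnP nu K; first by rewrite z0 // !mulr0.
  by rewrite hsg // mulrA.
have t0 nu : 0 <= sg * v nu by rewrite vE mulr_ge0 // super_ge0.
have -> : fdiff k (- 2 ^- n) (super r a) z = limn (series v) by [].
rewrite (_ : `|limn (series v)| = `|sg * limn (series v)|); last by rewrite normrM sgn mul1r.
rewrite (le_trans _ (ler_norm _)) //.
have cs : cvgn (series (fun nu => sg * v nu)).
  have -> : series (fun nu => sg * v nu) = sg *: series v.
    by apply/funext => i; rewrite -[RHS]/(sg * series v i) /series /= mulr_sumr.
  exact: is_cvgZr.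
have -> : sg * limn (series v) = limn (series (fun nu => sg * v nu)).
  have -> : series (fun nu => sg * v nu) = sg *: series v.
    by apply/funext => i; rewrite -[RHS]/(sg * series v i) /series /= mulr_sumr.
  by rewrite limZr.
apply: (@le_trans _ _ (series (fun nu => sg * v nu) (10 * Q)%N)); last first.
  by apply: nondecreasing_cvgn_le => //; exact: nondecreasing_series.
have Q910 : (9 * Q <= 10 * Q)%N by rewrite leq_mul2r orbT.
rewrite /series /= (big_cat_nat _ Q910) //=.
rewrite -[leLHS]add0r lerD ?sumr_ge0 //.
apply: (@le_trans _ _ (\sum_(9 * Q <= nu < 10 * Q)
   (c0 * (10 * Q%:R) `^ (- (k + 1)) * ((3 / 16) ^+ r * a s)))).
  rewrite sumr_const_nat -mulnBl mul1n -[leRHS]mulr_natr.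
  have -> : 2 ^+ s / 2 ^+ n = (16 * Q%:R)^-1 :> R.
    have p2 i : (2 : R) ^+ i != 0 by rewrite expf_neq0 // pnatr_eq0.
    by rewrite /Q natrX nE !exprD; field; rewrite !p2.
  rewrite powR_inv ?mulr_gt0 // !powRM // ?(ltW Q0) //.
  have -> : - (k + 1) = - k - 1 by ring.
  rewrite [Q%:R `^ (- k - 1)]powRB ?(gt_eqF Q0) ?implybT // powRr1 ?(ltW Q0) //.
  rewrite (powRN 16).
  have Qn : Q%:R != 0 :> R by rewrite gt_eqF.
  have n16 : (16 : R) `^ k != 0 by rewrite gt_eqF // powR_gt0.
  set u1 := _ `^ (- k - 1); set u2 := _ `^ (- k); set u3 := _ `^ k in n16 *.
  set u4 := _ ^+ r.
  rewrite le_eqVlt; apply/orP; left; apply/eqP.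
  by field; rewrite Qn n16.
apply: ler_sum_nat => nu /andP[nu9 nu10]; rewrite vE.
have Kn : (K <= nu)%N.
  by rewrite (leq_trans KQ) // (leq_trans _ nu9) // leq_pmull.
rewrite ler_pM //.
- by rewrite mulr_ge0 ?powR_ge0 // ltW.
- by rewrite mulr_ge0 // exprn_ge0 // divr_ge0.
- apply: le_trans (hc0 nu Kn); rewrite ler_wpM2l ?(ltW c00) // !powRN.
  rewrite lef_pV2 ?posrE ?powR_gt0 ?ltr0n ?mulr_gt0 //.
  rewrite ge0_ler_powR ?nnegrE ?addr_ge0 ?ler01 ?(ltW k0) ?mulr_ge0 ?(ltW Q0) //.
  by rewrite -natrM ler_nat.
have n9 : 9 * (w / 4) <= nu%:R * eta.
  have -> : 9 * (w / 4) = (9 * Q)%:R * eta by rewrite wQ natrM; field.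
  by rewrite ler_wpM2r ?(ltW eta0) // ler_nat.
have n10 : nu%:R * eta <= 10 * (w / 4).
  have -> : 10 * (w / 4) = (10 * Q)%:R * eta by rewrite wQ natrM; field.
  by rewrite ler_wpM2r ?(ltW eta0) // ler_nat ltnW.
set x := y + _.
have x1 : 5 / 4 <= scale s * x.
  have : scale s * (5 / 4 * w) <= scale s * x.
    by rewrite ler_wpM2l ?(ltW (scale_gt0 s)) // /x; lra.
  by rewrite mulrCA sw mulr1.
have x2 : scale s * x <= 7 / 4.
  have : scale s * x <= scale s * (7 / 4 * w).
    by rewrite ler_wpM2l ?(ltW (scale_gt0 s)) // /x; lra.
  by rewrite mulrCA sw mulr1.
have [|-> ->] := @super_inside r a s x; first by apply/andP; split; lra.
rewrite mulrC ler_wpM2l // lerXn2r ?nnegrE ?divr_ge0 ?mulr_ge0 //; try lra.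
set t := scale s * x in x1 x2 *; nra.
Qed.

(** The mean value theorem preserves a lower bound of constant sign for
    the last derivative; with backward steps each difference changes the
    sign. *)
Lemma diffs_mvt_lower n (g : nat -> R -> R) (sg m eta : R) z :
  (forall j x, (j < n)%N -> is_derive x 1 (g j) (g j.+1 x)) ->
  0 <= eta -> `|sg| = 1 ->
  (forall x, z - n%:R * eta <= x <= z -> m <= sg * g n x) ->
  m * eta ^+ n <= `|diffs (nseq n (- eta)) (g 0%N) z|.
Proof.
elim: n g m sg => [|n IH] g m sg gd e0 sg1 gm.
  rewrite expr0 mulr1 /= (le_trans (gm z _)) ?mul0r ?subr0 ?lexx //.
  by rewrite (le_trans (ler_norm _)) // normrM sg1 mul1r.
rewrite exprS mulrA /=.
apply: (IH (fun j => diff1 (- eta) (g j)) _ (- sg)) => //.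
- move=> j t jn; have d1 := gd j t (leqW jn).
  have d2 : is_derive t 1 (fun s => g j (s + - eta)) (g j.+1 (t + - eta)).
    have h1 : is_derive t 1 (fun s : R => s + - eta) (1 + 0).
      by apply: is_deriveD.
    have h2 : is_derive (t + - eta) 1 (g j) (g j.+1 (t + - eta)) by apply: gd; exact: leqW.
    have := @is_derive1_comp R (g j) (fun s : R => s + - eta) t _ _ h2 h1.
    by rewrite addr0 mulr1.
  exact: is_deriveB.
- by rewrite normrN.
move=> x /andP[x1 x2].
have [|||c /itvP c01 e] := @MVT_segment R (g n) (g n.+1) (x - eta) x.
- by rewrite gerBl.
- by move=> t _; exact: gd.
- apply: continuous_subspaceT => t; apply: differentiable_continuous.
  by apply/derivable1_diffP; have [] := gd n t (ltnSn n).
have -> : - sg * diff1 (- eta) (g n) x = sg * g n.+1 c * eta.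
  rewrite /diff1 mulNr -mulrN opprB e -mulrA; congr (_ * (_ * _)); ring.
rewrite ler_wpM2r // gm // -natr1.
have c1 : x - eta <= c by rewrite c01.
have c2 : c <= x by rewrite c01.
by apply/andP; split; lra.
Qed.

Lemma fdiff_nat (n : nat) h (F : R -> R) M x : bounded_by M F ->
  fdiff n%:R h F x = diffs (nseq n h) F x.
Proof.
elim: n F M => [|n IH] F M FM; first by rewrite fdiff0.
rewrite -natr1 (@fdiffS _ _ h F x M) //= (IH _ (M + M)) //.
exact: bounded_by_diff1.
Qed.

Lemma poly_nonzero_interval (P : {poly R}) : P != 0 ->
  exists A B c sg : R, [/\ 0 < A < B, B < 1, 0 < c, `|sg| = 1 &
    forall t, A <= t <= B -> c <= sg * P.[t]].
Proof.
move=> P0.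
have [t0 [t01 Pt0]] : exists t0 : R, 0 < t0 < 1 /\ P.[t0] != 0.
  apply: contrapT => h.
  pose s := [seq (i.+2%:R)^-1 : R | i <- iota 0 (size P)].
  have := @max_poly_roots R P s P0.
  have -> : all (root P) s.
    apply/allP => _ /mapP[i _ ->]; apply/rootP/eqP/negPn/negP => Pi.
    by apply: h; exists (i.+2%:R^-1); rewrite invr_gt0 ltr0n invf_lt1 ?ltr0n // ltr1n.
  have -> : uniq s.
    rewrite map_inj_uniq ?iota_uniq // => i j /invr_inj /eqP.
    by rewrite eqr_nat => /eqP [].
  by rewrite size_map size_iota ltnn => /(_ isT isT).
pose c := `|P.[t0]| / 2; have c0 : 0 < c by rewrite divr_gt0 // normr_gt0.
have cont : {for t0, continuous (fun t => P.[t])} by exact: continuous_horner.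
have /andP[t00 t1] := t01.
have h1 : \forall t \near t0, `|P.[t0] - P.[t]| < c.
  by have /cvgrPdist_lt := cont; apply.
have /nbhs_ballP[d /= d0 hd] := h1.
pose e := Num.min (d / 2) (Num.min (t0 / 2) ((1 - t0) / 2)).
have e0 : 0 < e by rewrite !lt_min !divr_gt0 // subr_gt0.
have ed : e <= d / 2 by rewrite ge_min lexx.
have et : e <= t0 / 2 by rewrite !ge_min lexx orbT.
have et' : e <= (1 - t0) / 2 by rewrite !ge_min lexx !orbT.
exists (t0 - e), (t0 + e), c, (Num.sg P.[t0]); split.
- by apply/andP; split; lra.
- by lra.
- by [].
- by rewrite normr_sg Pt0.
move=> t /andP[ta tb].
have : `|P.[t0] - P.[t]| < c.
  apply: hd; rewrite /ball /= ltr_norml; apply/andP; split; lra.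
rewrite ltr_norml => /andP[b1 b2].
have cE : 2 * c = `|P.[t0]| by rewrite /c; field.
have [p0|p0] := ltP 0 P.[t0].
  rewrite gtr0_sg // mul1r; rewrite gtr0_norm // in cE; lra.
have p1 : P.[t0] < 0 by rewrite lt_neqAle Pt0.
rewrite ltr0_sg // mulN1r; rewrite ltr0_norm // in cE; lra.
Qed.

Lemma parab_exp_derivn_neq0 r (n : nat) : (n <= r)%N -> ((parab : {poly R}) ^+ r)^`(n) != 0.
Proof.
move=> nr.
have sp : size (parab : {poly R}) = 3%N.
  rewrite /parab size_mul ?polyX_eq0 // -?size_poly_eq0.
    by rewrite size_polyX -opprB size_polyN size_XsubC.
  by rewrite -opprB size_polyN size_XsubC.
have p0 : (parab : {poly R}) != 0 by rewrite -size_poly_eq0 sp.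
have p1 : (parab : {poly R}) ^+ r != 0 by rewrite expf_neq0.
have sz : size ((parab : {poly R}) ^+ r) = (2 * r).+1.
  by have := size_exp (parab : {poly R}) r; rewrite sp => <-; rewrite prednK // lt0n size_poly_eq0.
apply: contraTneq isT => h.
have := coef_derivn n ((parab : {poly R}) ^+ r) (2 * r - n); rewrite h coef0 subnKC; last first.
  by rewrite (leq_trans nr) // leq_pmull.
move=> /esym/eqP; rewrite mulrn_eq0 => /orP[|].
  by rewrite eqn0Ngt ffact_gt0 (leq_trans nr) // leq_pmull.
have -> : (2 * r)%N = (size ((parab : {poly R}) ^+ r)).-1 by rewrite sz.
by rewrite -/(lead_coef _) lead_coef_eq0 (negbTE p1).
Qed.

(** For an integral order the difference is local, so the
    argument of the fractional case breaks down. Inside the support of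
    the atom, however, it is an iterated difference of a polynomial whose K-th
    derivative is bounded away from 0 on some interval. *)
Lemma fdiff_super_lower_int (K r : nat) : (K.+2 <= r)%N ->
  exists c l (n0 : nat), [/\ 0 < c, 0 < l &
  forall a s n, (forall s, 0 <= a s) -> (s + n0 <= n)%N ->
  exists x, [/\ 0 <= x, x + l * 2 ^- s <= 1 & forall z, x <= z < x + l * 2 ^- s ->
    c * (2 ^+ s / 2 ^+ n) ^+ K * a s <= `|fdiff K%:R (- 2 ^- n) (super r a) z|]].
Proof.
move=> Kr; have r2 : (2 <= r)%N by rewrite (leq_trans _ Kr).
have Kr' : (K <= r)%N by rewrite (leq_trans _ Kr) // -addn2 leq_addr.
have [A [B [c [sg [/andP[A0 AB] B1 c0 sg1 hc]]]]] :=
  poly_nonzero_interval (parab_exp_derivn_neq0 Kr').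
have d0 : 0 < B - A by rewrite subr_gt0.
have [n0 hn0] := exists_nat_ge (8 * K%:R / (B - A)).
exists (c * 4 ^+ K), ((B - A) / 8), n0.
split; [by rewrite mulr_gt0 ?exprn_gt0|by rewrite divr_gt0|].
move=> a s n a0 sn.
pose w : R := (scale s)^-1; pose eta : R := 2 ^- n.
have S0 := @scale_gt0 R s.
have eta0 : 0 < eta by rewrite invr_gt0 exprn_gt0.
have w0 : 0 < w by rewrite invr_gt0.
have sw : scale s * w = 1 by rewrite mulfV // lt0r_neq0.
have w4 : w <= 4^-1 by rewrite lef_pV2 ?posrE // scale_ge4.
have wE : 2 ^- s = 4 * w :> R.
  have p2 i : (2 : R) ^+ i != 0 by rewrite expf_neq0 // pnatr_eq0.
  by rewrite /w /scale; field; rewrite p2.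
have Ke : K%:R * eta <= w * (B - A) / 2.
  have h1 : 8 * K%:R <= 2 ^+ (n - s) * (B - A).
    rewrite -ler_pdivrMr // (le_trans hn0) // -natrX ler_nat.
    rewrite (leq_trans (ltnW (ltn_expl n0 (isT : (1 < 2)%N)))) // leq_exp2l //.
    by rewrite leq_subRL ?(leq_trans _ sn) ?leq_addr.
  have e1 : eta * 2 ^+ (n - s) = 4 * w.
    have nE : n = (s + (n - s))%N by rewrite subnKC // (leq_trans _ sn) ?leq_addr.
    rewrite -wE /eta {1}nE exprD.
    have p2 i : (2 : R) ^+ i != 0 by rewrite expf_neq0 // pnatr_eq0.
    by field; rewrite !p2.
  have := ler_wpM2l (ltW eta0) h1; rewrite [eta * (2 ^+ _ * _)]mulrA e1; lra.
have wA : 0 < w * A by rewrite mulr_gt0.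
have wB : w * B <= w by rewrite ler_piMr ?ltW.
have wBA : w * (B - A) = w * B - w * A by rewrite mulrBr.
have wd : 0 < w * (B - A) by rewrite mulr_gt0.
have lE : (B - A) / 8 * 2 ^- s = w * (B - A) / 2 by rewrite wE; field.
exists (w + w * A + w * (B - A) / 2); rewrite lE; split; [lra|lra|].
move=> z /andP[z1 z2].
pose x nu := z + (K%:R - nu%:R) * - eta.
have ins y : w + w * A <= y <= w + w * B -> A <= scale s * y - 1 <= B.
  move=> /andP[y1 y2].
  have := ler_wpM2l (ltW S0) y1; have := ler_wpM2l (ltW S0) y2.
  by rewrite !mulrDr !mulrA sw !mul1r => h1 h2; apply/andP; split; lra.
have insx nu : (nu <= K)%N -> w + w * A <= x nu <= w + w * B.
  move=> nK; have n1 : 0 <= (K%:R - nu%:R) * eta.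
    by rewrite mulr_ge0 ?(ltW eta0) // subr_ge0 ler_nat.
  have n2 : (K%:R - nu%:R) * eta <= K%:R * eta.
    by rewrite ler_wpM2r ?(ltW eta0) // gerBl.
  rewrite /x mulrN; apply/andP; split; lra.
have nu_le nu : (K < nu)%N -> dcoef K%:R nu = 0 :> R by exact: dcoef_nat_eq0.
have sE nu : dcoef K%:R nu * super r a (x nu) = dcoef K%:R nu * (a s * atom r s (x nu)).
  have [nK|Kn] := leqP nu K; last by rewrite nu_le // !mul0r.
  have /andP[i1 i2] := ins _ (insx _ nK).
  by have [|-> _] := @super_inside r a s (x nu); first by apply/andP; split; lra.
have [mF pF FM] := @bounded_periodic_atom R r s r2.
have -> : fdiff K%:R (- 2 ^- n) (super r a) z = a s * fdiff K%:R (- eta) (atom r s) z.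
  have c1 := @fdiff_is_cvg _ K%:R (- eta) (atom r s) z 1 (ler0n _ _) FM.
  rewrite /fdiff; apply: cvg_lim => //.
  have -> : series (fun nu => dcoef K%:R nu * super r a (z + (K%:R - nu%:R) * - 2 ^- n)) =
     a s *: series (fun nu => dcoef K%:R nu * atom r s (z + (K%:R - nu%:R) * - eta)).
    apply/funext => i; rewrite -[RHS]/(a s * series _ i) /series /= mulr_sumr.
    by apply: eq_bigr => nu _; rewrite sE mulrCA.
  by apply: cvgZr; exact: c1.
rewrite normrM (ger0_norm (a0 s)) mulrC ler_wpM2l //.
rewrite (@fdiff_nat K _ _ _ _ FM).
pose g j y := scale s ^+ j * tpoly ((parab ^+ r)^`(j)) (scale s * fracp y - 1).
have -> : atom r s = g 0%N by apply/funext => y; rewrite /g mul1r.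
apply: le_trans (@diffs_mvt_lower K g sg (c * scale s ^+ K) eta z _ (ltW eta0) sg1 _).
- have -> : 2 ^+ s / 2 ^+ n = 2 ^+ s * eta by [].
  by rewrite exprMn !mulrA /scale exprMn !mulrA.
- move=> j y jK; apply: is_derive_atom_chain.
  by rewrite (leq_trans _ Kr) // !ltnS ltnW.
move=> y /andP[y1 y2].
have yAB : w + w * A <= y <= w + w * B by apply/andP; split; lra.
have /andP[i1 i2] := ins y yAB.
have yf : fracp y = y.
  by have /andP[? ?] := yAB; rewrite fracp_id //; apply/andP; split; lra.
rewrite /g yf /tpoly ifT; last by apply/andP; split; lra.
rewrite mulrCA mulrC ler_wpM2l ?exprn_ge0 ?(ltW S0) // hc //.
by apply/andP.
Qed.

(** The lower counterpart of [tint_fdiff_atom_le]: on an interval of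
    length comparable to 2^-s the difference with step 2^-n, n >= s + n0, is as
    large as that estimate permits. *)
Lemma fdiff_super_lower k r : 0 < k -> k + 3 <= r%:R ->
  exists c l (n0 : nat), [/\ 0 < c, 0 < l &
  forall a s n, (forall s, 0 <= a s) -> (s + n0 <= n)%N ->
  exists x, [/\ 0 <= x, x + l * 2 ^- s <= 1 & forall z, x <= z < x + l * 2 ^- s ->
    c * (2 ^+ s / 2 ^+ n) `^ k * a s <= `|fdiff k (- 2 ^- n) (super r a) z|]].
Proof.
move=> k0 kr; have [[K kK]|/forallNP nK] := pselect (exists K : nat, K%:R = k).
  have Kr : (K.+2 <= r)%N.
    by rewrite -(ler_nat R) (le_trans _ kr) // -kK -natrD ler_nat; lia.
  have [c [l [n0 [c0 l0 h]]]] := fdiff_super_lower_int Kr.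
  exists c, l, n0; split => // a s n a0 sn; have [x [x0 x1 hx]] := h a s n a0 sn.
  exists x; split => // z /hx; rewrite kK -[in X in X -> _]powR_mulrn ?kK //.
by apply: fdiff_super_lower_nonint => // i; apply/eqP => iK; exact: (nK i).
Qed.

End lower_bounds.

(** * Discrete sums with logarithmic factors *)

Section dyadic_sums.
Context {R : realType}.
Implicit Types (a d e k p t x y : R) (i n s N : nat).

Definition p2 x : R := 2 `^ x.

Lemma p2_gt0 x : 0 < p2 x.
Proof. exact: powR_gt0. Qed.

Lemma p2D x y : p2 (x + y) = p2 x * p2 y.
Proof. by rewrite /p2 powRD // pnatr_eq0 implybT. Qed.

Lemma p20 : p2 0 = 1.
Proof. exact: powRr0. Qed.

Lemma p2N x : p2 (- x) = (p2 x)^-1.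
Proof. exact: powRN. Qed.

Lemma p2_nat n : p2 n%:R = 2 ^+ n.
Proof. exact: powR_mulrn. Qed.

Lemma p2_le x y : x <= y -> p2 x <= p2 y.
Proof. by move=> xy; rewrite /p2 ler_powR // ler1n. Qed.

Lemma p2_powR x y : (p2 x) `^ y = p2 (x * y).
Proof. by rewrite /p2 powRrM. Qed.

Lemma p2_ge1 x : 0 <= x -> 1 <= p2 x.
Proof. by move=> x0; rewrite -p20 p2_le. Qed.

Lemma powR_comparable e B x y : 1 <= B -> 0 < x -> 0 < y ->
  x <= B * y -> y <= B * x -> x `^ e <= B `^ `|e| * y `^ e.
Proof.
move=> B1 x0 y0 xy yx; have B0 : 0 < B by exact: lt_le_trans B1.
have pos f u v : 0 <= f -> 0 < u -> 0 < v -> u <= B * v -> u `^ f <= B `^ f * v `^ f.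
  move=> f0 u0 v0 uv; rewrite -powRM ?(ltW B0) ?(ltW v0) //.
  by rewrite ge0_ler_powR ?nnegrE ?(ltW u0) // mulr_ge0 ?(ltW B0) ?(ltW v0).
have [e0|e0] := leP 0 e; first by rewrite ger0_norm //; exact: pos.
have en : 0 <= - e by rewrite oppr_ge0 ltW.
rewrite ltr0_norm //.
have -> : x `^ e = (x `^ (- e))^-1 by rewrite -powRN opprK.
have -> : y `^ e = (y `^ (- e))^-1 by rewrite -powRN opprK.
rewrite ler_pdivlMr ?powR_gt0 // mulrC ler_pdivrMr ?powR_gt0 //.
exact: pos.
Qed.

(** The logarithmic factor (1 - log t)^(-lam) at t of order 2^-s. *)
Definition slow lam s : R := s.+1%:R `^ (- lam).

Lemma slow_gt0 lam s : 0 < slow lam s.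
Proof. by rewrite powR_gt0. Qed.

Lemma poly_le_exp L d : 0 < d -> exists2 C, 0 < C &
  forall x, 0 <= x -> (1 + x) `^ L <= C * p2 (d * x).
Proof.
move=> d0; have ln2 : 0 < ln 2 :> R by rewrite ln_gt0 // ltr1n.
have [L0|L0] := leP L 0.
  exists 1 => // x x0; rewrite mul1r (@le_trans _ _ 1) //.
    rewrite -[leRHS](powRr0 (1 + x)) ler_powR // lerDl //.
  by rewrite p2_ge1 // mulr_ge0 // ltW.
pose c := Num.min 1 (d * ln 2 / L).
have c0 : 0 < c by rewrite lt_min ltr01 divr_gt0 // mulr_gt0.
have c1 : c <= 1 by rewrite ge_min lexx.
have cL : c * L <= d * ln 2 by rewrite -ler_pdivlMr // ge_min lexx orbT.
exists (c^-1 `^ L); first by rewrite powR_gt0 // invr_gt0.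
move=> x x0; have x1 : 0 <= 1 + x by rewrite addr_ge0.
have h : 1 + x <= c^-1 * expR (c * x).
  rewrite ler_pdivlMl // mulrDr mulr1 (le_trans _ (expR_ge1Dx _)) // lerD2r //.
apply: (@le_trans _ _ ((c^-1 * expR (c * x)) `^ L)).
  by rewrite ge0_ler_powR ?nnegrE ?(ltW L0) // (le_trans x1).
rewrite powRM ?invr_ge0 ?expR_ge0 ?(ltW c0) // ler_pM2l ?powR_gt0 ?invr_gt0 //.
rewrite /p2 /powR gt_eqF ?expR_gt0 //= expRK (gt_eqF (ltr0Sn R 1)) ler_expR.
have := ler_wpM2r x0 cL; lra.
Qed.

(** The ratio (s+1)/(n+1) is at most 1 + |s - n|, and powers of this are
    dominated by any geometric growth. *)
Lemma slow_comparable lam d : 0 < d -> exists2 C, 0 < C &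
  forall s n, slow lam s <= C * slow lam n * p2 (d * `|s%:R - n%:R|).
Proof.
move=> d0; have [C C0 hC] := poly_le_exp `|lam| d0; exists C => // s n.
set x : R := `|s%:R - n%:R|; have x0 : 0 <= x by exact: normr_ge0.
have base (i j : nat) : i.+1%:R <= (1 + `|i%:R - j%:R|) * j.+1%:R :> R.
  have h1 : 1 <= j.+1%:R :> R by rewrite ler1n.
  have h2 := ler_norm (i%:R - j%:R : R).
  have h3 : `|i%:R - j%:R : R| <= `|i%:R - j%:R| * j.+1%:R by rewrite ler_peMr.
  rewrite mulrDl mul1r -[i.+1%:R]natr1 -[X in _ <= X + _]natr1; lra.
have := @powR_comparable (- lam) (1 + x) s.+1%:R n.+1%:R.
rewrite normrN lerDl => /(_ x0 (ltr0Sn _ _) (ltr0Sn _ _) (base s n)).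
rewrite /x distrC => /(_ (base n s)) h.
apply: (le_trans h); rewrite -/(slow lam n) mulrAC ler_wpM2r ?(ltW (slow_gt0 _ _)) //.
by rewrite distrC; exact: hC.
Qed.

Lemma geometric_sum_le d : 0 < d -> exists2 C, 0 < C &
  forall n N, \sum_(0 <= s < N) p2 (- (d * `|s%:R - n%:R|)) <= C.
Proof.
move=> d0; pose q := p2 (- d).
have q0 : 0 < q by exact: p2_gt0.
have q1 : q < 1.
  rewrite /q -p20 /p2 /powR (gt_eqF (ltr0Sn R 1)) ltr_expR mul0r mulNr oppr_lt0.
  by rewrite mulr_gt0 // ln_gt0 // ltr1n.
have geo N : \sum_(0 <= j < N) q ^+ j <= (1 - q)^-1.
  have := subrX1 q N; rewrite -opprB => h.
  rewrite -[leRHS]mul1r ler_pdivlMr ?subr_gt0 // mulrC big_mkord.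
  have -> : (1 - q) * \sum_(i < N) q ^+ i = 1 - q ^+ N.
    by rewrite -[RHS]opprK h -mulNr opprB.
  by rewrite gerBl exprn_ge0 // ltW.
have qE j : p2 (- (d * j%:R)) = q ^+ j.
  by rewrite -mulNr /p2 powRrM powR_mulrn // powR_ge0.
exists (2 * (1 - q)^-1); first by rewrite mulr_gt0 // invr_gt0 subr_gt0.
move=> n N; apply: (@le_trans _ _ (\sum_(0 <= s < n + N) p2 (- (d * `|s%:R - n%:R|)))).
  rewrite [leRHS](big_cat_nat _ (leq_addl n N)) //= lerDl sumr_ge0 // => i _.
  exact/ltW/p2_gt0.
rewrite (big_cat_nat _ (leq_addr N n)) //= mulr2n mulrDl mul1r lerD //.
  rewrite big_nat_rev /= add0n (le_trans _ (geo n)) //.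
  apply: ler_sum_nat => i /andP[_ ilt].
  rewrite natrB // distrC (_ : n%:R - (n%:R - i.+1%:R) = i.+1%:R); last by ring.
  rewrite normr_nat qE exprS ler_piMl ?exprn_ge0 ?(ltW q0) ?(ltW q1) //.
rewrite [(n + N)%N]addnC -[X in \sum_(X <= _ < _) _]add0n big_addn addnK (le_trans _ (geo N)) //.
apply: ler_sum_nat => i _; rewrite natrD addrK normr_nat qE //.
Qed.

Lemma slow_sum_le lam d : 0 < d -> exists2 C, 0 < C &
  forall n N, \sum_(0 <= s < N) slow lam s * p2 (- (d * `|s%:R - n%:R|)) <= C * slow lam n.
Proof.
move=> d0; have d20 : 0 < d / 2 by rewrite divr_gt0.
have [C1 C10 h1] := slow_comparable lam d20; have [C2 C20 h2] := geometric_sum_le d20.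
exists (C1 * C2); first exact: mulr_gt0.
move=> n N; apply: (@le_trans _ _ (\sum_(0 <= s < N) C1 * slow lam n * p2 (- (d / 2 * `|s%:R - n%:R|)))).
  apply: ler_sum => s _; have := h1 s n; set x := `|s%:R - n%:R| => hx.
  have -> : p2 (- (d * x)) = p2 (- (d / 2 * x)) * p2 (- (d / 2 * x)).
    by rewrite -p2D; congr p2; field.
  by rewrite mulrA ler_wpM2r ?(ltW (p2_gt0 _)) // p2N ler_pdivrMr ?p2_gt0.
rewrite -mulr_sumr mulrAC ler_wpM2r ?(ltW (slow_gt0 _ _)) //.
by rewrite ler_wpM2l ?(ltW C10).
Qed.

Lemma p2_min_le d1 d2 d x : d <= d1 -> d <= d2 -> 0 <= d ->
  p2 (- (d1 * x)) * Num.min 1 (p2 ((d1 + d2) * x)) <= p2 (- (d * `|x|)).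
Proof.
move=> h1 h2 d0; have [x0|x0] := leP 0 x.
  apply: (@le_trans _ _ (p2 (- (d1 * x)) * 1)).
    by rewrite ler_wpM2l ?(ltW (p2_gt0 _)) // ge_min lexx.
  by rewrite mulr1 p2_le // lerN2 ger0_norm // ler_wpM2r.
apply: (@le_trans _ _ (p2 (- (d1 * x)) * p2 ((d1 + d2) * x))).
  by rewrite ler_wpM2l ?(ltW (p2_gt0 _)) // ge_min lexx orbT.
rewrite -p2D p2_le // ltr0_norm // mulrN opprK.
have -> : - (d1 * x) + (d1 + d2) * x = d2 * x by ring.
by rewrite ler_wnM2r // ltW.
Qed.

(** The sum that bounds the rearrangement, at a point of order 2^-i, of the
    difference with step of order 2^-n. Bounding min(1, 2^(i-s)) by 2^(e(i-s))
    turns it into a convolution with a kernel decaying geometrically in |s - n|.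
    Using two values of e, slightly above and below 1/q, yields decay in |i - n|
    on both sides. *)
Lemma kernel_sum_le lam gam k e : 0 <= e -> e <= 1 -> 0 < gam + e -> gam + e < k ->
  exists2 C, 0 < C & forall i n N,
  \sum_(0 <= s < N) p2 (- (gam * s%:R)) * slow lam s *
     (Num.min 1 (p2 (k * (s%:R - n%:R))) * Num.min 1 (p2 (i%:R - s%:R)))
  <= C * (slow lam n * p2 (e * i%:R - (gam + e) * n%:R)).
Proof.
move=> e0 e1 g0 gk; pose d := Num.min (gam + e) (k - (gam + e)).
have d0 : 0 < d by rewrite lt_min g0 subr_gt0.
have d1 : d <= gam + e by rewrite ge_min lexx.
have d2 : d <= k - (gam + e) by rewrite ge_min lexx orbT.
have [C C0 hC] := slow_sum_le lam d0; exists C => // i n N.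
rewrite mulrA; apply: (@le_trans _ _ (\sum_(0 <= s < N)
    p2 (e * i%:R - (gam + e) * n%:R) * (slow lam s * p2 (- (d * `|s%:R - n%:R|))))).
  apply: ler_sum => s _.
  have m1 : Num.min 1 (p2 (i%:R - s%:R)) <= p2 (e * (i%:R - s%:R)).
    have [h|h] := leP 0 (i%:R - s%:R : R).
      by rewrite (@le_trans _ _ 1) ?ge_min ?lexx // p2_ge1 // mulr_ge0.
    rewrite (@le_trans _ _ (p2 (i%:R - s%:R))) ?ge_min ?lexx ?orbT // p2_le //.
    rewrite -subr_ge0; have -> : e * (i%:R - s%:R) - (i%:R - s%:R) = (1 - e) * - (i%:R - s%:R) by ring.
    by rewrite mulr_ge0 ?subr_ge0 // oppr_ge0 ltW.
  have m2 := @p2_min_le (gam + e) (k - (gam + e)) d (s%:R - n%:R).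
  have {}m2 := m2 d1 d2 (ltW d0); rewrite [gam + e + _]addrC subrK in m2.
  set mn := Num.min 1 (p2 (k * _)) in m2 *.
  have mn0 : 0 <= mn by rewrite le_min ler01 ltW // p2_gt0.
  apply: (@le_trans _ _ (p2 (- (gam * s%:R)) * slow lam s * (mn * p2 (e * (i%:R - s%:R))))).
    apply: ler_wpM2l; last exact: ler_wpM2l.
    exact: mulr_ge0 (ltW (p2_gt0 _)) (ltW (slow_gt0 _ _)).
  have -> : p2 (- (gam * s%:R)) * slow lam s * (mn * p2 (e * (i%:R - s%:R))) =
     (p2 (- (gam * s%:R)) * p2 (e * (i%:R - s%:R))) * (slow lam s * mn) by ring.
  rewrite -p2D.
  have -> : - (gam * s%:R) + e * (i%:R - s%:R) =
     (e * i%:R - (gam + e) * n%:R) + - ((gam + e) * (s%:R - n%:R)) by ring.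
  rewrite p2D -!mulrA ler_wpM2l ?(ltW (p2_gt0 _)) // mulrCA ler_wpM2l ?(ltW (slow_gt0 _ _)) //.
rewrite -mulr_sumr mulrC ler_wpM2r ?(ltW (p2_gt0 _)) //.
Qed.

(** At the critical exponent gamma + e = al the kernel no longer decays
    for s < n. Bounding min(1, 2^(al(s-n))) by 2^(al(s-n)) shows decay in |s - i|
    instead: the terms with s close to i carry the rearrangement at 2^-i. *)
Lemma kernel_sum_high_le lam al e : 0 < e -> e < 1 ->
  exists2 C, 0 < C & forall i n N,
  \sum_(0 <= s < N) p2 (- ((al - e) * s%:R)) * slow lam s *
     (Num.min 1 (p2 (al * (s%:R - n%:R))) * Num.min 1 (p2 (i%:R - s%:R)))
  <= C * (slow lam i * p2 (e * i%:R - al * n%:R)).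
Proof.
move=> e0 e1; pose d := Num.min e (1 - e).
have d0 : 0 < d by rewrite lt_min e0 subr_gt0.
have d1 : d <= e by rewrite ge_min lexx.
have d2 : d <= 1 - e by rewrite ge_min lexx orbT.
have [C C0 hC] := slow_sum_le lam d0; exists C => // i n N.
rewrite mulrA; apply: (@le_trans _ _ (\sum_(0 <= s < N)
    p2 (e * i%:R - al * n%:R) * (slow lam s * p2 (- (d * `|s%:R - i%:R|))))).
  apply: ler_sum => s _.
  have m1 : Num.min 1 (p2 (al * (s%:R - n%:R))) <= p2 (al * (s%:R - n%:R)).
    by rewrite ge_min lexx orbT.
  have m2 := @p2_min_le e (1 - e) d (i%:R - s%:R).
  have {}m2 := m2 d1 d2 (ltW d0); rewrite [e + _]addrC subrK mul1r distrC in m2.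
  set mn := Num.min 1 (p2 (i%:R - _)) in m2 *.
  have mn0 : 0 <= mn by rewrite le_min ler01 ltW // p2_gt0.
  apply: (@le_trans _ _ (p2 (- ((al - e) * s%:R)) * slow lam s * (p2 (al * (s%:R - n%:R)) * mn))).
    apply: ler_wpM2l; last exact: ler_wpM2r.
    exact: mulr_ge0 (ltW (p2_gt0 _)) (ltW (slow_gt0 _ _)).
  have -> : p2 (- ((al - e) * s%:R)) * slow lam s * (p2 (al * (s%:R - n%:R)) * mn) =
     (p2 (- ((al - e) * s%:R)) * p2 (al * (s%:R - n%:R))) * (slow lam s * mn) by ring.
  rewrite -p2D.
  have -> : - ((al - e) * s%:R) + al * (s%:R - n%:R) =
     (e * i%:R - al * n%:R) + - (e * (i%:R - s%:R)) by ring.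
  rewrite p2D -!mulrA ler_wpM2l ?(ltW (p2_gt0 _)) // mulrCA ler_wpM2l ?(ltW (slow_gt0 _ _)) //.
rewrite -mulr_sumr mulrC ler_wpM2r ?(ltW (p2_gt0 _)) //.
Qed.

(** The second half of the sum consists of at least N/2 terms of order N^e. *)
Lemma sum_powR_ge e : exists2 c, 0 < c & forall N, (0 < N)%N ->
  c * N%:R `^ (1 + e) <= \sum_(0 <= i < N) i.+1%:R `^ e.
Proof.
exists (2 `^ (- `|e|) / 2); first by rewrite divr_gt0 ?powR_gt0.
move=> N N0; have hN : (N./2 <= N)%N by have := odd_double_half N; lia.
have Np : 0 < N%:R :> R by rewrite ltr0n.
rewrite (big_cat_nat _ hN) //= -[leLHS]add0r lerD ?sumr_ge0 //.
apply: (@le_trans _ _ (\sum_(N./2 <= i < N) 2 `^ (- `|e|) * N%:R `^ e)); last first.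
  apply: ler_sum_nat => i /andP[i1 i2].
  rewrite powRN mulrC ler_pdivrMr ?powR_gt0 // mulrC.
  apply: powR_comparable => //; rewrite ?ler1n // -?natrM ler_nat; last by lia.
  by have := odd_double_half N; lia.
rewrite sumr_const_nat -[leRHS]mulr_natl.
have hh : N%:R / 2 <= (N - N./2)%:R :> R.
  rewrite ler_pdivrMr // -natrM ler_nat; have := odd_double_half N; lia.
apply: (@le_trans _ _ (N%:R / 2 * (2 `^ (- `|e|) * N%:R `^ e))); last first.
  by rewrite ler_wpM2r // mulr_ge0 ?powR_ge0.
rewrite [N%:R `^ (1 + e)]powRD; last by rewrite (gt_eqF Np) implybT.
by rewrite powRr1 ?(ltW Np) // le_eqVlt; apply/orP; left; apply/eqP; ring.
Qed.

Lemma sum_powR_le e : -1 < e -> exists2 C, 0 < C & forall N,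
  \sum_(0 <= i < N) i.+1%:R `^ e <= C * N%:R `^ (1 + e).
Proof.
move=> e1; have [y yE] : exists y, 1 + e = y by exists (1 + e).
have y0 : 0 < y by rewrite -yE; lra.
rewrite yE.
exists ((1 + y) / y); first by rewrite divr_gt0 // addr_gt0.
elim=> [|N IH].
  by rewrite big_geq //; exact: mulr_ge0 (ltW (divr_gt0 (addr_gt0 ltr01 y0) y0)) (powR_ge0 _ _).
rewrite big_nat_recr //= (le_trans (lerD IH (lexx _))) //.
have M0 : 0 < N.+1%:R :> R by rewrite ltr0n.
set M : R := N.+1%:R in M0 *; pose v := M^-1.
have v0 : 0 < v by rewrite invr_gt0.
have v1 : v <= 1 by rewrite invf_le1 // ler1n.
have NE : N%:R = M * (1 - v) :> R.
  by rewrite mulrBr mulr1 divff ?gt_eqF // /M -natr1 addrK.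
have h : (1 - v) `^ y <= 1 - y * v / (1 + y).
  have : (1 - v) `^ y <= (1 + y * v)^-1.
    have [->|v1'] := eqVneq v 1.
      by rewrite subrr powR0 ?gt_eqF // invr_ge0 mulr1 addr_ge0 // ltW.
    have v2 : 0 < 1 - v by rewrite subr_gt0 lt_neqAle v1'.
    rewrite /powR gt_eqF //; apply: (@le_trans _ _ (expR (- (y * v)))).
      rewrite ler_expR -mulrN ler_pM2l //.
      by rewrite (le_ln1Dx (x := - v)) // ltrN2 lt_neqAle v1'.
    by rewrite expRN lef_pV2 ?posrE ?expR_gt0 ?expR_ge1Dx // addr_gt0 ?mulr_gt0.
  move=> /le_trans; apply.
  have yv : 0 < 1 + y * v by rewrite addr_gt0 ?mulr_gt0.
  have -> : (1 + y * v)^-1 = 1 - y * v / (1 + y * v) by field; rewrite gt_eqF.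
  rewrite lerD2l lerN2 ler_pM2l ?mulr_gt0 // lef_pV2 ?posrE ?(addr_gt0 ltr01 y0) //.
  by rewrite lerD2l ler_piMr // ltW.
have v1' : 0 <= 1 - v by rewrite subr_ge0.
have My : 0 < M `^ y by exact: powR_gt0.
have eE : M `^ e = M `^ y * v.
  have -> : e = y - 1 by rewrite -yE; ring.
  by rewrite powRB ?(gt_eqF M0) ?implybT // powRr1 ?(ltW M0).
rewrite NE powRM ?(ltW M0) // eE.
apply: (@le_trans _ _ ((1 + y) / y * (M `^ y * (1 - y * v / (1 + y))) + M `^ y * v)).
  by rewrite lerD2r ler_pM2l ?divr_gt0 ?addr_gt0 // ler_pM2l.
have y1 : 1 + y != 0 by rewrite gt_eqF // addr_gt0.
have y2 : y != 0 by rewrite gt_eqF.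
by rewrite le_eqVlt; apply/orP; left; apply/eqP; field; rewrite y1 y2.
Qed.

Lemma sum_powR_bounded e : e < -1 -> exists2 C, 0 < C & forall N,
  \sum_(0 <= i < N) i.+1%:R `^ e <= C.
Proof.
move=> e1; pose y := - (1 + e); have y0 : 0 < y by rewrite /y; lra.
exists (1 + y^-1); first by rewrite addr_gt0 // invr_gt0.
case=> [|N]; first by rewrite big_geq // addr_ge0 // invr_ge0 ltW.
suff : \sum_(0 <= i < N.+1) i.+1%:R `^ e <= 1 + y^-1 * (1 - N.+1%:R `^ (- y)).
  by move=> /le_trans; apply; rewrite lerD2l ler_piMr ?invr_ge0 ?(ltW y0) // gerBl powR_ge0.
elim: N => [|N IH]; first by rewrite big_nat1 !powR1 subrr mulr0 addr0.
rewrite big_nat_recr //= (le_trans (lerD IH (lexx _))) //.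
suff : N.+2%:R `^ e <= y^-1 * (N.+1%:R `^ (- y) - N.+2%:R `^ (- y)) by lra.
rewrite ler_pdivlMl //.
have M0 : 0 < N.+2%:R :> R by rewrite ltr0n.
set M : R := N.+2%:R in M0 *; pose v := M^-1.
have v0 : 0 < v by rewrite invr_gt0.
have v1 : 0 < 1 - v by rewrite subr_gt0 invf_lt1 // ltr1n.
have NE : N.+1%:R = M * (1 - v) :> R.
  by rewrite mulrBr mulr1 divff ?gt_eqF // /M -[N.+2%:R]natr1 addrK.
have eE : M `^ e = M `^ (- y) * v.
  have -> : e = - y - 1 by rewrite /y; ring.
  by rewrite powRB ?(gt_eqF M0) ?implybT // powRr1 ?(ltW M0).
have My : 0 < M `^ (- y) by exact: powR_gt0.
rewrite NE powRM ?(ltW M0) ?(ltW v1) // eE -{3}[M `^ (- y)]mulr1 -mulrBr mulrCA.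
rewrite ler_pM2l // lerBrDl /powR gt_eqF //.
have hl : ln (1 - v) <= - v by rewrite (le_ln1Dx (x := - v)) // ltrN2 -subr_gt0.
rewrite (le_trans (expR_ge1Dx _)) // ler_expR.
have := ler_wpM2l (ltW y0) hl; lra.
Qed.

End dyadic_sums.

(** * Dyadic decomposition of integrals and of Lorentz norms *)

Section dyadic_integrals.
Context {R : realType}.
Local Notation mu := (@lebesgue_measure R).
Implicit Types (u x e p tau : R) (i n N : nat) (b B : nat -> R).

Definition dyadic i : set R := `[2 ^- i.+1, 2 ^- i[%classic.

Lemma dyadic_exists u : 0 < u < 1 -> exists i, dyadic i u.
Proof.
move=> /andP[u0 u1].
have ex : exists n, 2 ^- n <= u.
  have [N hN] := exists_nat_ge u^-1; exists N.
  rewrite -[leRHS]invrK lef_pV2 ?posrE ?invr_gt0 ?exprn_gt0 // (le_trans hN) //.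
  by rewrite -natrX ler_nat ltnW // ltn_expl.
have := ex_minnP ex; case=> -[|n] hn hmin.
  by move: hn; rewrite expr0 invr1 leNgt u1.
exists n; rewrite /dyadic /= in_itv /= hn /= ltNge; apply/negP => /hmin.
by rewrite ltnn.
Qed.

Lemma dyadic_gt0 i u : dyadic i u -> 0 < u.
Proof.
by rewrite /dyadic /= in_itv /= => /andP[h _]; rewrite (lt_le_trans _ h) // invr_gt0 exprn_gt0.
Qed.

Lemma dyadic_sub i : dyadic i `<=` `]0, 1[%classic.
Proof.
move=> u du; rewrite /= in_itv /= (dyadic_gt0 du) /=.
move: du; rewrite /dyadic /= in_itv /= => /andP[_ h]; rewrite (lt_le_trans h) //.
by rewrite invf_le1 ?exprn_gt0 // exprn_ege1 // ler1n.
Qed.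

Lemma dyadic_unique i n u : dyadic i u -> dyadic n u -> i = n.
Proof.
have aux (j l : nat) : (j < l)%N -> dyadic j u -> dyadic l u -> False.
  rewrite /dyadic /= !in_itv /= => jl /andP[h1 _] /andP[_ h2].
  move: (le_lt_trans h1 h2); rewrite ltf_pV2 ?posrE ?exprn_gt0 // ltNge.
  by rewrite ler_weXn2l // ler1n.
by move=> hi hn; have [ij|ij|//] := ltngtP i n; [case: (aux _ _ ij hi hn)|case: (aux _ _ ij hn hi)].
Qed.

Lemma dyadic_comparable i u : dyadic i u -> u <= 2 * p2 (- i%:R) /\ p2 (- i%:R) <= 2 * u.
Proof.
move=> du; have u0 := dyadic_gt0 du; move: du; rewrite /dyadic /= in_itv /= => /andP[h1 h2].
rewrite p2N p2_nat; split.
  by rewrite (le_trans (ltW h2)) // ler_peMl ?invr_ge0 ?exprn_ge0 // ler1n.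
have -> : 2 ^- i = 2 * 2 ^- i.+1 :> R by rewrite exprS; field; rewrite expf_neq0 // pnatr_eq0.
by rewrite ler_pM2l.
Qed.

Lemma powR_dyadic e i u : dyadic i u ->
  u `^ e <= 2 `^ `|e| * p2 (- (e * i%:R)) /\ p2 (- (e * i%:R)) <= 2 `^ `|e| * u `^ e.
Proof.
move=> du; have [h1 h2] := dyadic_comparable du; have u0 := dyadic_gt0 du.
have -> : p2 (- (e * i%:R)) = (p2 (- i%:R)) `^ e by rewrite p2_powR mulNr mulrC.
by split; apply: powR_comparable; rewrite ?ler1n ?p2_gt0.
Qed.

Lemma log_dyadic e i u : dyadic i u ->
  (1 - ln u) `^ e <= 2 `^ `|e| * i.+1%:R `^ e /\ i.+1%:R `^ e <= 2 `^ `|e| * (1 - ln u) `^ e.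
Proof.
move=> du; have u0 := dyadic_gt0 du; move: du; rewrite /dyadic /= in_itv /= => /andP[h1 h2].
have p0 n : (0 : R) < 2 ^+ n by rewrite exprn_gt0.
have l1 : i%:R * ln 2 <= - ln u.
  rewrite lerNr mulr_natl -lnXn // -lnV ?posrE ?p0 //.
  by rewrite ler_ln ?posrE ?invr_gt0 ?p0 // ltW.
have l2 : - ln u <= i.+1%:R * ln 2.
  rewrite lerNl mulr_natl -lnXn // -lnV ?posrE ?p0 //.
  by rewrite ler_ln ?posrE ?invr_gt0 ?p0.
have ln21 : ln 2 <= 1 :> R.
  by have := @le_ln1Dx R 1; apply; rewrite (lt_trans _ ltr01) // ltrN10.
have ln22 : 2^-1 <= ln 2 :> R.
  have := @le_ln1Dx R (- 2^-1); rewrite ltrN2 invf_lt1 // ltr1n => /(_ isT).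
  have -> : 1 - 2^-1 = 2^-1 :> R by field.
  by rewrite lnV ?posrE // lerN2.
have i0 : 0 <= i%:R :> R by [].
have a1 := ler_wpM2l i0 ln22.
have a2 := ler_wpM2l (ler0n R i.+1) ln21.
have iE : i.+1%:R = i%:R + 1 :> R by rewrite natr1.
rewrite iE in a2 l2 *.
by split; apply: powR_comparable; rewrite ?ler1n //; lra.
Qed.

Lemma measurable_dyadic i : measurable (dyadic i).
Proof. exact: measurable_itv. Qed.

Definition dstep b u : \bar R := \sum_(i <oo) (b i * \1_(dyadic i) u)%:E.

Lemma dstepE b i u : dyadic i u -> dstep b u = (b i)%:E.
Proof.
move=> du; apply: cvg_lim => //; apply: cvg_near_cst; near=> n.
have sn : (i < n)%N by near: n; exists i.+1.
rewrite sumEFin; congr (_%:E).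
rewrite (bigD1_seq i) ?mem_index_iota ?iota_uniq //= big1 ?addr0.
  by rewrite indicE mem_set // mulr1.
move=> s si; rewrite indicE memNset ?mulr0 // => ds.
by move: si; rewrite (dyadic_unique ds du) eqxx.
Unshelve. all: by end_near.
Qed.

Lemma integral_dstep b : (forall i, 0 <= b i) ->
  (\int[mu]_(u in `]0%R, 1%R[) dstep b u = \sum_(i <oo) (b i * 2 ^- i.+1)%:E)%E.
Proof.
move=> b0; rewrite integral_nneseries //; last 2 first.
- move=> i; apply: measurable_funTS; apply/measurable_EFinP.
  exact: (measurable_funM (measurable_cst _) (measurable_indic (measurable_dyadic i))).
- by move=> i u _; rewrite lee_fin mulr_ge0.
apply: eq_eseriesr => i _.
transitivity ((b i)%:E * \int[mu]_(u in `]0%R, 1%R[) (\1_(dyadic i) u)%:E)%E.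
  rewrite -ge0_integralZl_EFin //.
  apply: measurable_funTS; apply/measurable_EFinP.
  exact: measurable_indic (measurable_dyadic i).
rewrite integral_indic //; last exact: measurable_dyadic.
rewrite setIidl; last exact: dyadic_sub.
rewrite -[X in (_ * X)%E]/(mu (dyadic i)) /dyadic lebesgue_measure_itv /= lte_fin.
rewrite ltf_pV2 ?posrE ?exprn_gt0 // ltr_eXn2l ?ltr1n // ltnSn -EFinB -EFinM.
congr ((_ * _)%:E); rewrite exprS; field; by rewrite expf_neq0 // pnatr_eq0.
Qed.

Lemma integral_dyadic_le b (phi : R -> \bar R) : (forall i, 0 <= b i) ->
  (forall u, 0 < u < 1 -> (0 <= phi u)%E) ->
  (forall i u, dyadic i u -> (phi u <= (b i)%:E)%E) ->
  (\int[mu]_(u in `]0%R, 1%R[) phi u <= \sum_(i <oo) (b i * 2 ^- i.+1)%:E)%E.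
Proof.
move=> b0 phi0 h; rewrite -integral_dstep //; apply: le_integral_ge0.
  by move=> u /=; rewrite in_itv /=; exact: phi0.
move=> u /=; rewrite in_itv /= => /dyadic_exists [i du]; rewrite (dstepE _ du); exact: h.
Qed.

Lemma integral_dyadic_ge b (phi : R -> \bar R) : (forall i, 0 <= b i) ->
  (forall i u, dyadic i u -> ((b i)%:E <= phi u)%E) ->
  (\sum_(i <oo) (b i * 2 ^- i.+1)%:E <= \int[mu]_(u in `]0%R, 1%R[) phi u)%E.
Proof.
move=> b0 h; rewrite -integral_dstep //; apply: le_integral_ge0.
  by move=> u _; apply: nneseries_ge0 => i _ _; rewrite lee_fin mulr_ge0.
by move=> u /=; rewrite in_itv /= => /dyadic_exists [i du]; rewrite (dstepE _ du); exact: h.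
Qed.

Section lorentz.
Context {m : nat}.
Implicit Types f : m.-tuple R -> R.

Lemma rearrangement_ge0 f u : (0 <= rearrangement f u)%E.
Proof. by apply: le_ereal_inf_tmp => _ [s [s0 _] <-]; rewrite lee_fin. Qed.

Lemma poweR_le e (x y : \bar R) : 0 <= e -> (0 <= x)%E -> (x <= y)%E ->
  (poweR x e <= poweR y e)%E.
Proof.
move=> e0 x0 xy; apply: gt0_ler_poweR => //; rewrite in_itv /= ?x0 ?leey //.
by rewrite (le_trans x0) //= leey.
Qed.

(** On the i-th dyadic interval the weight t^(tau/p-1) dt integrates to
    about 2^(-i tau/p), so the Lorentz norm is the l_tau norm of 2^(-i/p) times the
    size of the rearrangement there. *)
Lemma lorentz_norm_le p tau : 0 < p -> 0 < tau -> exists2 C, 0 < C &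
  forall f B S, (forall i, 0 <= B i) ->
  (forall i u, dyadic i u -> (rearrangement f u <= (B i * p2 (i%:R / p))%:E)%E) ->
  (forall N, \sum_(0 <= i < N) B i `^ tau <= S) ->
  (lorentz_norm p tau f <= (C * S `^ tau^-1)%:E)%E.
Proof.
move=> p0 tau0; pose c : R := 2 `^ `|tau / p - 1|.
have c0 : 0 < c by rewrite powR_gt0.
exists (c `^ tau^-1); first by rewrite powR_gt0.
move=> f B S B0 hB hS.
have S0 : 0 <= S by have := hS 0%N; rewrite big_geq.
rewrite /lorentz_norm -powRM ?(ltW c0) // -poweR_EFin.
apply: poweR_le; first by rewrite invr_ge0 ltW.
  by apply: integral_ge0 => u _; rewrite mule_ge0 ?poweR_ge0 // lee_fin powR_ge0.
pose b i := c * (B i `^ tau) * p2 i%:R.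
have b0 i : 0 <= b i by rewrite /b !mulr_ge0 ?powR_ge0 ?(ltW c0) ?(ltW (p2_gt0 _)).
apply: (@le_trans _ _ (\sum_(i <oo) (b i * 2 ^- i.+1)%:E)%E).
  apply: integral_dyadic_le => //.
    by move=> u _; rewrite mule_ge0 ?poweR_ge0 // lee_fin powR_ge0.
  move=> i u du; have u0 := dyadic_gt0 du.
  apply: (@le_trans _ _ (poweR (B i * p2 (i%:R / p))%:E tau * (u `^ (tau / p - 1))%:E)%E).
    rewrite lee_wpmul2r ?lee_fin ?powR_ge0 //.
    by apply: poweR_le; rewrite ?rearrangement_ge0 ?(ltW tau0) ?hB.
  rewrite poweR_EFin -EFinM lee_fin powRM ?(ltW (p2_gt0 _)) // p2_powR.
  have [h _] := powR_dyadic (tau / p - 1) du.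
  have e0 : 0 <= B i `^ tau * p2 (i%:R / p * tau).
    by rewrite mulr_ge0 ?powR_ge0 // ltW // p2_gt0.
  apply: (le_trans (ler_wpM2l e0 h)); rewrite -/c /b.
  have -> : p2 i%:R = p2 (i%:R / p * tau) * p2 (- ((tau / p - 1) * i%:R)).
    by rewrite -p2D; congr p2; ring.
  by rewrite le_eqVlt; apply/orP; left; apply/eqP; ring.
apply: le_nneseries_bound => [i|N]; first by rewrite mulr_ge0 // invr_ge0 exprn_ge0.
apply: (@le_trans _ _ (c * \sum_(0 <= i < N) B i `^ tau)); last by rewrite ler_pM2l.
rewrite mulr_sumr; apply: ler_sum => i _; rewrite /b -mulrA ler_piMr //.
  by rewrite mulr_ge0 ?powR_ge0 // ltW.
by rewrite p2_nat ler_pdivrMr ?exprn_gt0 // mul1r ler_weXn2l // ler1n.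
Qed.

Lemma lorentz_norm_ge p tau : 0 < p -> 0 < tau -> exists2 c, 0 < c &
  forall f B N, (forall i, 0 <= B i) ->
  (forall i u, (i < N)%N -> dyadic i u -> ((B i * p2 (i%:R / p))%:E <= rearrangement f u)%E) ->
  ((c * (\sum_(0 <= i < N) B i `^ tau) `^ tau^-1)%:E <= lorentz_norm p tau f)%E.
Proof.
move=> p0 tau0; pose c : R := (2 `^ `|tau / p - 1|)^-1 / 2.
have c0 : 0 < c by rewrite divr_gt0 // invr_gt0 powR_gt0.
exists (c `^ tau^-1); first by rewrite powR_gt0.
move=> f B N B0 hB.
rewrite /lorentz_norm -powRM ?(ltW c0) ?sumr_ge0 // => [|i _]; last exact: powR_ge0.
rewrite -poweR_EFin; apply: poweR_le; first by rewrite invr_ge0 ltW.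
  by rewrite lee_fin mulr_ge0 ?(ltW c0) // sumr_ge0 // => i _; exact: powR_ge0.
pose b i := if (i < N)%N then 2 * c * (B i `^ tau) * p2 i%:R else 0.
have b0 i : 0 <= b i.
  by rewrite /b; case: ifP => _ //; rewrite !mulr_ge0 ?powR_ge0 ?(ltW c0) ?(ltW (p2_gt0 _)).
apply: (@le_trans _ _ (\sum_(i <oo) (b i * 2 ^- i.+1)%:E)%E).
  apply: (@le_trans _ _ (\sum_(0 <= i < N) (b i * 2 ^- i.+1)%:E)%E); last first.
    by apply: nneseries_lim_ge => i _ _; rewrite lee_fin mulr_ge0 // invr_ge0 exprn_ge0.
  rewrite sumEFin lee_fin mulr_sumr; apply: ler_sum_nat => i /andP[_ iN].
  rewrite /b iN p2_nat exprS le_eqVlt; apply/orP; left; apply/eqP; field.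
  by rewrite expf_neq0 // pnatr_eq0.
apply: integral_dyadic_ge => // i u du; rewrite /b; case: ifPn => iN; last first.
  by rewrite mule_ge0 ?poweR_ge0 // lee_fin powR_ge0.
apply: (@le_trans _ _ (poweR (B i * p2 (i%:R / p))%:E tau * (u `^ (tau / p - 1))%:E)%E); last first.
  rewrite lee_wpmul2r ?lee_fin ?powR_ge0 //.
  by apply: poweR_le; rewrite ?(ltW tau0) ?hB // lee_fin mulr_ge0 // ltW // p2_gt0.
rewrite poweR_EFin -EFinM lee_fin powRM ?(ltW (p2_gt0 _)) // p2_powR.
have [_ h] := powR_dyadic (tau / p - 1) du.
have e0 : 0 <= B i `^ tau * p2 (i%:R / p * tau).
  by rewrite mulr_ge0 ?powR_ge0 // ltW // p2_gt0.
rewrite -ler_pdivrMl ?powR_gt0 // in h.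
apply: (le_trans _ (ler_wpM2l e0 h)).
have -> : p2 i%:R = p2 (i%:R / p * tau) * p2 (- ((tau / p - 1) * i%:R)).
  by rewrite -p2D; congr p2; ring.
rewrite /c; set q := 2 `^ _; rewrite le_eqVlt; apply/orP; left; apply/eqP; field.
by rewrite gt_eqF // powR_gt0.
Qed.

End lorentz.
End dyadic_integrals.

(** * Tensor products and their rearrangements *)

Section tensor_products.
Context {R : realType} {m : nat}.
Implicit Types (x h t : m.-tuple R) (F phi : 'I_m -> R -> R).
Local Notation mu := (@lebesgue_measure R).

Definition tensor F x : R := \prod_(j < m) F j (tnth x j).

(** Also true for divergent series, whose limit is 0 by convention; for K = 0
    this uses that the product series converges. *)
Lemma lim_series_mulr (v : nat -> R) (K : R) :
  limn (series (fun n => v n * K)) = limn (series v) * K.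
Proof.
have E : series (fun n => v n * K) = (fun n => series v n * K).
  by apply/funext => n; rewrite /series /= mulr_suml.
have [K0|K0] := eqVneq K 0.
  rewrite E K0 mulr0; apply: cvg_lim => //; apply: cvg_near_cst.
  by near=> n; rewrite mulr0.
have [cv|ncv] := pselect (cvgn (series v)).
  rewrite E; apply: cvg_lim => //.
  by apply: cvgM; [exact: cv|exact: cvg_cst].
rewrite (lim_divergent ncv) mul0r; apply: lim_divergent => cv; apply: ncv.
have -> : series v = (fun n => series (fun n => v n * K) n * K^-1).
  by apply/funext => n; rewrite E mulfK.
by apply/cvg_ex; exists (limn (series (fun n => v n * K)) * K^-1);
  apply: cvgM; [exact: cv|exact: cvg_cst].
Unshelve. all: by end_near.
Qed.

(** Also true when the series of v diverges: both sides are then 0. *)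
Lemma lim_series_subr (v w : nat -> R) : series w @ \oo --> (0 : R) ->
  limn (series (fun n => v n - w n)) = limn (series v).
Proof.
move=> w0.
have E : series (fun n => v n - w n) = (fun n => series v n - series w n).
  by apply/funext => n; rewrite /series /= sumrB.
have [cv|ncv] := pselect (cvgn (series v)).
  rewrite E; apply: cvg_lim => //; rewrite -[X in _ --> X]subr0.
  by apply: cvgB; [exact: cv|exact: w0].
rewrite (lim_divergent ncv); apply: lim_divergent => cv; apply: ncv.
have -> : series v = (fun n => series (fun n => v n - w n) n + series w n).
  by apply/funext => n; rewrite E subrK.
apply/cvg_ex; exists (limn (series (fun n => v n - w n)) + 0).
by apply: cvgD; [exact: cv|exact: w0].
Qed.

Lemma difference_tensor (a s : R) (j : 'I_m) F :
  difference a s j (tensor F) = tensor (fun i => if i == j then fdiff a s (F j) else F i).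
Proof.
apply/funext => x; rewrite /difference /tensor (bigD1 j) //= eqxx.
rewrite -[LHS]/(limn (series _)) /fdiff -lim_series_mulr; congr (limn (series _)).
apply/funext => nu; rewrite (bigD1 j) //= tnth_mktuple eqxx mul1r /dcoef -!mulrA.
congr (_ * (_ * (_ * (_ * _)))); apply: eq_bigr => i ij.
by rewrite tnth_mktuple (negbTE ij) mul0r addr0.
Qed.

Lemma mixed_difference_tensor (a : 'rV[R]_m) h F :
  mixed_difference a h (tensor F) = tensor (fun j => fdiff (a 0 j) (tnth h j) (F j)).
Proof.
rewrite /mixed_difference.
have gen (s : seq 'I_m) F' : uniq s ->
    foldl (fun g j => difference (a 0 j) (tnth h j) j g) (tensor F') s =
    tensor (fun j => if j \in s then fdiff (a 0 j) (tnth h j) (F' j) else F' j).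
  elim: s F' => [|j s IH] F' //= /andP[js us].
  rewrite difference_tensor IH //; congr tensor; apply/funext => i.
  rewrite inE; case: (eqVneq i j) => [->|ij] /=; first by rewrite (negbTE js).
  by [].
rewrite gen ?enum_uniq //; congr tensor; apply/funext => j.
by rewrite mem_enum.
Qed.

(** If a product of m factors exceeds the product of the sg j, some
    factor exceeds its own bound; each of these m events has measure at
    most u/m. *)
Lemma distribution_prod_le f phi (sg : 'I_m -> R) (E : 'I_m -> set R) (u : R) :
  (0 < m)%N ->
  (forall x, unit_cube x -> f [tuple 2 * pi * tnth x i | i < m] = tensor phi x) ->
  (forall j, 0 <= sg j) -> (forall j, measurable (E j)) ->
  (forall j, (mu (E j) <= (u / m%:R)%:E)%E) ->
  (forall j z, 0 <= z < 1 -> sg j < `|phi j z| -> E j z) ->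
  (distribution_fun f (\prod_j sg j) <= u%:E)%E.
Proof.
move=> m0 hf sg0 mE Eu hE.
pose A (j : 'I_m) : 'I_m -> set R := fun i => if i == j then E j `&` `[0%R, 1%R[ else `[0%R, 1%R[%classic.
have mA j i : measurable (A j i).
  by rewrite /A; case: ifP => _ //; exact: measurableI.
have muI : mu `[0%R, 1%R[%classic = 1%:E.
  by rewrite lebesgue_measure_itv /= lte01 -EFinB subr0.
have muA j : (lebesgue_tuple m (box (A j)) <= (u / m%:R)%:E)%E.
  rewrite lebesgue_tuple_box // (bigD1 j) //= big1 => [|i ij]; last first.
    by rewrite /A (negbTE ij).
  rewrite mule1 /A eqxx (le_trans _ (Eu j)) //.
  apply: le_measure; [|by rewrite inE; exact: mE|exact: subIsetl].
  by rewrite inE; apply: measurableI; [exact: mE|exact: measurable_itv].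
rewrite /distribution_fun.
apply: (@le_trans _ _ (lebesgue_tuple m (\big[setU/set0]_(j < m) box (A j)))).
  apply: lebesgue_tuple_le => x [cx /= hx].
  apply: contrapT => nx; move: hx; rewrite hf // /tensor normr_prod ltNge => /negP; apply.
  apply: ler_prod => j _; rewrite normr_ge0 /= leNgt; apply/negP => sj.
  apply: nx; rewrite (bigD1 j) //=; left => i; rewrite /A; case: eqVneq => [->|_].
    by split; [apply: hE; [exact: cx|exact: sj]|rewrite /= in_itv /=; exact: cx].
  by rewrite /= in_itv /=; exact: cx.
apply: (@le_trans _ _ (\sum_(j < m) lebesgue_tuple m (box (A j)))%E).
  suff [] : measurable (\big[setU/set0]_(j < m) box (A j)) /\
      (lebesgue_tuple m (\big[setU/set0]_(j < m) box (A j)) <=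
       \sum_(j < m) lebesgue_tuple m (box (A j)))%E by [].
  elim/big_rec2: _ => [|j y B _ [mB hB]]; first by rewrite measure0.
  have mb : measurable (box (A j)) by exact: measurable_box.
  split; first exact: measurableU.
  exact: (le_trans (measureU2 _ mb mB) (leeD2l _ hB)).
apply: (@le_trans _ _ (\sum_(j < m) (u / m%:R)%:E)%E); first exact: lee_sum.
rewrite sumEFin lee_fin sumr_const card_ord -[leLHS]mulr_natr divfK //.
by rewrite pnatr_eq0 -lt0n.
Qed.

Lemma rearrangement_prod_le f phi (sg : 'I_m -> R) (E : 'I_m -> set R) (u : R) :
  (0 < m)%N ->
  (forall x, unit_cube x -> f [tuple 2 * pi * tnth x i | i < m] = tensor phi x) ->
  (forall j, 0 <= sg j) -> (forall j, measurable (E j)) ->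
  (forall j, (mu (E j) <= (u / m%:R)%:E)%E) ->
  (forall j z, 0 <= z < 1 -> sg j < `|phi j z| -> E j z) ->
  (rearrangement f u <= (\prod_j sg j)%:E)%E.
Proof.
move=> m0 hf sg0 mE Eu hE; apply: ereal_inf_lbound.
exists (\prod_j sg j) => //; split; first exact: prodr_ge0.
exact: distribution_prod_le hE.
Qed.

(** On the box of the intervals the product is at least the product
    of the c j, and the box has measure greater than u. *)
Lemma rearrangement_prod_ge f phi (c l x0 : 'I_m -> R) (u : R) :
  (forall x, unit_cube x -> f [tuple 2 * pi * tnth x i | i < m] = tensor phi x) ->
  (forall j, 0 <= c j) -> (forall j, 0 < l j) ->
  (forall j, 0 <= x0 j) -> (forall j, x0 j + l j <= 1) ->
  (forall j z, x0 j <= z < x0 j + l j -> c j <= `|phi j z|) ->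
  u < \prod_j l j ->
  ((\prod_j c j)%:E <= rearrangement f u)%E.
Proof.
move=> hf c0 l0 x00 x01 hc ul; apply: le_ereal_inf_tmp => _ [s [s0 ds] <-].
rewrite lee_fin leNgt; apply/negP => sc.
pose A (j : 'I_m) : set R := `[x0 j, x0 j + l j[%classic.
have mA j : measurable (A j) by exact: measurable_itv.
move: ds; rewrite leNgt => /negP; apply.
apply: (@lt_le_trans _ _ (\prod_j l j)%:E); first by rewrite lte_fin.
apply: (@le_trans _ _ (lebesgue_tuple m (box A))).
  rewrite lebesgue_tuple_box // (eq_bigr (fun j => (l j)%:E)); last first.
    by move=> j _; rewrite /A lebesgue_measure_itv /= lte_fin ltrDl l0 -EFinD addrAC subrr add0r.
  by rewrite prodEFin.
apply: lebesgue_tuple_le => x bx.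
have cx : unit_cube x.
  move=> j; have := bx j; rewrite /A /= in_itv /= => /andP[h1 h2].
  by rewrite (le_trans (x00 j)) //= (lt_le_trans h2).
split=> //=; rewrite hf // /tensor normr_prod (lt_le_trans sc) //.
by apply: ler_prod => j _; rewrite c0 /= hc //; have := bx j; rewrite /A /= in_itv.
Qed.

End tensor_products.

Section test_function.
Context {R : realType} {m : nat}.
Implicit Types (h t : m.-tuple R).

Definition testfun r (a : 'I_m -> nat -> R) (c : 'I_m -> R) : m.-tuple R -> R :=
  tensor (fun j y => super r (a j) (y / (2 * pi)) - c j).

Lemma twopi_gt0 : 0 < 2 * pi :> R.
Proof. by rewrite mulr_gt0 // pi_gt0. Qed.

(** The rescaling to period 1, together with the fact that differences
    annihilate constants. *)
Lemma fdiff_super_scaled r (a : nat -> R) (c k h z : R) : 0 < k ->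
  fdiff k h (fun y => super r a (y / (2 * pi)) - c) (2 * pi * z) =
  fdiff k (h / (2 * pi)) (super r a) z.
Proof.
move=> k0; have p0 : 2 * pi != 0 :> R by rewrite gt_eqF // twopi_gt0.
have c1 : series (dcoef k) @ \oo --> (0 : R).
  rewrite -(cvg_shiftS _); have := dcoef_cvg0 k0; apply: cvg_trans.
  by apply: near_eq_cvg; near=> n; rewrite /series /= sum_dcoef.
rewrite /fdiff.
rewrite -[RHS](@lim_series_subr R _ (fun nu => dcoef k nu * c)); last first.
  have -> : series (fun nu => dcoef k nu * c) = (fun n => series (dcoef k) n * c).
    by apply/funext => n; rewrite /series /= mulr_suml.
  by rewrite -(mul0r c); apply: cvgM; [exact: c1|exact: cvg_cst].
congr (limn (series _)); apply/funext => nu; rewrite mulrBr; congr (_ * super _ _ _ - _).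
have := p0; set q := 2 * pi => q0; by field.
Unshelve. all: by end_near.
Qed.

Lemma mixed_difference_testfun r a c (k : 'rV[R]_m) h x : (forall j, 0 < k 0 j) ->
  mixed_difference k h (testfun r a c) [tuple 2 * pi * tnth x i | i < m] =
  tensor (fun j => fdiff (k 0 j) (tnth h j / (2 * pi)) (super r (a j))) x.
Proof.
move=> k0; rewrite /testfun mixed_difference_tensor /tensor; apply: eq_bigr => j _.
by rewrite tnth_mktuple fdiff_super_scaled.
Qed.

(** The constant 2 in the levels makes strict the inequality
    required by [fdiff_super_superset]; the step may be divided by 2 pi because
    the bound increases with it. *)
Lemma rearrangement_mixed_difference_le r (k : 'rV[R]_m) : (0 < m)%N ->
  (forall j, 0 < k 0 j) -> (forall j, k 0 j + 3 <= r%:R) ->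
  exists2 C : R, 0 < C & forall (a : 'I_m -> nat -> R) (c : 'I_m -> R) t h (u : R) (Th : 'I_m -> R),
  (forall j s, 0 <= a j s) -> (forall j, `|tnth h j| <= tnth t j) -> 0 < u ->
  (forall j, 0 < Th j) ->
  (forall j N, \sum_(0 <= s < N) a j s *
     (Num.min 1 ((2 ^+ s * tnth t j) `^ k 0 j) * Num.min 1 (2 ^- s / u)) <= Th j) ->
  (rearrangement (mixed_difference k h (testfun r a c)) u <= (C * \prod_j Th j)%:E)%E.
Proof.
move=> m0 k0 kr.
have /choice [C hC] : forall j, exists C : R, 0 < C /\ forall (a : nat -> R) (h u sg : R), (forall s, 0 <= a s) -> 0 < u -> 0 <= sg ->
  (\sum_(s <oo) (a s * (C * (Num.min 1 ((2 ^+ s * `|h|) `^ k 0 j) * Num.min u (2 ^- s))))%:E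
    < (sg * u)%:E)%E ->
  exists E : set R, [/\ measurable E, (lebesgue_measure E <= u%:E)%E &
    forall z, 0 <= z < 1 -> sg < `|fdiff (k 0 j) h (super r a) z| -> E z].
  by move=> j; have [C C0 hC] := fdiff_super_superset (k0 j) (kr j); exists C.
have mR : 0 < m%:R :> R by rewrite ltr0n.
exists (\prod_j (2 * C j * m%:R)).
  by apply: prodr_gt0 => j _; rewrite !mulr_gt0 ?(hC j).1.
move=> a c t h u Th a0 ht u0 Th0 hTh.
have u'0 : 0 < u / m%:R by rewrite divr_gt0.
have um1 : m%:R != 0 :> R by rewrite gt_eqF.
have un0 : u != 0 by rewrite gt_eqF.
have /choice [E hE] : forall j, exists E : set R, [/\ measurable E, (lebesgue_measure E <= (u / m%:R)%:E)%E &
    forall z, 0 <= z < 1 -> 2 * C j * m%:R * Th j <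
      `|fdiff (k 0 j) (tnth h j / (2 * pi)) (super r (a j)) z| -> E z].
  move=> j; have [C0 h1] := hC j; apply: h1 => //.
    by rewrite !mulr_ge0 ?(ltW C0) ?(ltW (Th0 j)).
  apply: (@le_lt_trans _ _ (C j * Th j * u)%:E); last first.
    rewrite lte_fin; have -> : 2 * C j * m%:R * Th j * (u / m%:R) = 2 * (C j * Th j * u) by field.
    by rewrite ltr_pMl ?ltr1n // !mulr_gt0 // ltr1n.
  apply: le_nneseries_bound => [s|N].
    by rewrite !mulr_ge0 ?(ltW C0) // le_min ?ler01 ?powR_ge0 ?(ltW u'0) ?invr_ge0 ?exprn_ge0.
  apply: (@le_trans _ _ (C j * u * \sum_(0 <= s < N) a j s *
     (Num.min 1 ((2 ^+ s * tnth t j) `^ k 0 j) * Num.min 1 (2 ^- s / u)))); last first.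
    by rewrite -mulrA [u * _]mulrC mulrA ler_wpM2r ?(ltW u0) // ler_wpM2l ?(ltW C0).
  rewrite mulr_sumr; apply: ler_sum => s _.
  have t0 : 0 <= tnth t j by rewrite (le_trans _ (ht j)).
  have p1 : 2 ^+ s * `|tnth h j / (2 * pi)| <= 2 ^+ s * tnth t j.
    rewrite ler_wpM2l ?exprn_ge0 // (le_trans _ (ht j)) // normrM ler_piMr //.
    rewrite normfV gtr0_norm ?twopi_gt0 // invf_le1 ?twopi_gt0 //.
    by have := @pi_ge2 R; lra.
  have m1 : Num.min 1 ((2 ^+ s * `|tnth h j / (2 * pi)|) `^ k 0 j) <=
      Num.min 1 ((2 ^+ s * tnth t j) `^ k 0 j).
    rewrite le_min !ge_min lexx /=; apply/orP; right.
    by rewrite ge0_ler_powR ?nnegrE ?mulr_ge0 ?exprn_ge0 // ltW.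
  have m2 : Num.min (u / m%:R) (2 ^- s) <= u * Num.min 1 (2 ^- s / u).
    have -> : u * Num.min 1 (2 ^- s / u) = Num.min u (2 ^- s).
      by rewrite minr_pMr ?(ltW u0) // mulr1 mulrCA divff ?mulr1.
    rewrite le_min !ge_min lexx orbT andbT ler_pdivrMr // ler_peMr ?(ltW u0) ?orTb //.
    by rewrite ler1n.
  set M1 := Num.min 1 _ in m1 *; set M2 := Num.min (u / _) _ in m2 *.
  have M10 : 0 <= M1 by rewrite le_min ler01 powR_ge0.
  have M20 : 0 <= M2 by rewrite le_min (ltW u'0) invr_ge0 exprn_ge0.
  have e1 : M1 * M2 <= Num.min 1 ((2 ^+ s * tnth t j) `^ k 0 j) * (u * Num.min 1 (2 ^- s / u)).
    exact: ler_pM.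
  have e2 : 0 <= a j s * C j by rewrite mulr_ge0 // ltW.
  have := ler_wpM2l e2 e1.
  set Q1 := Num.min 1 _; set Q2 := Num.min 1 _.
  have -> : a j s * C j * (M1 * M2) = a j s * (C j * (M1 * M2)) by ring.
  have -> // : a j s * C j * (Q1 * (u * Q2)) = C j * u * (a j s * (Q1 * Q2)) by ring.
rewrite -big_split /=.
apply: (@rearrangement_prod_le R m _ (fun j => fdiff (k 0 j) (tnth h j / (2 * pi)) (super r (a j)))
   (fun j => 2 * C j * m%:R * Th j) E) => //.
- by move=> x _; exact: mixed_difference_testfun.
- by move=> j; rewrite !mulr_ge0 ?(ltW (Th0 j)) // ltW // (hC j).1.
- by move=> j; have [] := hE j.
- by move=> j; have [] := hE j.
- by move=> j; have [] := hE j.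
Qed.

Lemma rearrangement_mixed_difference_ge r (k : 'rV[R]_m) :
  (forall j, 0 < k 0 j) -> (forall j, k 0 j + 3 <= r%:R) ->
  exists (cc l : R) (n0 : nat), [/\ 0 < cc, 0 < l &
    forall (a : 'I_m -> nat -> R) (c : 'I_m -> R) (s n : 'I_m -> nat) (u : R),
  (forall j s, 0 <= a j s) -> (forall j, (s j + n0 <= n j)%N) ->
  u < l * \prod_j 2 ^- s j ->
  ((cc * \prod_j ((2 ^+ s j / 2 ^+ n j) `^ k 0 j * a j (s j)))%:E <=
    rearrangement (mixed_difference k [tuple (- (2 * pi * 2 ^- n j))%R | j < m] (testfun r a c)) u)%E].
Proof.
move=> k0 kr.
have /choice [C hC] : forall j, exists p : R * R * nat, [/\ 0 < p.1.1, 0 < p.1.2 &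
  forall (a : nat -> R) (s n : nat), (forall s, 0 <= a s) -> (s + p.2 <= n)%N ->
  exists x : R, [/\ 0 <= x, x + p.1.2 * 2 ^- s <= 1 & forall z, x <= z < x + p.1.2 * 2 ^- s ->
    p.1.1 * (2 ^+ s / 2 ^+ n) `^ k 0 j * a s <= `|fdiff (k 0 j) (- 2 ^- n) (super r a) z|]].
  by move=> j; have [c [l [n0 [? ? ?]]]] := fdiff_super_lower (k0 j) (kr j); exists (c, l, n0).
exists (\prod_j (C j).1.1), (\prod_j (C j).1.2), (\max_j (C j).2)%N; split.
- by apply: prodr_gt0 => j _; have [] := hC j.
- by apply: prodr_gt0 => j _; have [] := hC j.
move=> a c s n u a0 sn hu.
have /choice [x0 hx] : forall j, exists x, [/\ 0 <= x, x + (C j).1.2 * 2 ^- s j <= 1 &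
   forall z, x <= z < x + (C j).1.2 * 2 ^- s j ->
    (C j).1.1 * (2 ^+ s j / 2 ^+ n j) `^ k 0 j * a j (s j) <=
     `|fdiff (k 0 j) (- 2 ^- n j) (super r (a j)) z|].
  move=> j; have [_ _ h] := hC j; apply: h => //.
  by rewrite (leq_trans _ (sn j)) // leq_add2l; exact: leq_bigmax.
rewrite -big_split /= -big_split /= in hu *.
have p0 : 2 * pi != 0 :> R by rewrite gt_eqF // twopi_gt0.
apply: (@rearrangement_prod_ge R m _ (fun j => fdiff (k 0 j) (- 2 ^- n j) (super r (a j)))
  _ (fun j => (C j).1.2 * 2 ^- s j) x0) => //.
- move=> x _; rewrite mixed_difference_testfun //; apply: eq_bigr => j _.
  by rewrite tnth_mktuple mulNr mulrAC divff // mul1r.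
- move=> j; have [c1 _ _] := hC j.
  by rewrite !mulr_ge0 ?powR_ge0 // ltW.
- by move=> j; have [_ l1 _] := hC j; rewrite mulr_gt0 // invr_gt0 exprn_gt0.
- by move=> j; have [] := hx j.
- by move=> j; have [] := hx j.
- by move=> j z; rewrite mulrA; have [_ _] := hx j; apply.
Qed.

End test_function.

(** * Mixed moduli of smoothness of the test functions *)

Section modulus_bounds.
Context {R : realType} {m : nat}.
Implicit Types (h t : m.-tuple R) (c : 'I_m -> R) (k : 'rV[R]_m).

Lemma p2_ge0 (x : R) : 0 <= p2 x.
Proof. exact: ltW (p2_gt0 x). Qed.

Lemma slow_ge0 (lam : R) s : 0 <= slow lam s.
Proof. exact: ltW (slow_gt0 lam s). Qed.

#[local] Hint Resolve p2_ge0 slow_ge0 p2_gt0 slow_gt0 : core.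

Definition spike (j0 : 'I_m) (gam lam : R) (j : 'I_m) (s : nat) : R :=
  if j == j0 then p2 (- (gam * s%:R)) * slow lam s else (s == 0)%N%:R.

Lemma spike_ge0 j0 gam lam j s : 0 <= spike j0 gam lam j s.
Proof.
rewrite /spike; case: ifP => _ //.
exact: mulr_ge0.
Qed.

Lemma min1_mul2 (x : R) : 0 <= x -> Num.min 1 (2 * x) <= 2 * Num.min 1 x.
Proof.
move=> x0; rewrite [leRHS]minr_pMr // mulr1 le_min !ge_min lexx !orbT andbT.
by rewrite ler1n.
Qed.

Lemma kernel_dyadic_le (k t u : R) (n i s : nat) : 0 < k -> dyadic n t -> dyadic i u ->
  Num.min 1 ((2 ^+ s * t) `^ k) * Num.min 1 (2 ^- s / u) <=
  2 * (Num.min 1 (p2 (k * (s%:R - n%:R))) * Num.min 1 (p2 (i%:R - s%:R))).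
Proof.
move=> k0 dt du; have t0 := dyadic_gt0 dt; have u0 := dyadic_gt0 du.
have m1 : Num.min 1 ((2 ^+ s * t) `^ k) <= Num.min 1 (p2 (k * (s%:R - n%:R))).
  rewrite le_min !ge_min lexx /=; apply/orP; right.
  rewrite [k * _]mulrC -p2_powR ge0_ler_powR ?nnegrE ?(ltW k0) //.
    by rewrite mulr_ge0 ?exprn_ge0 // ltW.
  rewrite p2D p2N !p2_nat ler_wpM2l ?exprn_ge0 //.
  by move: dt; rewrite /dyadic /= in_itv /= => /andP[_ /ltW].
have m2 : Num.min 1 (2 ^- s / u) <= 2 * Num.min 1 (p2 (i%:R - s%:R)).
  apply: (le_trans _ (min1_mul2 (ltW (p2_gt0 _)))).
  rewrite le_min !ge_min lexx /=; apply/orP; right.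
  rewrite ler_pdivrMr // mulrAC p2D p2N !p2_nat mulrA ler_peMl ?invr_ge0 ?exprn_ge0 //.
  have [_ h] := dyadic_comparable du; rewrite p2N p2_nat in h.
  by rewrite -(ler_pdivrMr _ _ (exprn_gt0 i (ltr0n R 2))) mul1r.
rewrite mulrCA; apply: ler_pM => //.
- by rewrite le_min ler01 powR_ge0.
- by rewrite le_min ler01 divr_ge0 ?invr_ge0 ?exprn_ge0 ?(ltW u0).
Qed.

(** Reduces the modulus to the discrete kernel sums in the coordinate j0.
    In another coordinate the single atom contributes t_j^k_j. *)
Lemma mixed_modulus_le (j0 : 'I_m) (gam lam q T : R) r k : 0 < q -> 0 < T ->
  (forall j, 0 < k 0 j) -> (forall j, k 0 j + 3 <= r%:R) ->
  exists2 C : R, 0 < C & forall (c : 'I_m -> R) t (n : nat) (B : nat -> R) (S : R),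
  (forall j, 0 < tnth t j < 1) -> dyadic n (tnth t j0) -> (forall i, 0 < B i) ->
  (forall i N, \sum_(0 <= s < N) p2 (- (gam * s%:R)) * slow lam s *
     (Num.min 1 (p2 (k 0 j0 * (s%:R - n%:R))) * Num.min 1 (p2 (i%:R - s%:R)))
     <= B i * p2 (i%:R / q)) ->
  (forall N, \sum_(0 <= i < N) B i `^ T <= S) ->
  (mixed_modulus q T k (testfun r (spike j0 gam lam) c) t <=
    (C * S `^ T^-1 * \prod_(j < m | j != j0) (tnth t j `^ k 0 j))%:E)%E.
Proof.
move=> q0 T0 k0 kr; have m0 : (0 < m)%N := leq_ltn_trans (leq0n _) (ltn_ord j0).
have [C1 C10 h1] := rearrangement_mixed_difference_le m0 k0 kr.
have [C2 C20 h2] := @lorentz_norm_le R m q T q0 T0.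
exists (C2 * (2 * C1)); first by rewrite !mulr_gt0.
move=> c t n B S t01 dt B0 hB hS; set W := \prod_(j < m | _) _.
have W0 : 0 < W.
  by apply: prodr_gt0 => j _; rewrite powR_gt0 //; have /andP[] := t01 j.
apply: ub_ereal_sup => _ [h ht <-].
have S0 : 0 <= S by have := hS 0%N; rewrite big_geq.
apply: (le_trans (h2 _ (fun i => 2 * C1 * W * B i) ((2 * C1 * W) `^ T * S) _ _ _)).
- by move=> i; rewrite !mulr_ge0 ?(ltW C10) ?(ltW W0) ?(ltW (B0 _)).
- move=> i u du; have u0 := dyadic_gt0 du.
  apply: (le_trans (h1 _ c t h u (fun j => if j == j0 then 2 * (B i * p2 (i%:R / q))
                              else tnth t j `^ k 0 j) _ _ u0 _ _)).
  + exact: spike_ge0.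
  + exact: ht.
  + move=> j; case: ifP => _; first by rewrite !mulr_gt0 // p2_gt0.
    by rewrite powR_gt0 //; have /andP[] := t01 j.
  + move=> j N; rewrite /spike; case: eqVneq => [->|jj0].
      apply: (@le_trans _ _ (2 * \sum_(0 <= s < N) p2 (- (gam * s%:R)) * slow lam s *
     (Num.min 1 (p2 (k 0 j0 * (s%:R - n%:R))) * Num.min 1 (p2 (i%:R - s%:R))))); last first.
        by rewrite ler_pM2l.
      rewrite mulr_sumr; apply: ler_sum => s _; rewrite [leRHS]mulrCA ler_wpM2l //.
        exact: mulr_ge0.
      exact: kernel_dyadic_le.
    have /andP[tj0 tj1] := t01 j.
    apply: (@le_trans _ _ (\sum_(0 <= s < N) (s == 0)%N%:R * tnth t j `^ k 0 j)).
      apply: ler_sum => s _; have [->|_] := eqVneq s 0%N; last by rewrite !mul0r.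
      have -> : (true : nat)%:R = 1 :> R by [].
      rewrite !mul1r -[leRHS]mulr1; apply: ler_pM.
      - by rewrite le_min ler01 powR_ge0.
      - by rewrite le_min ler01 mulr_ge0 ?invr_ge0 ?exprn_ge0 // ltW.
      - by rewrite ge_min lexx orbT.
      - by rewrite ge_min lexx.
    rewrite -mulr_suml ler_piMl ?powR_ge0 //; case: N => [|N]; first by rewrite big_geq.
    by rewrite big_nat_recl // big1 ?addr0.
  rewrite (bigD1 j0) //= eqxx (eq_bigr (fun j => tnth t j `^ k 0 j)); last first.
    by move=> j /negbTE ->.
  rewrite lee_fin -/W le_eqVlt; apply/orP; left; apply/eqP; ring.
- move=> N; under eq_bigr do rewrite powRM ?mulr_ge0 ?(ltW C10) ?(ltW W0) ?(ltW (B0 _)) //.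
  by rewrite -mulr_sumr ler_wpM2l ?powR_ge0.
rewrite lee_fin powRM ?powR_ge0 // -powRrM mulfV ?gt_eqF // powRr1; last first.
  by rewrite !mulr_ge0 ?(ltW C10) ?(ltW W0).
by rewrite le_eqVlt; apply/orP; left; apply/eqP; ring.
Qed.

(** Below the critical order both choices e = 1/q + d and
    e = 1/q - d are admissible in [kernel_sum_le]; the first is used for i < n,
    the second for i >= n, so that the profile decays geometrically in |i - n| and
    its l_T norm does not depend on T up to constants. *)
Lemma mixed_modulus_sub_le (j0 : 'I_m) (gam lam q T : R) r k : 1 < q -> 0 < T ->
  (forall j, 0 < k 0 j) -> (forall j, k 0 j + 3 <= r%:R) ->
  0 < gam + q^-1 -> gam + q^-1 < k 0 j0 ->
  exists2 C : R, 0 < C & forall (c : 'I_m -> R) t (n : nat),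
  (forall j, 0 < tnth t j < 1) -> dyadic n (tnth t j0) ->
  (mixed_modulus q T k (testfun r (spike j0 gam lam) c) t <=
    (C * (p2 (- ((gam + q^-1) * n%:R)) * slow lam n) *
       \prod_(j < m | j != j0) (tnth t j `^ k 0 j))%:E)%E.
Proof.
move=> q1 T0 k0 kr g0 gk; have q0 : 0 < q by rewrite (lt_trans ltr01).
have [C0 C00 h0] := mixed_modulus_le j0 gam lam q0 T0 k0 kr.
have qi0 : 0 < q^-1 by rewrite invr_gt0.
have qi1 : q^-1 < 1 by rewrite invf_lt1.
pose d := Num.min (Num.min q^-1 (1 - q^-1)) (Num.min (gam + q^-1) (k 0 j0 - (gam + q^-1))) / 2.
have [d0 [d1 [d2 [d3 d4]]]] : 0 < d /\ d < q^-1 /\ d < 1 - q^-1 /\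
    d < gam + q^-1 /\ d < k 0 j0 - (gam + q^-1).
  rewrite /d; set M := Num.min (Num.min _ _) _.
  have M0 : 0 < M by rewrite !lt_min qi0 g0 !subr_gt0 qi1 gk.
  have [] : [/\ M <= q^-1, M <= 1 - q^-1, M <= gam + q^-1 & M <= k 0 j0 - (gam + q^-1)].
    by split; rewrite !ge_min lexx ?orbT.
  by move=> *; do !split; lra.
have e1 : 0 <= q^-1 + d by rewrite addr_ge0 // ltW.
have e2 : q^-1 + d <= 1 by lra.
have e3 : 0 < gam + (q^-1 + d) by lra.
have e4 : gam + (q^-1 + d) < k 0 j0 by lra.
have e5 : 0 <= q^-1 - d by lra.
have e6 : q^-1 - d <= 1 by lra.
have e7 : 0 < gam + (q^-1 - d) by lra.
have e8 : gam + (q^-1 - d) < k 0 j0 by lra.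
have [C1 C10 h1] := kernel_sum_le lam e1 e2 e3 e4.
have [C2 C20 h2] := kernel_sum_le lam e5 e6 e7 e8.
have dT : 0 < d * T by rewrite mulr_gt0.
have [C3 C30 h3] := geometric_sum_le dT.
exists (C0 * ((C1 + C2) * C3 `^ T^-1)).
  by rewrite !mulr_gt0 ?powR_gt0 // addr_gt0.
move=> c t n t01 dt; set A := p2 _ * slow lam n.
have A0 : 0 < A by rewrite mulr_gt0 ?p2_gt0 ?slow_gt0.
pose K := (C1 + C2) * A; have K0 : 0 < K by rewrite mulr_gt0 // addr_gt0.
apply: (le_trans (h0 c t n (fun i => K * p2 (- (d * `|i%:R - n%:R|))) (K `^ T * C3) t01 dt _ _ _)).
- by move=> i; rewrite mulr_gt0 ?p2_gt0.
- move=> i N; rewrite /K /A.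
  have [ni|ni] := leP (n%:R : R) i%:R.
    apply: (le_trans (h2 i n N)).
    have -> : (q^-1 - d) * i%:R - (gam + (q^-1 - d)) * n%:R =
      - ((gam + q^-1) * n%:R) + - (d * (i%:R - n%:R)) + i%:R / q by ring.
    rewrite ger0_norm ?subr_ge0 // !p2D.
    set X := p2 _; set Y := p2 (- (d * _)); set Z := p2 (_ / _).
    have P0 : 0 <= slow lam n * X * Y * Z := mulr_ge0 (mulr_ge0 (mulr_ge0 (slow_ge0 lam n) (p2_ge0 _ : 0 <= X)) (p2_ge0 _ : 0 <= Y)) (p2_ge0 _ : 0 <= Z).
    have := mulr_ge0 (ltW C10) P0; lra.
  apply: (le_trans (h1 i n N)).
  have -> : (q^-1 + d) * i%:R - (gam + (q^-1 + d)) * n%:R =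
    - ((gam + q^-1) * n%:R) + - (d * - (i%:R - n%:R)) + i%:R / q by ring.
  rewrite ltr0_norm ?subr_lt0 // !p2D.
  set X := p2 _; set Y := p2 (- (d * _)); set Z := p2 (_ / _).
  have P0 : 0 <= slow lam n * X * Y * Z := mulr_ge0 (mulr_ge0 (mulr_ge0 (slow_ge0 lam n) (p2_ge0 _ : 0 <= X)) (p2_ge0 _ : 0 <= Y)) (p2_ge0 _ : 0 <= Z).
  have := mulr_ge0 (ltW C20) P0; lra.
- move=> N; under eq_bigr do rewrite powRM ?(ltW K0) // p2_powR.
  rewrite -mulr_sumr ler_wpM2l ?powR_ge0 // (le_trans _ (h3 n N)) //.
  apply: ler_sum => i _; rewrite le_eqVlt; apply/orP; left; apply/eqP; congr p2; ring.
rewrite lee_fin powRM ?powR_ge0 ?(ltW C30) // -powRrM mulfV ?gt_eqF // powRr1 ?(ltW K0) //.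
by rewrite /K le_eqVlt; apply/orP; left; apply/eqP; ring.
Qed.

(** For i <= n the profile is (i+1)^(-lam) without decay, and its
    l_T norm produces (n+1)^(1/T - lam); this needs lam T < 1. For i > n
    it still decays geometrically. *)
Lemma mixed_modulus_critical_le (j0 : 'I_m) (lam q T : R) (r : nat) k : 1 < q -> 0 < T ->
  (forall j, 0 < k 0 j) -> (forall j, k 0 j + 3 <= r%:R) -> lam * T < 1 ->
  exists2 C : R, 0 < C & forall (c : 'I_m -> R) t (n : nat),
  (forall j, 0 < tnth t j < 1) -> dyadic n (tnth t j0) ->
  (mixed_modulus q T k (testfun r (spike j0 (k 0 j0 - q^-1)%R lam) c) t <=
    (C * (p2 (- (k 0 j0 * n%:R)) * n.+1%:R `^ (T^-1 - lam)) *
       \prod_(j < m | j != j0) (tnth t j `^ k 0 j))%R%:E)%E.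
Proof.
move=> q1 T0 k0 kr lT; have q0 : 0 < q by rewrite (lt_trans ltr01).
set al := k 0 j0; have al0 : 0 < al := k0 j0.
have [C0 C00 h0] := mixed_modulus_le j0 (al - q^-1) lam q0 T0 k0 kr.
have qi0 : 0 < q^-1 by rewrite invr_gt0.
have qi1 : q^-1 < 1 by rewrite invf_lt1.
pose d := Num.min q^-1 al / 2.
have [d0 [d1 d2]] : 0 < d /\ d < q^-1 /\ d < al.
  rewrite /d; set M := Num.min _ _.
  have M0 : 0 < M by rewrite !lt_min qi0.
  have [] : M <= q^-1 /\ M <= al by split; rewrite !ge_min lexx ?orbT.
  by move=> *; do !split; lra.
have e5 : 0 <= q^-1 - d by lra.
have e6 : q^-1 - d <= 1 by lra.
have e7 : 0 < al - q^-1 + (q^-1 - d) by lra.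
have e8 : al - q^-1 + (q^-1 - d) < al by lra.
have [C1 C10 h1] := kernel_sum_high_le lam al qi0 qi1.
have [C2 C20 h2] := kernel_sum_le lam e5 e6 e7 e8.
have dT : 0 < d * T by rewrite mulr_gt0.
have [C3 C30 h3] := geometric_sum_le dT.
have lT' : - 1 < - (lam * T) by lra.
have [C4 C40 h4] := sum_powR_le lT'.
exists (C0 * ((C1 + C2) * (C4 + C3) `^ T^-1)).
  by rewrite !mulr_gt0 ?powR_gt0 // addr_gt0.
move=> c t n t01 dt.
pose K := (C1 + C2) * p2 (- (al * n%:R)).
have K0 : 0 < K by rewrite mulr_gt0 ?p2_gt0 // addr_gt0.
pose b (i : nat) := if (i <= n)%N then slow lam i else slow lam n * p2 (- (d * `|i%:R - n%:R|)).
have b0 i : 0 < b i by rewrite /b; case: ifP => _; rewrite ?mulr_gt0 ?p2_gt0 ?slow_gt0.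
apply: (le_trans (h0 c t n (fun i => K * b i)
  (K `^ T * ((C4 + C3) * n.+1%:R `^ (1 - lam * T))) t01 dt _ _ _)).
- by move=> i; rewrite mulr_gt0.
- move=> i N; rewrite /K /b; case: leqP => ni.
    apply: (le_trans (h1 i n N)).
    have -> : q^-1 * i%:R - al * n%:R = - (al * n%:R) + i%:R / q by ring.
    rewrite !p2D; set X := p2 _; set Z := p2 (_ / _).
    have P0 : 0 <= slow lam i * X * Z := mulr_ge0 (mulr_ge0 (slow_ge0 lam i) (p2_ge0 _ : 0 <= X)) (p2_ge0 _ : 0 <= Z).
    have := mulr_ge0 (ltW C20) P0; lra.
  apply: (le_trans (h2 i n N)).
  have -> : (q^-1 - d) * i%:R - (al - q^-1 + (q^-1 - d)) * n%:R =
    - (al * n%:R) + - (d * (i%:R - n%:R)) + i%:R / q by ring.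
  rewrite ger0_norm ?subr_ge0 ?ler_nat ?(ltnW ni) // !p2D.
  set X := p2 _; set Y := p2 (- (d * _)); set Z := p2 (_ / _).
  have P0 : 0 <= slow lam n * X * Y * Z := mulr_ge0 (mulr_ge0 (mulr_ge0 (slow_ge0 lam n) (p2_ge0 _ : 0 <= X)) (p2_ge0 _ : 0 <= Y)) (p2_ge0 _ : 0 <= Z).
  have := mulr_ge0 (ltW C10) P0; lra.
- move=> N; under eq_bigr do rewrite powRM ?(ltW K0) ?(ltW (b0 _)) //.
  rewrite -mulr_sumr ler_wpM2l ?powR_ge0 //.
  have n1 : 1 <= n.+1%:R :> R by rewrite ler1n.
  apply: (@le_trans _ _ (\sum_(0 <= i < N) ((if (i <= n)%N then i.+1%:R `^ (- (lam * T)) else 0) +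
     n.+1%:R `^ (1 - lam * T) * p2 (- (d * T * `|i%:R - n%:R|))))).
    apply: ler_sum => i _; rewrite /b; case: leqP => ni.
      rewrite /slow -powRrM mulNr lerDl mulr_ge0 ?powR_ge0 //; exact: p2_ge0.
    rewrite add0r powRM // p2_powR.
    rewrite mulNr [d * T]mulrC -[T * d * _]mulrA [T * _]mulrC ler_wpM2r //.
    rewrite /slow -powRrM mulNr ler_powR //; lra.
  rewrite big_split /= -mulr_sumr mulrDl lerD //; last first.
    by rewrite mulrC ler_wpM2r ?powR_ge0.
  apply: (@le_trans _ _ (\sum_(0 <= i < n.+1) i.+1%:R `^ (- (lam * T)))); last exact: h4.
  rewrite -big_mkcond /=.
  have [Nn|nN] := leqP N n.+1.
    rewrite [leRHS](big_cat_nat _ Nn) //= -[leLHS]addr0 lerD //.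
      by rewrite [leLHS]big_mkcond /=; apply: ler_sum => i _; case: ifP.
    by apply: sumr_ge0 => i _; exact: powR_ge0.
  rewrite (big_cat_nat _ (ltnW nN)) //= [X in _ + X]big_nat_cond [X in _ + X]big_pred0; last first.
    by move=> i; apply/negP => /andP[/andP[h _]]; rewrite leqNgt h.
  by rewrite addr0 [leLHS]big_mkcond /=; apply: ler_sum => i _; case: ifP.
rewrite lee_fin powRM ?mulr_ge0 ?powR_ge0 ?(ltW (addr_gt0 C40 C30)) //.
rewrite -powRrM mulfV ?gt_eqF // powRr1 ?(ltW K0) //.
rewrite powRM ?powR_ge0 ?(ltW (addr_gt0 C40 C30)) // -powRrM.
have -> : (1 - lam * T) / T = T^-1 - lam by field; rewrite gt_eqF.
by rewrite /K le_eqVlt; apply/orP; left; apply/eqP; ring.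
Qed.

Lemma exists_pow2_le (l : R) : 0 < l -> exists L, 2 ^- L <= l.
Proof.
move=> l0; have [N hN] := exists_nat_ge l^-1; exists N.
rewrite -[leRHS]invrK lef_pV2 ?posrE ?invr_gt0 ?exprn_gt0 // (le_trans hN) //.
by rewrite -natrX ler_nat ltnW // ltn_expl.
Qed.

(** One difference, with steps -2 pi 2^-n_j, serves all s at once: the
    atom s bounds its rearrangement from below on the dyadic interval of index
    s + L, and the contributions of different s add up in l_T. *)
Lemma mixed_modulus_ge (j0 : 'I_m) (gam lam q T : R) r k : 0 < q -> 0 < T ->
  (forall j, 0 < k 0 j) -> (forall j, k 0 j + 3 <= r%:R) ->
  exists (c1 : R) (n0 : nat), 0 < c1 /\ forall (c : 'I_m -> R) t (n : nat) (P : nat -> R),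
  dyadic n (tnth t j0) -> (n0 <= n)%N -> (forall j, j != j0 -> 2^-1 <= tnth t j) ->
  (forall s, 0 <= P s) ->
  (forall s, (s + n0 <= n)%N -> P s <= p2 ((k 0 j0 - gam - q^-1) * s%:R) * slow lam s *
     p2 (- (k 0 j0 * n%:R))) ->
  ((c1 * (\sum_(0 <= s < (n - n0).+1) P s `^ T) `^ T^-1)%:E <=
   mixed_modulus q T k (testfun r (spike j0 gam lam) c) t)%E.
Proof.
move=> q0 T0 k0 kr.
have [cc [l [n0 [cc0 l0 hr]]]] := rearrangement_mixed_difference_ge k0 kr.
have [c2 c20 hl] := @lorentz_norm_ge R m q T q0 T0.
(* The atom s acts on u < l 2^-s, which contains the dyadic interval s + L. *)
have [L hL] := exists_pow2_le l0.
pose M := (n0 + 4)%N.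
pose W := \prod_(j < m | j != j0) ((2 ^+ 0 / 2 ^+ M : R) `^ k 0 j).
have W0 : 0 < W by apply: prodr_gt0 => j _; rewrite powR_gt0 // divr_gt0 ?exprn_gt0.
pose c1 := cc * p2 (- (4 * k 0 j0)) * W * p2 (- (L%:R / q)).
have c10 : 0 < c1 by rewrite !mulr_gt0 // p2_gt0.
exists (c2 * c1), n0; split; first exact: mulr_gt0.
move=> c t n P dt nn t2 P0 hP.
(* Since 2 pi <= 8, the steps 2 pi 2^-(n+4) and 2 pi 2^-M are at most t_j0 and 1/2. *)
pose nj (j : 'I_m) := if j == j0 then (n + 4)%N else M.
pose h : m.-tuple R := [tuple (- (2 * pi * 2 ^- nj j))%R | j < m].
have pi4 : 2 * pi <= 2 ^+ 3 :> R by have [/andP[_ hp] _] := pihalf_02_cos_pihalf R; rewrite -natrX; lra.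
have pow2 (a b : nat) : 2 ^+ a / 2 ^+ (b + a) = 2 ^- b :> R.
  by rewrite exprD; field; rewrite !expf_neq0 // pnatr_eq0.
have hh j : `|tnth h j| <= tnth t j.
  rewrite tnth_mktuple normrN ger0_norm; last first.
    by rewrite mulr_ge0 ?invr_ge0 ?exprn_ge0 // ltW // twopi_gt0.
  rewrite /nj; case: eqVneq => [->|jj0].
    apply: (@le_trans _ _ (2 ^+ 3 / 2 ^+ (n.+1 + 3))); last first.
      by rewrite pow2; move: dt; rewrite /dyadic /= in_itv /= => /andP[].
    by rewrite addSnnS ler_wpM2r // invr_ge0 exprn_ge0.
  apply: (le_trans _ (t2 j jj0)).
  apply: (@le_trans _ _ (2 ^+ 3 / 2 ^+ (n0.+1 + 3))).
    by rewrite /M addSnnS ler_wpM2r // invr_ge0 exprn_ge0.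
  by rewrite pow2 lef_pV2 ?posrE ?exprn_gt0 // -[leLHS]expr1 ler_weXn2l // ler1n.
apply: (@le_trans _ _ (lorentz_norm q T (mixed_difference k h (testfun r (spike j0 gam lam) c)))); last first.
  by apply: ereal_sup_ubound; exists h => //=.
pose B (i : nat) := if (L <= i)%N then c1 * P (i - L)%N else 0.
have B0 i : 0 <= B i by rewrite /B; case: ifP => _ //; rewrite mulr_ge0 // ltW.
apply: (le_trans _ (hl _ B (L + (n - n0).+1)%N B0 _)).
  rewrite lee_fin -mulrA ler_pM2l //.
  have -> : c1 * (\sum_(0 <= s < (n - n0).+1) P s `^ T) `^ T^-1 =
    (c1 `^ T * \sum_(0 <= s < (n - n0).+1) P s `^ T) `^ T^-1.
    rewrite powRM ?powR_ge0 ?sumr_ge0 // => [|i _]; last exact: powR_ge0.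
    by rewrite -powRrM mulfV ?gt_eqF // powRr1 // ltW.
  rewrite ge0_ler_powR ?invr_ge0 ?(ltW T0) // ?nnegrE ?mulr_ge0 ?powR_ge0 ?sumr_ge0 //.
  + by move=> i _; exact: powR_ge0.
  + by move=> i _; exact: powR_ge0.
  rewrite mulr_sumr (big_cat_nat _ (leq_addr (n - n0).+1 L)) //= -[leLHS]add0r lerD //.
    by apply: sumr_ge0 => i _; exact: powR_ge0.
  rewrite -[X in _ <= \sum_(X <= _ < _) _]add0n big_addn addKn; apply: ler_sum => s _.
  by rewrite /B leq_addl addnK powRM // ltW.
move=> i u iN du; rewrite /B; case: leqP => Li; last first.
  by rewrite mul0r; exact: rearrangement_ge0.
pose s := (i - L)%N; have iE : i = (s + L)%N by rewrite subnK.
have sn : (s + n0 <= n)%N by rewrite /s; move: iN Li nn; clear; lia.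
pose sj (j : 'I_m) := if j == j0 then s else 0%N.
apply: (le_trans _ (hr _ c sj nj u _ _ _)).
- rewrite lee_fin (bigD1 j0) //= /sj /nj eqxx.
  rewrite (eq_bigr (fun j => (2 ^+ 0 / 2 ^+ M : R) `^ k 0 j)) -/W; last first.
    by move=> j /negbTE jj0; rewrite /spike jj0 mulr1.
  have -> : (2 ^+ s / 2 ^+ (n + 4) : R) `^ k 0 j0 = p2 ((s%:R - (n%:R + 4)) * k 0 j0).
    by rewrite -p2_powR p2D p2N -natrD !p2_nat.
  rewrite /spike eqxx -/s iE natrD mulrDl p2D.
  have {}hP := hP s sn.
  apply: (@le_trans _ _ (c1 * (p2 ((k 0 j0 - gam - q^-1) * s%:R) * slow lam s *
     p2 (- (k 0 j0 * n%:R))) * (p2 (s%:R / q) * p2 (L%:R / q)))).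
    rewrite ler_wpM2r ?ler_wpM2l ?(ltW c10) //.
    exact: mulr_ge0.
  rewrite /c1 le_eqVlt; apply/orP; left; apply/eqP.
  rewrite [p2 (- (L%:R / q))]p2N; set X := p2 (L%:R / q).
  have X0 : X != 0 by rewrite gt_eqF // p2_gt0.
  have -> : p2 ((s%:R - (n%:R + 4)) * k 0 j0) =
     p2 ((k 0 j0 - gam - q^-1) * s%:R) * p2 (- (k 0 j0 * n%:R)) * p2 (s%:R / q) *
     p2 (- (4 * k 0 j0)) / p2 (- (gam * s%:R)).
    by rewrite -p2N -!p2D; congr p2; ring.
  set Y := p2 (- (gam * s%:R)).
  have Y0 : Y != 0 by rewrite gt_eqF // p2_gt0.
  by field; rewrite X0 Y0.
- exact: spike_ge0.
- by move=> j; rewrite /sj /nj; case: ifP => _; rewrite /M; clear -sn; lia.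
- move: du; rewrite /dyadic /= in_itv /= => /andP[_ /lt_le_trans]; apply.
  have -> : \prod_j (2 ^- sj j) = 2 ^- s :> R.
    rewrite (bigD1 j0) //= big1 ?mulr1 /sj ?eqxx // => j /negbTE ->.
    by rewrite expr0 invr1.
  by rewrite iE exprD invfM mulrC ler_wpM2r // invr_ge0 exprn_ge0.
Qed.

Lemma mixed_modulus_critical_ge (j0 : 'I_m) (lam q T : R) (r : nat) k : 0 < q -> 0 < T ->
  (forall j, 0 < k 0 j) -> (forall j, k 0 j + 3 <= r%:R) ->
  exists (c1 : R) (n0 : nat), 0 < c1 /\ forall (c : 'I_m -> R) t (n : nat),
  dyadic n (tnth t j0) -> (n0 <= n)%N -> (forall j, j != j0 -> 2^-1 <= tnth t j) ->
  ((c1 * (p2 (- (k 0 j0 * n%:R)) * n.+1%:R `^ (T^-1 - lam)))%:E <=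
   mixed_modulus q T k (testfun r (spike j0 (k 0 j0 - q^-1)%R lam) c) t)%E.
Proof.
move=> q0 T0 k0 kr; set al := k 0 j0.
have [c1 [n0 [c10 h1]]] := mixed_modulus_ge j0 (al - q^-1) lam q0 T0 k0 kr.
have [c2 c20 h2] := @sum_powR_ge R (- (lam * T)).
pose K : R := n0.+1%:R `^ `|T^-1 - lam|.
have K0 : 0 < K by rewrite powR_gt0.
exists (c1 * (c2 `^ T^-1 * K^-1)), n0; split.
  by rewrite !mulr_gt0 ?invr_gt0 // powR_gt0.
move=> c t n dt nn t2; pose A := p2 (- (al * n%:R)); have A0 : 0 < A by exact: p2_gt0.
apply: (le_trans _ (h1 c t n (fun s => A * slow lam s) dt nn t2 _ _)).
- rewrite lee_fin -/A -!mulrA ler_pM2l //.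
  under eq_bigr do rewrite powRM ?(ltW A0) //.
  rewrite -mulr_sumr powRM ?powR_ge0 ?sumr_ge0 // => [|i _]; last exact: powR_ge0.
  rewrite -powRrM mulfV ?gt_eqF // powRr1 ?(ltW A0) //.
  have h : c2 * (n - n0).+1%:R `^ (1 - lam * T) <= \sum_(0 <= s < (n - n0).+1) slow lam s `^ T.
    apply: (le_trans (h2 (n - n0).+1 isT)); apply: ler_sum => s _.
    by rewrite /slow -powRrM mulNr.
  apply: (@le_trans _ _ (A * (c2 `^ T^-1 * (n - n0).+1%:R `^ (T^-1 - lam)))).
    have -> : c2 `^ T^-1 * (K^-1 * (A * n.+1%:R `^ (T^-1 - lam))) =
      A * (c2 `^ T^-1 * (K^-1 * n.+1%:R `^ (T^-1 - lam))) by ring.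
    rewrite ler_wpM2l ?(ltW A0) // ler_wpM2l ?powR_ge0 // ler_pdivrMl //.
    apply: powR_comparable; rewrite ?ler1n // -?natrM ?ler_nat //; last by lia.
    rewrite -{1}(subnK nn); set x := (n - n0)%N.
    by rewrite mulSn mulnS; have := leq0n (n0 * x); lia.
  rewrite ler_wpM2l ?(ltW A0) //.
  have -> : T^-1 - lam = (1 - lam * T) * T^-1 by field; rewrite gt_eqF.
  rewrite powRrM -powRM ?powR_ge0 ?(ltW c20) //.
  rewrite ge0_ler_powR ?invr_ge0 ?(ltW T0) // nnegrE.
    by rewrite mulr_ge0 ?powR_ge0 // ltW.
  by apply: sumr_ge0 => i _; exact: powR_ge0.
- by move=> s; exact: mulr_ge0 (ltW A0) _.
- move=> s _; rewrite -/al (_ : (al - (al - q^-1) - q^-1) = 0); last by ring.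
  by rewrite mul0r p20 mul1r mulrC.
Qed.

Lemma mixed_modulus_sub_ge (j0 : 'I_m) (gam lam q T : R) r k : 0 < q -> 0 < T ->
  (forall j, 0 < k 0 j) -> (forall j, k 0 j + 3 <= r%:R) ->
  exists (c1 : R) (n0 : nat), 0 < c1 /\ forall (c : 'I_m -> R) t (n : nat),
  dyadic n (tnth t j0) -> (n0 <= n)%N -> (forall j, j != j0 -> 2^-1 <= tnth t j) ->
  ((c1 * (p2 (- ((gam + q^-1) * n%:R)) * slow lam n))%:E <=
   mixed_modulus q T k (testfun r (spike j0 gam lam) c) t)%E.
Proof.
move=> q0 T0 k0 kr; set al := k 0 j0.
have [c1 [n0 [c10 h1]]] := mixed_modulus_ge j0 gam lam q0 T0 k0 kr.
have [K K0 hK] := @slow_comparable R lam 1 ltr01.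
pose e := al - gam - q^-1.
exists (c1 * (p2 (- (e * n0%:R)) / (K * p2 n0%:R))), n0; split.
  by rewrite !mulr_gt0 ?invr_gt0 ?mulr_gt0 ?p2_gt0.
move=> c t n dt nn t2; pose A := p2 (e * (n - n0)%:R) * slow lam (n - n0) * p2 (- (al * n%:R)).
have A0 : 0 < A by rewrite !mulr_gt0 ?p2_gt0 ?slow_gt0.
apply: (le_trans _ (h1 c t n (fun s => if s == (n - n0)%N then A else 0) dt nn t2 _ _)).
- rewrite lee_fin -!mulrA ler_pM2l //.
  rewrite big_nat_recr //= eqxx.
  apply: (@le_trans _ _ A).
    rewrite /A natrB // mulrBr p2D.
    have {}hK : slow lam n <= K * p2 n0%:R * slow lam (n - n0).
      have := hK n (n - n0)%N; rewrite natrB // mul1r.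
      by rewrite opprB addrC subrK normr_nat mulrAC.
    have -> : p2 (- ((gam + q^-1) * n%:R)) = p2 (e * n%:R) * p2 (- (al * n%:R)).
      by rewrite -p2D; congr p2; rewrite /e; ring.
    rewrite [leLHS](_ : _ = p2 (- (e * n0%:R)) * p2 (e * n%:R) * p2 (- (al * n%:R)) *
      ((K * p2 n0%:R)^-1 * slow lam n)); last by ring.
    rewrite [leRHS](_ : _ = p2 (- (e * n0%:R)) * p2 (e * n%:R) * p2 (- (al * n%:R)) *
      slow lam (n - n0)); last by ring.
    rewrite ler_pM2l ?mulr_gt0 ?p2_gt0 // ler_pdivrMl ?mulr_gt0 ?p2_gt0 //.
  rewrite -[leLHS](powRr1 (ltW A0)) -(mulfV (lt0r_neq0 T0)) powRrM.
  rewrite ge0_ler_powR ?invr_ge0 ?(ltW T0) ?nnegrE ?powR_ge0 //.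
    by rewrite addr_ge0 ?powR_ge0 // sumr_ge0 // => i _; exact: powR_ge0.
  by rewrite lerDr sumr_ge0 // => i _; exact: powR_ge0.
- by move=> s; case: ifP => _ //; exact: ltW.
- move=> s _; case: eqVneq => [->|_]; first by [].
  by rewrite !mulr_ge0.
Qed.

End modulus_bounds.

(** * Lorentz norms and means of the test functions *)

Section membership.
Context {R : realType}.
Implicit Types (a : nat -> R) (r : nat).
Local Notation leb := (@lebesgue_measure R).

(** At z >= u only atoms with 2^s u <= 1 can be nonzero. *)
Lemma super_le_cutoff r a (B u z : R) : 0 <= B -> (forall s, 0 <= a s) ->
  (forall s, 2 ^+ s * u <= 1 -> a s <= B) -> 0 <= z < 1 -> u <= z -> super r a z <= B.
Proof.
move=> B0 a0 hB z01 uz.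
have [[s hs]|/forallNP h] := pselect (exists s, atom r s z != 0); last first.
  rewrite super_eq0 // => s; have /negP := h s; by rewrite negbK => /eqP.
rewrite (superE a hs) (@le_trans _ _ (a s)) //; first by rewrite ler_piMr // atom_le1.
apply: hB; have := atom_neq0 hs; rewrite fracp_id // /scale => /andP[_ h].
have : 2 ^+ s * u <= 2 ^+ s * z by rewrite ler_wpM2l // exprn_ge0.
lra.
Qed.

Lemma measurable_super_scaled r a : (2 <= r)%N ->
  measurable_fun [set: R] (fun y => super r a (y / (2 * pi))).
Proof.
move=> r2; apply: (measurableT_comp (measurable_super a r2)).
exact: (measurable_funM (@measurable_id _ _ setT) (measurable_cst _)).
Qed.

Lemma measurable_atom_scaled r s : (2 <= r)%N ->
  measurable_fun [set: R] (fun y => atom r s (y / (2 * pi))).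
Proof.
move=> r2; have [mF _ _] := @bounded_periodic_atom R r s r2.
apply: (measurableT_comp mF).
exact: (measurable_funM (@measurable_id _ _ setT) (measurable_cst _)).
Qed.

Lemma integral_atom_scaled_le r s : (2 <= r)%N ->
  (\int[leb]_(y in `[0%R, (2 * pi)%R]) (atom r s (y / (2 * pi)))%:E <= (pi * 2 ^- s)%:E)%E.
Proof.
move=> r2; have p0 := @twopi_gt0 R; have w0 := @scale_gt0 R s.
have p1 : 2 * pi != 0 :> R by rewrite gt_eqF.
have w1 : scale s != 0 :> R by rewrite gt_eqF.
pose D : set R := `[0%R, 2 * (2 * pi) / scale s]%classic.
have -> : (pi * 2 ^- s)%:E = leb D.
  rewrite /D lebesgue_measure_itv /= lte_fin divr_gt0 ?mulr_gt0 ?pi_gt0 // sube0.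
  congr (_%:E); rewrite /scale; field; by rewrite expf_neq0 // pnatr_eq0.
apply: (@le_trans _ _ (\int[leb]_(y in `[0%R, (2 * pi)%R]) (\1_D y)%:E)%E).
  apply: le_integral_ge0 => y; rewrite /= in_itv /= => /andP[y0 y1].
    by rewrite lee_fin atom_ge0.
  have [->|hs] := eqVneq (atom r s (y / (2 * pi))) 0; first by rewrite lee_fin.
  suff Dy : D y by rewrite lee_fin indicE mem_set // atom_le1.
  rewrite /D /= in_itv /= y0 /=.
  have := atom_neq0 hs.
  move: y1; rewrite le_eqVlt => /predU1P[->|y1].
    have -> : fracp (2 * pi / (2 * pi)) = 0 :> R.
      have := @fracpD R 0 1; rewrite add0r divff // => ->.
      by rewrite fracp_id ?lexx ?ltr01.
    by rewrite mulr0 ltNge ler01.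
  rewrite fracp_id ?divr_ge0 ?(ltW p0) //= ?ltr_pdivrMr ?mul1r // => /andP[_].
  by rewrite mulrA ltr_pdivrMr // => /ltW h; rewrite ler_pdivlMr // mulrC.
rewrite integral_indic //; last exact: measurable_itv.
apply: le_measure; rewrite ?inE; [|exact: measurable_itv|exact: subIsetl].
by apply: measurableI; exact: measurable_itv.
Qed.

Lemma integral_super_scaled_lt r a (A eta : R) : (2 <= r)%N -> (forall s, 0 <= a s) ->
  eta < 1 -> (forall s, a s <= A * p2 (eta * s%:R)) ->
  (\int[leb]_(y in `[0%R, (2 * pi)%R]) (super r a (y / (2 * pi)))%:E < +oo)%E.
Proof.
move=> r2 a0 e1 hA; have A0 : 0 <= A.
  by have := le_trans (a0 0%N) (hA 0%N); rewrite mulr0 p20 mulr1.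
under eq_integral do rewrite superEF.
have d0 : 0 < 1 - eta by rewrite subr_gt0.
have [C C0 hC] := geometric_sum_le d0.
rewrite integral_nneseries //; last 2 first.
- move=> s; apply: measurable_funTS; apply/measurable_EFinP.
  exact: (measurable_funM (measurable_cst _) (measurable_atom_scaled s r2)).
- by move=> s y _; rewrite lee_fin mulr_ge0 // atom_ge0.
apply: (@le_lt_trans _ _ (A * pi * C)%:E); last exact: ltry.
apply: (@le_trans _ _ (\sum_(s <oo) (A * pi * p2 (- ((1 - eta) * `|s%:R - 0%:R|)))%:E)%E).
  apply: lee_nneseries => [s _ _|s _].
    by apply: integral_ge0 => y _; rewrite lee_fin mulr_ge0 // atom_ge0.
  under eq_integral do rewrite EFinM.
  rewrite ge0_integralZl_EFin //; last 2 first.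
  - by move=> y _; rewrite lee_fin atom_ge0.
  - by apply: measurable_funTS; apply/measurable_EFinP; exact: measurable_atom_scaled.
  apply: (le_trans (lee_wpmul2l _ (integral_atom_scaled_le s r2))); first by rewrite lee_fin.
  rewrite -EFinM lee_fin subr0 normr_nat.
  have -> : - ((1 - eta) * s%:R) = eta * s%:R + - s%:R by ring.
  rewrite p2D p2N p2_nat.
  have h : 0 <= pi * 2 ^- s :> R by rewrite mulr_ge0 ?pi_ge0 // invr_ge0 exprn_ge0.
  have := ler_wpM2r h (hA s); lra.
apply: le_nneseries_bound => [s|N].
  by rewrite !mulr_ge0 ?pi_ge0 // ltW // p2_gt0.
by rewrite -mulr_sumr ler_wpM2l // mulr_ge0 // pi_ge0.
Qed.

(** The hypothesis gam + e > 0 leaves room for a small power that absorbs the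
    logarithmic factor. *)
Lemma spike_rate (gam lam e : R) : 0 < e -> 0 < gam + e ->
  exists A eta : R, [/\ 0 < A, 0 <= eta, eta < e &
    forall s, p2 (- (gam * s%:R)) * slow lam s <= A * p2 (eta * s%:R)].
Proof.
move=> e0 ge0; pose d := Num.min e (gam + e) / 2.
have [d0 [d1 d2]] : 0 < d /\ d < e /\ 2 * d <= gam + e.
  rewrite /d; set M := Num.min _ _.
  have M0 : 0 < M by rewrite !lt_min e0.
  have [] : M <= e /\ M <= gam + e by split; rewrite !ge_min lexx ?orbT.
  by move=> *; do !split; lra.
have [C C0 hC] := slow_comparable lam d0.
exists (C * slow lam 0), (e - d); split; [|lra|lra|].
  by rewrite mulr_gt0 // slow_gt0.
move=> s; have := hC s 0%N; rewrite subr0 normr_nat => {}hC.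
apply: (le_trans (ler_wpM2l (ltW (p2_gt0 _)) hC)); rewrite mulrCA.
rewrite ler_wpM2l ?(ltW (mulr_gt0 C0 (slow_gt0 _ _))) // -p2D p2_le //.
have s0 : 0 <= s%:R :> R by [].
have h : 0 <= gam + e - 2 * d by lra.
have := mulr_ge0 h s0; lra.
Qed.

Section testfun.
Context {m : nat}.
Implicit Types (x : m.-tuple R) (c : 'I_m -> R).

Lemma testfunE r (b : 'I_m -> nat -> R) c x :
  testfun r b c [tuple 2 * pi * tnth x i | i < m] =
  tensor (fun j z => super r (b j) z - c j) x.
Proof.
rewrite /testfun /tensor; apply: eq_bigr => j _; rewrite tnth_mktuple.
by rewrite mulrAC divff ?mul1r // gt_eqF // twopi_gt0.
Qed.

Lemma testfun_periodic r (b : 'I_m -> nat -> R) c j x :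
  testfun r b c (translate j (2 * pi) x) = testfun r b c x.
Proof.
rewrite /testfun /tensor; apply: eq_bigr => i _; rewrite tnth_mktuple mulrDl.
rewrite mulfK; last by rewrite gt_eqF // twopi_gt0.
by have := @per1_super R r (b i) (tnth x i / (2 * pi)) (Posz (i == j)) => ->.
Qed.

Lemma measurable_testfun r (b : 'I_m -> nat -> R) c : (2 <= r)%N ->
  measurable_fun [set: m.-tuple (measurableTypeR R)] (testfun r b c).
Proof.
move=> r2; apply/measurable_EFinP.
have -> : EFin \o testfun r b c =
    (fun x => \prod_(j < m) (super r (b j) (tnth x j / (2 * pi)) - c j)%:E)%E.
  by apply/funext => x /=; rewrite prodEFin.
apply: (@measurable_prod_tnth R m (fun j y => (super r (b j) (y / (2 * pi)) - c j)%:E)) => j.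
apply/measurable_EFinP; apply: measurable_funB; last exact: measurable_cst.
exact: measurable_super_scaled.
Qed.

(** Away from [0, u/m[ the superposition grows at most like a power
    of 1/u with exponent eta < 1/q, which the weight of the norm compensates. *)
Lemma lorentz_norm_testfun_lt (j0 : 'I_m) (gam lam q T : R) r c : 0 < q -> 0 < T -> 0 < gam + q^-1 ->
  (lorentz_norm q T (testfun r (spike j0 gam lam) c) < +oo)%E.
Proof.
move=> q0 T0 g0; have m0 : (0 < m)%N := leq_ltn_trans (leq0n _) (ltn_ord j0).
have qi0 : 0 < q^-1 by rewrite invr_gt0.
have [A [eta [A0 eta0 eta1 hA]]] := spike_rate lam qi0 g0.
have [C C0 hC] := @lorentz_norm_le R m q T q0 T0.
have mR : 0 < m%:R :> R by rewrite ltr0n.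
pose K0 := A * (2 * m%:R) `^ eta + `|c j0|.
have K00 : 0 < K0 by rewrite ltr_wpDr // mulr_gt0 // powR_gt0 // mulr_gt0.
pose K := K0 * \prod_(j < m | j != j0) (1 + `|c j|).
have Kp : 0 < K.
  by rewrite mulr_gt0 // prodr_gt0 // => j _; rewrite ltr_wpDr.
have d0 : 0 < (q^-1 - eta) * T by rewrite mulr_gt0 // subr_gt0.
have [C3 C30 h3] := geometric_sum_le d0.
apply: (le_lt_trans (hC _ (fun i => K * p2 (- ((q^-1 - eta) * i%:R))) (K `^ T * C3) _ _ _)).
- by move=> i; rewrite mulr_ge0 ?p2_ge0 // ltW.
- move=> i u du; have u0 := dyadic_gt0 du.
  pose sg j := if j == j0 then K0 * p2 (eta * i%:R) else 1 + `|c j|.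
  have -> : K * p2 (- ((q^-1 - eta) * i%:R)) * p2 (i%:R / q) = \prod_j sg j.
    rewrite (bigD1 j0) //= /sg eqxx (eq_bigr (fun j => 1 + `|c j|)); last first.
      by move=> j /negbTE ->.
    rewrite /K -mulrA -p2D (_ : - ((q^-1 - eta) * i%:R) + i%:R / q = eta * i%:R); last by ring.
    by rewrite mulrAC.
  apply: (@rearrangement_prod_le R m _ (fun j z => super r (spike j0 gam lam j) z - c j)
      sg (fun=> `[0%R, u / m%:R[%classic)) => //.
  + by move=> x _; exact: testfunE.
  + move=> j; rewrite /sg; case: ifP => _; first by rewrite mulr_ge0 ?p2_ge0 // ltW.
    by rewrite addr_ge0.
  + by move=> j; rewrite lebesgue_measure_itv /= lte_fin divr_gt0 // sube0.
  move=> j z z01; rewrite /= in_itv /= => hz; have /andP[z0 z1] := z01; rewrite z0 /= ltNge.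
  apply/negP => uz; move: hz; apply/negP; rewrite -leNgt.
  have S0 := @super_ge0 R r (spike j0 gam lam j) z (spike_ge0 j0 gam lam j).
  apply: (le_trans (ler_normB _ _)); rewrite ger0_norm // /sg; case: eqVneq => [->|jj0].
    have E1 : 1 <= p2 (eta * i%:R) by rewrite p2_ge1 // mulr_ge0.
    rewrite /K0 mulrDl lerD //; last by rewrite ler_peMr.
    have X0 : 0 <= A * (2 * m%:R) `^ eta * p2 (eta * i%:R).
      by rewrite !mulr_ge0 ?powR_ge0 ?p2_ge0 // ltW.
    apply: (@super_le_cutoff r _ _ (u / m%:R)) => //; first exact: spike_ge0.
    move=> s hs; rewrite /spike eqxx (le_trans (hA s)) // -mulrA ler_wpM2l ?(ltW A0) //.
    rewrite ![eta * _]mulrC -!p2_powR -powRM ?p2_ge0 ?mulr_ge0 ?(ltW mR) //.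
    rewrite ge0_ler_powR ?nnegrE ?p2_ge0 ?mulr_ge0 ?p2_ge0 ?(ltW mR) //.
    have [_ h] := dyadic_comparable du; rewrite p2N p2_nat in h.
    rewrite !p2_nat; move: hs; rewrite mulrA ler_pdivrMr // mul1r => hs.
    have i0 : 0 < 2 ^+ i :> R by rewrite exprn_gt0.
    have h' : 1 <= 2 * u * 2 ^+ i by rewrite -ler_pdivrMr // mul1r.
    have s0 : 0 <= 2 ^+ s :> R by rewrite exprn_ge0.
    apply: (@le_trans _ _ (2 ^+ s * (2 * u * 2 ^+ i))); first by rewrite ler_peMr.
    by have := ler_wpM2r (mulr_ge0 (ler0n R 2) (ltW i0)) hs; lra.
  rewrite lerD2r.
  apply: (@super_le_cutoff r _ _ 0) => //; first exact: spike_ge0.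
  by move=> s _; rewrite /spike (negbTE jj0) lern1; case: (s == 0)%N.
- move=> N; under eq_bigr do rewrite powRM ?(ltW Kp) ?p2_ge0 // p2_powR.
  rewrite -mulr_sumr ler_wpM2l ?powR_ge0 // (le_trans _ (h3 0%N N)) //.
  apply: ler_sum => i _; rewrite subr0 normr_nat le_eqVlt; apply/orP; left; apply/eqP.
  congr p2; ring.
exact: ltry.
Qed.

Definition mean r a : R :=
  fine (\int[leb]_(y in `[0%R, (2 * pi)%R]) (super r a (y / (2 * pi)))%:E)%E / (2 * pi).

Lemma integral_centered_super r a (K : R) : (2 <= r)%N -> (forall s, 0 <= a s) ->
  (\int[leb]_(y in `[0%R, (2 * pi)%R]) (super r a (y / (2 * pi)))%:E < +oo)%E ->
  (\int[leb]_(y in `[0%R, (2 * pi)%R])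
    ((super r a (y / (2 * pi)) - mean r a) * K)%:E = 0)%E.
Proof.
move=> r2 a0 fI; have p0 := @twopi_gt0 R.
set D : set R := `[0%R, (2 * pi)%R]%classic.
have mD : measurable D by exact: measurable_itv.
have muD : leb D = (2 * pi)%:E.
  by rewrite /D lebesgue_measure_itv /= lte_fin p0 sube0.
have S0 y : 0 <= super r a (y / (2 * pi)) by exact: super_ge0.
have iS : leb.-integrable D (fun y => (super r a (y / (2 * pi)))%:E).
  apply/integrableP; split.
    by apply: measurable_funTS; apply/measurable_EFinP; exact: measurable_super_scaled.
  by under eq_integral do rewrite gee0_abs ?lee_fin //.
have ic : leb.-integrable D (fun=> (mean r a)%:E).
  apply/integrableP; split; first exact: measurable_cst.
  by under eq_integral do rewrite abse_EFin; rewrite integral_cst // -[X in (_ * X)%E]/(leb D) muD -EFinM ltry.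
under eq_integral do rewrite mulrC EFinM EFinB.
rewrite integralZl //; last exact: integrableB.
rewrite integralB // integral_cst // -[X in (_ - _ * X)%E]/(leb D) muD.
set I := (\int[leb]_(y in D) _)%E in fI *.
have Ifin : I \is a fin_num.
  by rewrite ge0_fin_numE //; apply: integral_ge0 => y _; rewrite lee_fin.
have -> : I = (mean r a * (2 * pi))%:E by rewrite /mean -/D -/I divfK ?gt_eqF // fineK.
have -> : ((mean r a)%:E * (2 * pi)%:E = (mean r a * (2 * pi))%:E)%E by [].
have -> : forall z : R, (z%:E - z%:E = 0)%E by move=> z; rewrite -EFinB subrr.
by rewrite mule0.
Qed.

(** The means vanish for every x, since every factor of the tensor product
    has mean zero. *)
Lemma lorentz0_testfun (j0 : 'I_m) (gam lam q T : R) r : (2 <= r)%N -> 1 < q -> 0 < T ->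
  0 < gam + q^-1 ->
  lorentz0 q T (testfun r (spike j0 gam lam) (fun j => mean r (spike j0 gam lam j))).
Proof.
move=> r2 q1 T0 g0; have q0 : 0 < q by rewrite (lt_trans ltr01).
have qi0 : 0 < q^-1 by rewrite invr_gt0.
have qi1 : q^-1 < 1 by rewrite invf_lt1.
split; first split.
- exact: measurable_testfun.
- by move=> j x; exact: testfun_periodic.
- exact: lorentz_norm_testfun_lt.
move=> j; apply: aeW => x.
pose K := \prod_(i < m | i != j)
  (super r (spike j0 gam lam i) (tnth x i / (2 * pi)) - mean r (spike j0 gam lam i)).
transitivity (\int[leb]_(y in `[0%R, (2 * pi)%R])
    ((super r (spike j0 gam lam j) (y / (2 * pi)) - mean r (spike j0 gam lam j)) * K)%:E)%E.
  apply: eq_integral => y _; congr (_%:E); rewrite /testfun /tensor (bigD1 j) //=.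
  rewrite tnth_mktuple eqxx; congr (_ * _); apply: eq_bigr => i ij.
  by rewrite tnth_mktuple (negbTE ij).
apply: integral_centered_super => //; first exact: spike_ge0.
have [A [eta [A0 _ eta1 hA]]] := spike_rate lam qi0 g0.
have [jj0|jj0] := eqVneq j j0.
  apply: (@integral_super_scaled_lt _ _ A eta) => //; first exact: spike_ge0.
  - exact: lt_trans qi1.
  - by move=> s; rewrite /spike jj0 eqxx.
apply: (@integral_super_scaled_lt _ _ 1 0) => //; first exact: spike_ge0.
by move=> s; rewrite /spike (negbTE jj0) mul0r p20 mulr1 lern1; case: (s == 0)%N.
Qed.

End testfun.
End membership.

(** * Integrals over the cube *)

Section cube_integrals.
Context {R : realType}.
Local Notation leb := (@lebesgue_measure R).

Lemma dstep_ge0 (b : nat -> R) u : (forall i, 0 <= b i) -> (0 <= dstep b u)%E.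
Proof. by move=> b0; apply: nneseries_ge0 => i _ _; rewrite lee_fin mulr_ge0. Qed.

Lemma dstep_eq0 (b : nat -> R) u : ~~ (0 < u < 1) -> dstep b u = 0%E.
Proof.
move=> hu; apply: eseries0 => i _ _; rewrite indicE memNset ?mulr0 // => /dyadic_sub.
by rewrite /= in_itv /=; apply/negP.
Qed.

Lemma measurable_dstep (b : nat -> R) : (forall i, 0 <= b i) -> measurable_fun [set: R] (dstep b).
Proof.
move=> b0; apply: ge0_emeasurable_sum => [i u _ _|i _].
  by rewrite lee_fin mulr_ge0.
apply/measurable_EFinP.
exact: (measurable_funM (measurable_cst _) (measurable_indic (measurable_dyadic i))).
Qed.

Lemma integral_dstepT (b : nat -> R) : (forall i, 0 <= b i) ->
  (\int[leb]_u dstep b u = \sum_(i <oo) (b i * 2 ^- i.+1)%:E)%E.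
Proof.
move=> b0; rewrite -integral_dstep // [RHS]integral_mkcond; congr (integral _ _ _).
apply/funext => u; rewrite /patch; case: ifPn => // hu; rewrite dstep_eq0 //.
by apply: contra hu => hu; rewrite inE /= in_itv.
Qed.

Context {m : nat}.
Implicit Types (b : 'I_m -> nat -> R) (t : m.-tuple R).
Local Notation mu := (@lebesgue_tuple R m).

Lemma cube_dyadic t : open_unit_cube t -> exists n : 'I_m -> nat, forall j, dyadic (n j) (tnth t j).
Proof.
move=> ct; have /choice [n hn] : forall j, exists i, dyadic i (tnth t j).
  by move=> j; apply: dyadic_exists; exact: ct.
by exists n.
Qed.

Lemma dyadic_cube t (n : 'I_m -> nat) : (forall j, dyadic (n j) (tnth t j)) -> open_unit_cube t.
Proof. by move=> h j; have /dyadic_sub := h j; rewrite /= in_itv. Qed.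

Lemma integral_prod_dstep b : (forall j i, 0 <= b j i) ->
  (\int[mu]_t (\prod_(j < m) dstep (b j) (tnth t j)) =
   \prod_(j < m) \sum_(i <oo) (b j i * 2 ^- i.+1)%:E)%E.
Proof.
move=> b0; rewrite (integral_lebesgue_tuple_prod (F := fun j => dstep (b j))).
- by apply: eq_bigr => j _; rewrite integral_dstepT.
- by move=> j; exact: measurable_dstep.
- by move=> j u; exact: dstep_ge0.
Qed.

Lemma prod_dstepE b t (n : 'I_m -> nat) : (forall j, dyadic (n j) (tnth t j)) ->
  (\prod_(j < m) dstep (b j) (tnth t j) = (\prod_j b j (n j))%:E)%E.
Proof.
by move=> hn; rewrite -prodEFin; apply: eq_bigr => j _; rewrite (dstepE _ (hn j)).
Qed.

(** Dominating by a tensor product of dyadic step functions reduces the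
    integral over the cube to one-dimensional series. *)
Lemma integral_cube_le (Phi : m.-tuple R -> \bar R) b : (forall j i, 0 <= b j i) ->
  (forall t, open_unit_cube t -> (0 <= Phi t)%E) ->
  (forall t (n : 'I_m -> nat), (forall j, dyadic (n j) (tnth t j)) ->
     (Phi t <= (\prod_j b j (n j))%:E)%E) ->
  (\int[mu]_(t in @open_unit_cube R m) Phi t <= \prod_(j < m) \sum_(i <oo) (b j i * 2 ^- i.+1)%:E)%E.
Proof.
move=> b0 P0 hP; rewrite -integral_prod_dstep // [leLHS]integral_mkcond.
apply: le_integral_ge0 => t _; rewrite /patch; case: ifPn => // ht.
    by apply: P0; rewrite inE in ht.
  rewrite inE in ht; have [n hn] := cube_dyadic ht; rewrite (prod_dstepE _ hn); exact: hP.
by apply: ge0_prode => j; exact: dstep_ge0.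
Qed.

Lemma integral_cube_ge (Phi : m.-tuple R -> \bar R) b : (forall j i, 0 <= b j i) ->
  (forall t (n : 'I_m -> nat), (forall j, dyadic (n j) (tnth t j)) ->
     ((\prod_j b j (n j))%:E <= Phi t)%E) ->
  (\prod_(j < m) \sum_(i <oo) (b j i * 2 ^- i.+1)%:E <= \int[mu]_(t in @open_unit_cube R m) Phi t)%E.
Proof.
move=> b0 hP; rewrite -integral_prod_dstep // [leRHS]integral_mkcond.
apply: le_integral_ge0 => t _.
  by apply: ge0_prode => j; exact: dstep_ge0.
rewrite /patch; case: ifPn => ht.
  rewrite inE in ht; have [n hn] := cube_dyadic ht; rewrite (prod_dstepE _ hn); exact: hP.
have [j hj] : exists j, ~ (0 < tnth t j < 1).
  by apply/existsNP => h; move: ht; rewrite notin_setE; apply=> j; exact: h.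
by rewrite (bigD1 j) //= dstep_eq0 ?mul0e //; apply/negP.
Qed.

Lemma prode_lt_pinfty (I : finType) (F : I -> \bar R) :
  (forall i, (0 <= F i)%E) -> (forall i, (F i < +oo)%E) -> (\prod_i F i < +oo)%E.
Proof.
move=> F0 Foo; suff : (0 <= \prod_i F i < +oo)%E by case/andP.
elim/big_ind: _ => [|x y /andP[x0 xoo] /andP[y0 yoo]|i _]; first by rewrite lee01 ltry.
  by rewrite mule_ge0 //= lte_mul_pinfty // ge0_fin_numE.
by rewrite F0 Foo.
Qed.

Lemma prode_eq_pinfty (I : finType) (i0 : I) (F : I -> \bar R) :
  F i0 = +oo%E -> (forall i, i != i0 -> (0 < F i)%E) -> (\prod_i F i = +oo)%E.
Proof.
move=> Foo F0; rewrite (bigD1 i0) //= Foo gt0_mulye //.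
by elim/big_ind: _ => // x y x0 y0; exact: mule_gt0.
Qed.

Lemma nneseries_eq_pinfty (v : nat -> R) : (forall i, 0 <= v i) ->
  (forall M, exists N, M <= \sum_(0 <= i < N) v i) -> (\sum_(i <oo) (v i)%:E = +oo)%E.
Proof.
move=> v0 hv; apply/eqyP => M M0; have [N hN] := hv M.
apply: (@le_trans _ _ (\sum_(0 <= i < N) (v i)%:E)%E); first by rewrite sumEFin lee_fin.
by apply: nneseries_lim_ge => i _ _; rewrite lee_fin.
Qed.

(** The discrete form of the convergence of the integral of
    t^(del-1) (1 - log t)^e over (0,1). *)
Lemma dyadic_profile_bounded (del e : R) : 0 < del \/ (del = 0 /\ e < -1) ->
  exists2 C, 0 < C & forall N, \sum_(0 <= i < N) p2 (- (del * i%:R)) * i.+1%:R `^ e <= C.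
Proof.
case=> [d0|[-> e1]].
  have [C C0 hC] := slow_sum_le (- e) d0.
  exists (C * slow (- e) 0); first by rewrite mulr_gt0 // slow_gt0.
  move=> N; apply: (le_trans _ (hC 0%N N)); apply: ler_sum => i _.
  by rewrite subr0 normr_nat /slow opprK mulrC.
have [C C0 hC] := sum_powR_bounded e1; exists C => // N.
apply: (le_trans _ (hC N)); apply: ler_sum => i _.
by rewrite mul0r oppr0 p20 mul1r.
Qed.

Lemma powR_unbounded (y M : R) : 0 < y -> exists2 N, (0 < N)%N & forall n, (N <= n)%N -> M <= n%:R `^ y.
Proof.
move=> y0; have [N hN] := exists_nat_ge (Num.max 0 M `^ y^-1).
exists N.+1 => // n Nn; apply: (@le_trans _ _ (Num.max 0 M)).
  by rewrite le_max lexx orbT.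
have M0 : 0 <= Num.max 0 M by rewrite le_max lexx.
have -> : Num.max 0 M = (Num.max 0 M `^ y^-1) `^ y.
  by rewrite -powRrM mulVf ?gt_eqF // powRr1.
rewrite ge0_ler_powR ?nnegrE ?powR_ge0 ?(ltW y0) //.
by rewrite (le_trans hN) // ler_nat ltnW.
Qed.

(** The divergent case e > -1, with finitely many terms removed. *)
Lemma sum_powR_unbounded (e : R) n0 M : -1 < e ->
  exists N, M <= \sum_(0 <= i < N) (if (n0 <= i)%N then i.+1%:R `^ e else 0).
Proof.
move=> e1; have [c c0 hc] := @sum_powR_ge R e.
pose S := \sum_(0 <= i < n0) i.+1%:R `^ e : R.
have y0 : 0 < 1 + e by lra.
have [N N0 hN] := powR_unbounded ((M + S) / c) y0.
have NN : (N <= N + n0)%N by exact: leq_addr.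
exists (N + n0)%N.
have h1 : M + S <= \sum_(0 <= i < N + n0) i.+1%:R `^ e.
  apply: (le_trans _ (hc _ (leq_trans N0 NN))).
  by rewrite -ler_pdivrMl // mulrC hN.
rewrite (big_cat_nat _ (leq_addl N n0)) //= -/S in h1.
rewrite (big_cat_nat _ (leq_addl N n0)) //= -lerBlDl.
rewrite [X in M - X]big_nat_cond [X in M - X]big1; last first.
  by move=> i /andP[/andP[_ i0] _]; rewrite leqNgt i0.
rewrite subr0; apply: (@le_trans _ _ (\sum_(n0 <= i < N + n0) i.+1%:R `^ e)); first by lra.
by apply: ler_sum_nat => i /andP[-> _].
Qed.

Lemma weight_dyadic (c r : R) : exists2 K, 0 < K & forall (t : R) i, dyadic i t ->
  (1 - ln t) `^ c / t `^ r <= K * (p2 (r * i%:R) * i.+1%:R `^ c) /\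
  p2 (r * i%:R) * i.+1%:R `^ c <= K * ((1 - ln t) `^ c / t `^ r).
Proof.
exists (2 `^ `|c| * 2 `^ `|r|); first by rewrite mulr_gt0 ?powR_gt0.
move=> t i dt; have [a1 a2] := log_dyadic c dt; have [b1 b2] := powR_dyadic (- r) dt.
rewrite normrN mulNr opprK powRN in b1 b2.
have h1 := ler_pM (powR_ge0 _ _) (eq_ind_r (fun z => 0 <= z) (powR_ge0 t (- r)) (esym (powRN _ _))) a1 b1.
have h2 := ler_pM (powR_ge0 _ _) (p2_ge0 _) a2 b2.
split.
  by apply: (le_trans h1); rewrite le_eqVlt; apply/orP; left; apply/eqP; ring.
by rewrite mulrC; apply: (le_trans h2); rewrite le_eqVlt; apply/orP; left; apply/eqP; ring.
Qed.

End cube_integrals.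

(** * Smoothness seminorms *)

Section seminorms.
Context {R : realType} {m : nat}.
Implicit Types (f : m.-tuple R -> R) (t : m.-tuple R) (a b c k r : 'rV[R]_m).

Lemma lorentz_norm_ge0 (q T : R) f : (0 <= lorentz_norm q T f)%E.
Proof. exact: poweR_ge0. Qed.

Lemma mixed_modulus_ge0 (q T : R) k f t : (forall j, 0 < tnth t j) ->
  (0 <= mixed_modulus q T k f t)%E.
Proof.
move=> t0; have [h hE] : exists h : m.-tuple R, forall j, tnth h j = 0.
  by exists [tuple 0 | j < m] => j; rewrite tnth_mktuple.
apply: (le_trans (lorentz_norm_ge0 q T (mixed_difference k h f))).
by apply: ereal_sup_ubound; exists h => // j; rewrite hE normr0 ltW.
Qed.

Lemma ln_cube_gt0 (u : R) : 0 < u < 1 -> 0 < 1 - ln u.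
Proof. by move=> u01; rewrite subr_gt0 (lt_trans _ ltr01) // ln_lt0. Qed.

Lemma powR_prod (I : finType) (F : I -> R) e : (forall i, 0 <= F i) ->
  (\prod_i F i) `^ e = \prod_i (F i `^ e).
Proof.
move=> F0; suff [] : 0 <= \prod_i F i /\ (\prod_i F i) `^ e = \prod_i (F i `^ e) by [].
elim/big_rec2: _ => [|i x y _ [y0 e0]]; first by split=> //; rewrite powR1.
by split; [rewrite mulr_ge0|rewrite powRM // e0].
Qed.

(** The weights agree: the Lipschitz seminorm is the limiting case r = a
    of the Besov seminorm, in which the order of the modulus equals the
    smoothness. *)
Lemma log_lip_seminormE (q T : R) theta a b f :
  log_lip_seminorm q T theta a b f = besov_seminorm q T theta a (- b) a f.
Proof.
case: theta => [Q| |]; rewrite /log_lip_seminorm /besov_seminorm; last by [].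
  congr poweR; apply: eq_integral => t; rewrite inE => ct; congr (_ * _%:E)%E.
  rewrite powR_prod => [|j]; last by rewrite mulr_ge0 ?powR_ge0.
  rewrite -big_split /=; apply: eq_bigr => j _; rewrite mxE.
  have /andP[t0 t1] := ct j; have l0 := ln_cube_gt0 (ct j).
  rewrite powRM ?powR_ge0 // -!powRrM powRD ?(gt_eqF t0) ?implybT // powRr1 ?(ltW t0) //.
  rewrite invfM -powRN [- b 0 j * Q]mulrC mulNr [a 0 j * Q]mulrC.
  ring.
congr ereal_sup; apply: eq_imagel => t ct; congr (_ * _%:E)%E.
by apply: eq_bigr => j _; rewrite mxE.
Qed.

Lemma log_lipE (q T : R) theta a b :
  log_lip m q T theta a b = besov m q T theta a (- b) a.
Proof.
apply/seteqP; split => f [f0 hf]; split; try exact: f0.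
  by rewrite -log_lip_seminormE; exact: hf.
by rewrite log_lip_seminormE; exact: hf.
Qed.

(** In each coordinate either the modulus decays faster than the weight
    grows, or the powers balance and the logarithmic exponent decides. The
    convention 1/oo = 0 makes the same condition work for the supremum. *)
Lemma besov_seminorm_lt (q T : R) theta r c k f (D kap e : 'I_m -> R) :
  (0 < theta)%E -> (forall j, 0 <= D j) ->
  (forall t (n : 'I_m -> nat), (forall j, dyadic (n j) (tnth t j)) ->
    (mixed_modulus q T k f t <=
      (\prod_j (D j * (p2 (- (kap j * (n j)%:R)) * (n j).+1%:R `^ e j)))%:E)%E) ->
  (forall j, r 0 j < kap j \/ (kap j = r 0 j /\ e j + c 0 j < - fine theta^-1%E)) ->
  (besov_seminorm q T theta r c k f < +oo)%E.
Proof.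
pose A (n : 'I_m -> nat) := \prod_j (D j * (p2 (- (kap j * (n j)%:R)) * (n j).+1%:R `^ e j)).
move=> theta0 D0 hom hk.
have A0 n : 0 <= A n.
  by apply: prodr_ge0 => j _; rewrite mulr_ge0 // mulr_ge0 ?p2_ge0 ?powR_ge0.
case: theta theta0 hk => [Q| |] // Q0 hk /=.
- rewrite lte_fin in Q0; rewrite fine_invr in hk.
  apply: poweR_lty.
  have /choice [K hK] : forall j, exists K : R, 0 < K /\ forall (t : R) (i : nat), dyadic i t ->
      (1 - ln t) `^ (Q * c 0 j) / t `^ (1 + Q * r 0 j) <=
      K * (p2 ((1 + Q * r 0 j) * i%:R) * i.+1%:R `^ (Q * c 0 j)).
    move=> j; have [K K0 hK] := weight_dyadic (Q * c 0 j) (1 + Q * r 0 j).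
    by exists K; split => // t i dt; have [] := hK t i dt.
  have E0 j : 0 <= D j `^ Q * K j by rewrite mulr_ge0 ?powR_ge0 // ltW // (hK j).1.
  pose b j i := D j `^ Q * K j * (p2 ((1 - Q * (kap j - r 0 j)) * i%:R) * i.+1%:R `^ (Q * (e j + c 0 j))).
  have b0 j i : 0 <= b j i by rewrite mulr_ge0 // mulr_ge0 ?powR_ge0 ?p2_ge0.
  apply: (@le_lt_trans _ _ (\prod_(j < m) \sum_(i <oo) (b j i * 2 ^- i.+1)%:E)%E); last first.
    apply: prode_lt_pinfty => j.
      by apply: nneseries_ge0 => i _ _; rewrite lee_fin mulr_ge0 // invr_ge0 exprn_ge0.
    have [S S0 hS] : exists2 S : R, 0 < S & forall N, \sum_(0 <= i < N)
        p2 (- (Q * (kap j - r 0 j) * i%:R)) * i.+1%:R `^ (Q * (e j + c 0 j)) <= S.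
      apply: dyadic_profile_bounded; case: (hk j) => [h|[-> h]].
        by left; rewrite mulr_gt0 // subr_gt0.
      by right; rewrite subrr mulr0; split => //; rewrite -ltr_pdivlMl // mulrN1.
    apply: (@le_lt_trans _ _ (D j `^ Q * K j * S)%:E); last exact: ltry.
    apply: le_nneseries_bound => [i|N]; first by rewrite mulr_ge0 // invr_ge0 exprn_ge0.
    apply: (@le_trans _ _ (D j `^ Q * K j * \sum_(0 <= i < N)
        p2 (- (Q * (kap j - r 0 j) * i%:R)) * i.+1%:R `^ (Q * (e j + c 0 j)))); last first.
      by rewrite ler_wpM2l.
    rewrite mulr_sumr; apply: ler_sum => i _; rewrite /b -mulrA ler_wpM2l //.
    rewrite mulrAC ler_wpM2r ?powR_ge0 // -p2_nat -p2N -p2D p2_le //.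
    rewrite -[i.+1%:R]natr1; lra.
  apply: integral_cube_le => // [t ct|t n dn].
    rewrite mule_ge0 ?poweR_ge0 // lee_fin prodr_ge0 // => j _.
    by rewrite divr_ge0 ?powR_ge0.
  have t0 j : 0 < tnth t j := dyadic_gt0 (dn j).
  set P := \prod_j (_ / _).
  have P0 : 0 <= P by rewrite prodr_ge0 // => j _; rewrite divr_ge0 ?powR_ge0.
  apply: (@le_trans _ _ (A n `^ Q * P)%:E).
    rewrite EFinM lee_wpmul2r ?lee_fin // -poweR_EFin.
    by apply: poweR_le; [exact: ltW|exact: mixed_modulus_ge0|exact: hom].
  rewrite lee_fin powR_prod => [|j]; last by rewrite mulr_ge0 // mulr_ge0 ?p2_ge0 ?powR_ge0.
  rewrite /P -!big_split /=; apply: ler_prod => j _.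
  rewrite !mulr_ge0 ?invr_ge0 ?powR_ge0 //=.
  have {hK}[K0 hK] := hK j; have {}hK := hK _ _ (dn j).
  rewrite powRM ?mulr_ge0 ?p2_ge0 ?powR_ge0 // powRM ?p2_ge0 ?powR_ge0 // p2_powR -powRrM.
  rewrite /b -!mulrA ler_wpM2l ?powR_ge0 // mulrA.
  apply: (le_trans (ler_wpM2l _ hK)).
    by rewrite mulr_ge0 ?p2_ge0 ?powR_ge0.
  have n1 : (n j).+1%:R != 0 :> R by [].
  rewrite [Q * (e j + _)]mulrDr powRD ?n1 ?implybT // [e j * Q]mulrC.
  have -> : p2 ((1 - Q * (kap j - r 0 j)) * (n j)%:R) =
    p2 (- (kap j * (n j)%:R) * Q) * p2 ((1 + Q * r 0 j) * (n j)%:R).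
    by rewrite -p2D; congr p2; ring.
  by rewrite le_eqVlt; apply/orP; left; apply/eqP; ring.
rewrite invey /= oppr0 in hk.
have /choice [K hK] : forall j, exists K : R, 0 < K /\ forall (t : R) (i : nat), dyadic i t ->
    t `^ (- r 0 j) * (1 - ln t) `^ c 0 j <=
    K * (p2 (r 0 j * i%:R) * i.+1%:R `^ c 0 j).
  move=> j; have [K K0 hK] := weight_dyadic (c 0 j) (r 0 j).
  by exists K; split => // t i dt; rewrite mulrC powRN; have [] := hK t i dt.
have /choice [S hS] : forall j, exists S : R, forall i,
    p2 (- ((kap j - r 0 j) * i%:R)) * i.+1%:R `^ (e j + c 0 j) <= S.
  move=> j; case: (hk j) => [h|[-> h]].
    have kr0 : 0 < kap j - r 0 j by rewrite subr_gt0.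
    have [S S0 hS] := dyadic_profile_bounded (e := e j + c 0 j) (or_introl kr0).
    exists S => i; apply: (le_trans _ (hS i.+1)); rewrite big_nat_recr //= lerDr.
    by apply: sumr_ge0 => l _; rewrite mulr_ge0 ?p2_ge0 ?powR_ge0.
  exists 1 => i; rewrite subrr mul0r oppr0 p20 mul1r.
  rewrite -[leRHS](powRr0 i.+1%:R) ler_powR ?ler1n // ltW //.
have S0 j : 0 <= S j by apply: (le_trans _ (hS j 0%N)); rewrite mulr_ge0 ?p2_ge0 ?powR_ge0.
apply: (@le_lt_trans _ _ (\prod_j (D j * K j * S j))%:E); last exact: ltry.
apply: ub_ereal_sup => _ [t ct <-]; have [n dn] := cube_dyadic ct.
have t0 j : 0 < tnth t j := dyadic_gt0 (dn j).
set P := \prod_j (tnth t j `^ _ * _).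
have P0 : 0 <= P by rewrite prodr_ge0 // => j _; rewrite mulr_ge0 ?powR_ge0.
apply: (@le_trans _ _ (A n * P)%:E).
  by rewrite EFinM lee_wpmul2r ?lee_fin // hom.
rewrite lee_fin /A /P -!big_split /=; apply: ler_prod => j _.
have [K0 {}hK] := hK j; have {}hK := hK _ _ (dn j).
apply/andP; split; first by rewrite !mulr_ge0 ?p2_ge0 ?powR_ge0.
rewrite -!mulrA ler_wpM2l // mulrA.
apply: (le_trans (ler_wpM2l _ hK)); first by rewrite mulr_ge0 ?p2_ge0 ?powR_ge0.
have {}hS := ler_wpM2l (ltW K0) (hS j (n j)).
apply: (le_trans _ hS).
have n1 : (n j).+1%:R != 0 :> R by [].
rewrite powRD ?n1 ?implybT //.
have -> : p2 (- ((kap j - r 0 j) * (n j)%:R)) =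
    p2 (- (kap j * (n j)%:R)) * p2 (r 0 j * (n j)%:R).
  by rewrite -p2D; congr p2; ring.
by rewrite le_eqVlt; apply/orP; left; apply/eqP; ring.
Qed.

(** Only the coordinate j0 is responsible for the divergence; the others
    are confined to [1/2, 1[, the dyadic interval of index 0. *)
Lemma besov_seminorm_pinfty (j0 : 'I_m) (q T : R) theta r c k f (cc e : R) n0 :
  (0 < theta)%E -> 0 < cc ->
  (forall t n, open_unit_cube t -> dyadic n (tnth t j0) -> (n0 <= n)%N ->
    (forall j, j != j0 -> 2^-1 <= tnth t j) ->
    ((cc * (p2 (- (r 0 j0 * n%:R)) * n.+1%:R `^ e))%:E <= mixed_modulus q T k f t)%E) ->
  - fine theta^-1%E < e + c 0 j0 ->
  (besov_seminorm q T theta r c k f = +oo)%E.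
Proof.
case: theta => [Q| |] // Q0 cc0 hom he /=.
- rewrite lte_fin in Q0; rewrite fine_invr in he.
  have /choice [K hK] : forall j, exists K : R, 0 < K /\ forall (t : R) (i : nat), dyadic i t ->
      p2 ((1 + Q * r 0 j) * i%:R) * i.+1%:R `^ (Q * c 0 j) <=
      K * ((1 - ln t) `^ (Q * c 0 j) / t `^ (1 + Q * r 0 j)).
    move=> j; have [K K0 hK] := weight_dyadic (Q * c 0 j) (1 + Q * r 0 j).
    by exists K; split => // t i dt; have [] := hK t i dt.
  rewrite eqy_poweR ?invr_gt0 //.
  pose b j i := if j == j0 then
      (if (n0 <= i)%N then cc `^ Q / K j * (p2 i%:R * i.+1%:R `^ (Q * (e + c 0 j))) else 0)
    else (if i == 0%N then (K j)^-1 else 0).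
  have K0 j : 0 < K j by have [] := hK j.
  have b0 j i : 0 <= b j i.
    rewrite /b; case: ifP => _; case: ifP => _ //; last by rewrite invr_ge0 ltW.
    by rewrite !mulr_ge0 ?powR_ge0 ?p2_ge0 // invr_ge0 ltW.
  apply/eqP; rewrite -leye_eq.
  apply: (@le_trans _ _ (\prod_(j < m) \sum_(i <oo) (b j i * 2 ^- i.+1)%:E)%E).
    rewrite leye_eq; apply/eqP; apply: (prode_eq_pinfty (i0 := j0)) => [|j jj0].
      apply: nneseries_eq_pinfty => [i|M]; first by rewrite mulr_ge0 // invr_ge0 exprn_ge0.
      have E1 : - 1 < Q * (e + c 0 j0).
        by rewrite -ltr_pdivrMl // mulrN1.
      pose L := cc `^ Q / K j0 / 2.
      have L0 : 0 < L by rewrite !divr_gt0 ?powR_gt0.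
      have [N hN] := sum_powR_unbounded n0 (M / L) E1; exists N.
      rewrite ler_pdivrMr // mulrC in hN; apply: (le_trans hN); rewrite mulr_sumr.
      apply: ler_sum => i _; rewrite /b eqxx; case: ifP => _; last by rewrite mulr0 mul0r.
      rewrite p2_nat exprS /L le_eqVlt; apply/orP; left; apply/eqP; field.
      by rewrite expf_neq0 ?pnatr_eq0 //= gt_eqF ?K0.
    apply: (@lt_le_trans _ _ (\sum_(0 <= i < 1) (b j i * 2 ^- i.+1)%:E)%E); last first.
      by apply: nneseries_lim_ge => i _ _; rewrite lee_fin mulr_ge0 // invr_ge0 exprn_ge0.
    by rewrite big_nat1 lte_fin /b (negbTE jj0) eqxx mulr_gt0 ?invr_gt0 // exprn_gt0.
  apply: integral_cube_ge => // t n dn; have ct := dyadic_cube dn.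
  have t0 j : 0 < tnth t j := dyadic_gt0 (dn j).
  set P := \prod_j (_ / _).
  have P0 : 0 <= P by rewrite prodr_ge0 // => j _; rewrite divr_ge0 ?powR_ge0.
  have Phi0 : (0 <= poweR (mixed_modulus q T k f t) Q * P%:E)%E.
    by rewrite mule_ge0 ?poweR_ge0 // lee_fin.
  have [[j [jj0 nj]]|/forallNP hj] := pselect (exists j, j != j0 /\ n j != 0%N).
    by rewrite (bigD1 j) //= /b (negbTE jj0) (negbTE nj) mul0r.
  have nj j : j != j0 -> n j = 0%N.
    by move=> jj0; apply/eqP/negPn/negP => h; apply: (hj j).
  have [n0n|nn0] := leqP n0 (n j0); last first.
    by rewrite (bigD1 j0) //= /b eqxx leqNgt nn0 mul0r.
  have t2 j : j != j0 -> 2^-1 <= tnth t j.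
    move=> jj0; have := dn j; rewrite nj // /dyadic /= in_itv /= => /andP[].
    by rewrite expr1.
  pose A := cc * (p2 (- (r 0 j0 * (n j0)%:R)) * (n j0).+1%:R `^ e).
  have A0 : 0 <= A by rewrite mulr_ge0 ?(ltW cc0) // mulr_ge0 ?p2_ge0 ?powR_ge0.
  apply: (@le_trans _ _ (A `^ Q * P)%:E); last first.
    rewrite EFinM lee_wpmul2r ?lee_fin // -poweR_EFin.
    by apply: poweR_le; [exact: ltW|rewrite lee_fin|exact: hom].
  rewrite lee_fin (bigD1 j0) //= /P [in leRHS](bigD1 j0) //= mulrA.
  apply: ler_pM => //.
  + by apply: prodr_ge0 => j _; exact: b0.
  + rewrite /b eqxx n0n.
    have [_ {}hK] := hK j0; have {}hK := hK _ _ (dn j0).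
    rewrite -ler_pdivrMl // in hK.
    apply: (le_trans _ (ler_wpM2l (powR_ge0 _ _) hK)).
    rewrite /A powRM ?(ltW cc0) ?mulr_ge0 ?p2_ge0 ?powR_ge0 // powRM ?p2_ge0 ?powR_ge0 //.
    rewrite p2_powR -powRrM.
    have n1 : (n j0).+1%:R != 0 :> R by [].
    rewrite [Q * (e + _)]mulrDr powRD ?n1 ?implybT // [e * Q]mulrC.
    have -> : p2 (n j0)%:R = p2 (- (r 0 j0 * (n j0)%:R) * Q) * p2 ((1 + Q * r 0 j0) * (n j0)%:R).
      by rewrite -p2D; congr p2; ring.
    by rewrite le_eqVlt; apply/orP; left; apply/eqP; ring.
  apply: ler_prod => j jj0; rewrite b0 /= /b (negbTE jj0) nj // eqxx.
  have [_ {}hK] := hK j; have {}hK := hK _ _ (dn j).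
  by rewrite -ler_pdivrMl // nj // mulr0 p20 powR1 mul1r mulr1 in hK.
rewrite invey /= oppr0 in he.
have /choice [K hK] : forall j, exists K : R, 0 < K /\ forall (t : R) (i : nat), dyadic i t ->
    p2 (r 0 j * i%:R) * i.+1%:R `^ c 0 j <= K * (t `^ (- r 0 j) * (1 - ln t) `^ c 0 j).
  move=> j; have [K K0 hK] := weight_dyadic (c 0 j) (r 0 j).
  by exists K; split => // t i dt; rewrite [t `^ _ * _]mulrC powRN; have [] := hK t i dt.
have K0 j : 0 < K j by have [] := hK j.
apply/eqyP => M M0.
pose L := cc * \prod_j (K j)^-1.
have L0 : 0 < L by rewrite mulr_gt0 // prodr_gt0 // => j _; rewrite invr_gt0.
have [N N0 hN] := powR_unbounded (M / L) he.
pose n := maxn n0 N.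
pose t : m.-tuple R := [tuple (if j == j0 then 2 ^- n.+1 else 2^-1) | j < m].
pose nn j := if j == j0 then n else 0%N.
have pow2 i : dyadic i (2 ^- i.+1 : R).
  rewrite /dyadic /= in_itv /= lexx /= ltf_pV2 ?posrE ?exprn_gt0 //.
  by rewrite ltr_eXn2l ?ltr1n.
have dn j : dyadic (nn j) (tnth t j).
  rewrite tnth_mktuple /nn; case: ifP => _; first exact: pow2.
  by have := pow2 0%N; rewrite expr1.
have ct := dyadic_cube dn.
apply: (@le_trans _ _ (mixed_modulus q T k f t *
   (\prod_j (tnth t j `^ (- r 0 j) * (1 - ln (tnth t j)) `^ c 0 j))%:E)%E); last first.
  by apply: ereal_sup_ubound; exists t.
set P := \prod_j (tnth t j `^ _ * _).
have P0 : 0 <= P by rewrite prodr_ge0 // => j _; rewrite mulr_ge0 ?powR_ge0.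
apply: (@le_trans _ _ ((cc * (p2 (- (r 0 j0 * n%:R)) * n.+1%:R `^ e)) * P)%:E); last first.
  rewrite EFinM lee_wpmul2r ?lee_fin //; apply: hom => //.
  - by have := dn j0; rewrite /nn eqxx.
  - exact: leq_maxl.
  - by move=> j jj0; rewrite tnth_mktuple (negbTE jj0).
rewrite lee_fin.
have hP : \prod_j ((K j)^-1 * (p2 (r 0 j * (nn j)%:R) * (nn j).+1%:R `^ c 0 j)) <= P.
  apply: ler_prod => j _; rewrite !mulr_ge0 ?invr_ge0 ?p2_ge0 ?powR_ge0 ?(ltW (K0 _)) //=.
  by rewrite ler_pdivrMl //; have [_ h] := hK j; exact: h.
have B0 : 0 <= cc * (p2 (- (r 0 j0 * n%:R)) * n.+1%:R `^ e).
  by rewrite mulr_ge0 ?(ltW cc0) // mulr_ge0 ?p2_ge0 ?powR_ge0.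
apply: (le_trans _ (ler_wpM2l B0 hP)); rewrite big_split /=.
have -> : \prod_j (p2 (r 0 j * (nn j)%:R) * (nn j).+1%:R `^ c 0 j) =
    p2 (r 0 j0 * n%:R) * n.+1%:R `^ c 0 j0.
  rewrite (bigD1 j0) //= big1 ?mulr1 /nn ?eqxx // => j /negbTE ->.
  by rewrite mulr0 p20 powR1 mulr1.
have {}hN := hN n.+1 (leqW (leq_maxr _ _)).
rewrite ler_pdivrMr // in hN; apply: (le_trans hN).
have n1 : n.+1%:R != 0 :> R by [].
rewrite powRD ?n1 ?implybT // /L p2N.
have X0 : p2 (r 0 j0 * n%:R) != 0 by rewrite gt_eqF // p2_gt0.
rewrite le_eqVlt; apply/orP; left; apply/eqP; by field.
Qed.

End seminorms.

(** * Choice of the parameters *)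

Section assembly.
Context {R : realType} {m : nat}.
Implicit Types (f : m.-tuple R -> R) (t : m.-tuple R) (k : 'rV[R]_m).

Lemma exists_smoothness k (al : 'rV[R]_m) : (forall j, 0 < k 0 j) -> (forall j, 0 < al 0 j) ->
  exists r : nat, [/\ (2 <= r)%N, forall j, k 0 j + 3 <= r%:R & forall j, al 0 j + 3 <= r%:R].
Proof.
move=> k0 a0; pose S := \sum_j (k 0 j + al 0 j) : R.
have hS j : k 0 j + al 0 j <= S.
  by rewrite /S (bigD1 j) //= lerDl sumr_ge0 // => i _; rewrite addr_ge0 // ltW.
have S0 : 0 <= S by rewrite sumr_ge0 // => i _; rewrite addr_ge0 // ltW.
have [r hr] := exists_nat_ge (S + 3); exists r; split.
- rewrite -(ler_nat R); lra.
- move=> j; have := hS j; have := a0 j; lra.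
- move=> j; have := hS j; have := k0 j; lra.
Qed.

(** Puts the bounds of the mixed modulus into the product form required
    by [besov_seminorm_lt]. *)
Lemma modulus_bound_dyadic (j0 : 'I_m) (C be e : R) k t (n : 'I_m -> nat) : 0 <= C ->
  (forall j, dyadic (n j) (tnth t j)) ->
  C * (p2 (- (be * (n j0)%:R)) * (n j0).+1%:R `^ e) *
    \prod_(j < m | j != j0) (tnth t j `^ k 0 j) <=
  \prod_j ((if j == j0 then C else 2 `^ `|k 0 j|) *
    (p2 (- ((if j == j0 then be else k 0 j) * (n j)%:R)) *
     (n j).+1%:R `^ (if j == j0 then e else 0))).
Proof.
move=> C0 dn; rewrite [leRHS](bigD1 j0) //= eqxx; apply: ler_wpM2l.
  by rewrite mulr_ge0 // mulr_ge0 ?p2_ge0 ?powR_ge0.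
apply: ler_prod => j /negbTE jj0; rewrite jj0 powR_ge0 /= powRr0 mulr1.
by have [] := powR_dyadic (k 0 j) (dn j).
Qed.

Lemma fine_inve_lt (theta : \bar R) (b : R) : (0 < theta)%E -> (theta^-1 < b%:E)%E ->
  fine theta^-1%E < b.
Proof.
case: theta => [Q| |] Q0 h; [|by move: h; rewrite invey /= lte_fin|by []].
rewrite lte_fin in Q0; by move: h; rewrite inver gt_eqF //= lte_fin.
Qed.

Lemma besov_intro (q T : R) theta (r c k : 'rV[R]_m) f : lorentz0 q T f ->
  (besov_seminorm q T theta r c k f < +oo)%E -> besov m q T theta r c k f.
Proof.
move=> hf hs; split; first exact: hf.
by have [[_ _ hn] _] := hf; exact: lte_add_pinfty.
Qed.

Lemma besov_elim (q T : R) theta (r c k : 'rV[R]_m) f :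
  (besov_seminorm q T theta r c k f = +oo)%E -> ~ besov m q T theta r c k f.
Proof.
move=> hs [_]; rewrite hs addey // gt_eqF //.
by rewrite (lt_le_trans _ (lorentz_norm_ge0 _ _ _)).
Qed.

End assembly.

Theorem theorem1p6 (R : realType) (m : nat) (hm : (0 < m)%N)
    (p0 p p1 tau0 tau1 tau : R) (theta : \bar R) (alpha b : 'rV[R]_m)
    (j0 : 'I_m)
    (hp0 : 1 < p0) (hp0p : p0 < p) (hpp1 : p < p1)
    (htau0 : 1 < tau0) (htau1 : 1 < tau1) (htau : 1 < tau)
    (htheta : (0 < theta)%E)
    (halpha : forall j, 0 < alpha 0 j)
    (hb : forall j, (theta^-1 < (b 0 j)%:E)%E) :
  (let v : 'rV[R]_m :=
     \row_j (- b 0 j + fine ((mine tau%:E theta)^-1)%E) in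
   let beta : 'rV[R]_m := \row_j (alpha 0 j + p0^-1 - p^-1) in
   forall k : 'rV[R]_m, (forall j, beta 0 j < k 0 j) ->
   mine tau%:E theta = tau%:E ->
   forall eps : R, 0 < eps ->
   exists f1 : m.-tuple R -> R,
     besov m p0 tau0 theta beta (v - eps *: delta_mx 0 j0) k f1 /\
     ~ log_lip m p tau theta alpha b f1)
  /\
  (let mu : 'rV[R]_m :=
     \row_j (- b 0 j + fine ((maxe tau%:E theta)^-1)%E) in
   let u : 'rV[R]_m := \row_j (alpha 0 j + p1^-1 - p^-1) in
   (forall j, 0 < u 0 j) ->
   forall k : 'rV[R]_m, (forall j, u 0 j < k 0 j) ->
   maxe tau%:E theta = tau%:E ->
   forall eps : R, 0 < eps ->
   exists f2 : m.-tuple R -> R,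
     log_lip m p tau theta alpha b f2 /\
     ~ besov m p1 tau1 theta u (mu + eps *: delta_mx 0 j0) k f2).
Proof.
have p00 : 0 < p0 by rewrite (lt_trans ltr01).
have pp0 : 0 < p by exact: lt_trans hp0p.
have pp1 : 1 < p by exact: lt_trans hp0p.
have p10 : 0 < p1 by exact: lt_trans hpp1.
have t0 : 0 < tau by rewrite (lt_trans ltr01).
have t00 : 0 < tau0 by rewrite (lt_trans ltr01).
have t10 : 0 < tau1 by rewrite (lt_trans ltr01).
have hib j : fine theta^-1%E < b 0 j := fine_inve_lt htheta (hb j).
have ip : p^-1 < p0^-1 by rewrite ltf_pV2 ?posrE.
have aj0 := halpha j0; have hib0 := hib j0.
set it := fine theta^-1%E in hib hib0.
pose gam := alpha 0 j0 - p^-1.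
split.
- move=> v beta k hk hmin eps e0.
  have hbeta j : 0 < beta 0 j by rewrite mxE; have := halpha j; lra.
  have k0 j : 0 < k 0 j by exact: lt_trans (hk j).
  have [r [r2 kr ar]] := exists_smoothness k0 halpha.
  (* The midpoint of the admissible range: the Lipschitz seminorm diverges below
     tau^-1 - b + it, the Besov seminorm converges above this value minus eps. *)
  pose lam := tau^-1 - b 0 j0 + it - eps / 2.
  have betaE : beta 0 j0 = gam + p0^-1 by rewrite mxE /gam; ring.
  have g0 : 0 < gam + p0^-1 by rewrite -betaE.
  have gk : gam + p0^-1 < k 0 j0 by rewrite -betaE.
  pose f := testfun r (spike j0 gam lam) (fun j => mean r (spike j0 gam lam j)).
  exists f; split.
    apply: besov_intro; first exact: lorentz0_testfun.
    have [C C0 hC] := mixed_modulus_sub_le lam hp0 t00 k0 kr g0 gk.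
    apply: (@besov_seminorm_lt _ _ _ _ _ _ _ _ _ (fun j => if j == j0 then C else 2 `^ `|k 0 j|)
      (fun j => if j == j0 then gam + p0^-1 else k 0 j) (fun j => if j == j0 then - lam else 0)) => //.
    + by move=> j; case: ifP => _; [exact: ltW|exact: powR_ge0].
    + move=> t n dn; have ct := dyadic_cube dn.
      apply: (le_trans (hC _ t (n j0) ct (dn j0))); rewrite lee_fin.
      by apply: modulus_bound_dyadic => //; exact: ltW.
    + move=> j; case: eqVneq => [->|jj0]; last by left.
      right; split; first by rewrite betaE.
      by rewrite !mxE hmin fine_invr !eqxx mulr1 -/it /lam; lra.
  rewrite log_lipE; apply: besov_elim.
  have [c1 [n0 [c10 h1]]] := mixed_modulus_critical_ge j0 lam pp0 t0 halpha ar.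
  apply: (@besov_seminorm_pinfty _ _ j0 _ _ _ _ _ _ _ c1 (tau^-1 - lam) n0) => //.
    by move=> t n _ dn nn t2; exact: h1.
  rewrite mxE -/it /lam; lra.
move=> mu u hu k hk hmax eps e0.
have k0 j : 0 < k 0 j by exact: lt_trans (hk j).
have [r [r2 kr ar]] := exists_smoothness k0 halpha.
(* d < eps makes the Besov seminorm diverge, d < b - 1/theta gives lam tau < 1. *)
pose d := Num.min eps (b 0 j0 - it) / 2.
have [d0 [d1 d2]] : 0 < d /\ d < eps /\ d < b 0 j0 - it.
  rewrite /d; set M := Num.min _ _.
  have M0 : 0 < M by rewrite lt_min e0 subr_gt0.
  have [] : M <= eps /\ M <= b 0 j0 - it by split; rewrite ge_min lexx ?orbT.
  by move=> *; do !split; lra.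
pose lam := tau^-1 - b 0 j0 + it + d.
have lt1 : lam * tau < 1 by rewrite -ltr_pdivlMr // mul1r /lam; lra.
have uE : u 0 j0 = gam + p1^-1 by rewrite mxE /gam; ring.
have g0 : 0 < gam + p^-1 by rewrite /gam subrK.
pose f := testfun r (spike j0 gam lam) (fun j => mean r (spike j0 gam lam j)).
exists f; split.
  rewrite log_lipE; apply: besov_intro; first exact: lorentz0_testfun.
  have [C C0 hC] := mixed_modulus_critical_le j0 pp1 t0 halpha ar lt1.
  apply: (@besov_seminorm_lt _ _ _ _ _ _ _ _ _ (fun j => if j == j0 then C else 2 `^ `|alpha 0 j|)
    (fun j => if j == j0 then alpha 0 j0 else alpha 0 j)
    (fun j => if j == j0 then tau^-1 - lam else 0)) => //.
  + by move=> j; case: ifP => _; [exact: ltW|exact: powR_ge0].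
  + move=> t n dn; have ct := dyadic_cube dn.
    apply: (le_trans (hC _ t (n j0) ct (dn j0))); rewrite lee_fin.
    by apply: modulus_bound_dyadic => //; exact: ltW.
  + move=> j; right; case: eqVneq => [->|jj0]; split=> //; rewrite mxE -/it.
      by rewrite /lam; lra.
    by rewrite add0r ltrN2.
apply: besov_elim.
have [c1 [n0 [c10 h1]]] := mixed_modulus_sub_ge j0 gam lam p10 t10 k0 kr.
apply: (@besov_seminorm_pinfty _ _ j0 _ _ _ _ _ _ _ c1 (- lam) n0) => //.
  by move=> t n _ dn nn t2; rewrite uE; exact: h1.
by rewrite !mxE hmax fine_invr !eqxx mulr1 -/it /lam; lra.
Qed.
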